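(* Let $(\mathcal{E}^{(\infty)}_I,\mathcal{D}^{(\infty)}_I)$ be the Dirichlet form on $L^2(I^{(\infty)},\nu)$ associated with the trace onto the half-line $I^{(\infty)}=[0,\infty)$ of the standard resistance form (equivalently, of the Brownian motion) on the infinite Sierpinski gasket. Then its jump kernel $J^{(\infty)}$ is given by $$J^{(\infty)}(x,y)=\frac{35}{16}\cdot\frac{14}{17}\Big(\frac{20}{3}\Big)^{n-1}\qquad\text{if } (x,y)\in\bigcup_{i\in\mathbb{N}}S_{n,i},\ n\in\mathbb{Z};$$ that is, with this $J^{(\infty)}$, $$\mathcal{E}^{(\infty)}_I(u,v)=\int_{I^{(\infty)}}\int_{I^{(\infty)}}(u(x)-u(y))(v(x)-v(y))J^{(\infty)}(x,y)\,\nu(dx)\nu(dy)$$ for any $u,v\in\mathcal{D}^{(\infty)}_I$.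
   Context: Resistance forms. For a set $A$, $\ell(A)=\{f: A\to\mathbb{R}\}$. For a quadratic (symmetric bilinear) form write $\mathcal{Q}(u)=\mathcal{Q}(u,u)$; the form is determined by its diagonal part. A resistance form $(\mathcal{E},\mathcal{F})$ on a set $X$: (RF1) $\mathcal{F}$ is a linear subspace of $\ell(X)$ containing constants, $\mathcal{E}$ is a non-negative symmetric quadratic form on $\mathcal{F}$, and $\mathcal{E}(f)=0$ iff $f$ is constant; (RF2) $\mathcal{F}$ modulo constants with $\mathcal{E}$ is a Hilbert space; (RF3) $\mathcal{F}$ separates points; (RF4) $R_{\mathcal{E}}(x,y)=\sup\{|f(x)-f(y)|^2/\mathcal{E}(f): f\in\mathcal{F},\mathcal{E}(f)\ne0\}<\infty$; (RF5) if $f\in\mathcal{F}$ then $\overline f=\min(\max(f,0),1)\in\mathcal{F}$ and $\mathcal{E}(\overline f)\le\mathcal{E}(f)$. For non-empty $Y\subseteq X$, the trace of $(\mathcal{E},\mathcal{F})$ on $Y$ is the resistance form $([\mathcal{E}]_Y,[\mathcal{F}]_Y)$ with $[\mathcal{F}]_Y=\{u|_Y:u\in\mathcal{F}\}$ and $[\mathcal{E}]_Y(v)=\inf\{\mathcal{E}(u):u\in\mathcal{F},u|_Y=v\}$. Sierpinski gasket. $p_0=(0,0)$, $p_1=(1,0)$, $p_2=(\frac12,\frac{\sqrt3}2)$, $F_i(z)=\frac12(z-p_i)+p_i$; $K$ is the unique non-empty compact set with $K=F_0(K)\cup F_1(K)\cup F_2(K)$. For $w=w_1\ldots w_m\in W_m=\{0,1,2\}^m$,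 $F_w=F_{w_1}\circ\cdots\circ F_{w_m}$. $V_0=\{p_0,p_1,p_2\}$, $V_m=\bigcup_{w\in W_m}F_w(V_0)$, $E_m=\{(F_w(p_i),F_w(p_j)): i\ne j, w\in W_m\}$, and $\mathcal{E}_m(u)=\frac12(\frac53)^m\sum_{(x,y)\in E_m}(u(x)-u(y))^2$ for $u\in\ell(V_m)$. Infinite Sierpinski gasket. $\rho_0^{(m)}(z)=2^mz$, $K^{(m)}=\rho_0^{(m)}(K)$, $K^{(\infty)}=\bigcup_{m\ge0}K^{(m)}$, $V^{(m)}_m=\rho_0^{(m)}(V_{2m})$, $p_i^{(m)}=2^mp_i$ for $i=1,2$, and for $u\in\ell(V_m^{(m)})$ $$\mathcal{Q}^{(m)}(u)=\Big(\frac35\Big)^m\mathcal{E}_{2m}(u\circ\rho_0^{(m)})+\frac56\Big(\frac35\Big)^m(u(p_1^{(m)})-u(p_2^{(m)}))^2.$$ The values $\mathcal{Q}^{(m)}(u|_{V^{(m)}_m})$ are non-decreasing in $m$. The standard resistance form on $K^{(\infty)}$ is $(\mathcal{E}^{(\infty)},\mathcal{F}^{(\infty)})$ with $\mathcal{F}^{(\infty)}=\{u\in C(K^{(\infty)}):\lim_{m\to\infty}\mathcal{Q}^{(m)}(u|_{V^{(m)}_m})<\infty\}$ and $\mathcal{E}^{(\infty)}(u)=\lim_{m\to\infty}\mathcal{Q}^{(m)}(u|_{V_m^{(m)}})$. Trace on the half-line. $I^{(\infty)}=[0,\infty)$ is identified with $[0,\infty)\times\{0\}\subseteq K^{(\infty)}$;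 $\nu$ is Lebesgue measure on $I^{(\infty)}$; $(\mathcal{E}^{(\infty)}_I,\mathcal{F}^{(\infty)}_I)=([\mathcal{E}^{(\infty)}]_{I^{(\infty)}},[\mathcal{F}^{(\infty)}]_{I^{(\infty)}})$. $C_0(I^{(\infty)})$ denotes continuous functions with compact support. $\mathcal{D}^{(\infty)}_I$ is the closure of $\mathcal{F}^{(\infty)}_I\cap C_0(I^{(\infty)})$ in $\mathcal{F}^{(\infty)}_I\cap L^2(I^{(\infty)},\nu)$ with respect to the norm $\sqrt{\mathcal{E}_*}$, $\mathcal{E}_*(u)=\mathcal{E}^{(\infty)}_I(u)+\int_{I^{(\infty)}}u^2\,d\nu$. Partition. For $i\in\mathbb{N}=\{1,2,\ldots\}$ and $n\in\mathbb{Z}$, $\underline{S}_{n,i}=(\frac{2i-1}{2^n},\frac{2i}{2^n}]\times[\frac{2i-2}{2^n},\frac{2i-1}{2^n})$, $\overline{S}_{n,i}=[\frac{2i-2}{2^n},\frac{2i-1}{2^n})\times(\frac{2i-1}{2^n},\frac{2i}{2^n}]$, $S_{n,i}=\underline{S}_{n,i}\cup\overline{S}_{n,i}$. The sets $S_{n,i}$ are pairwise disjoint and their union is $(I^{(\infty)})^2\setminus\{(x,x):x\in I^{(\infty)}\}$, so $J^{(\infty)}$ is defined off the diagonal. *)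

(* Defs.v *)
From HB Require Import structures.
From mathcomp Require Export all_boot all_order all_algebra.
From mathcomp Require Export all_classical all_reals all_analysis.
Export numFieldNormedType.Exports.

Set Implicit Arguments.
Unset Strict Implicit.
Unset Printing Implicit Defensive.

Import Order.TTheory GRing.Theory Num.Theory.
Local Open Scope classical_set_scope.
Local Open Scope ring_scope.

(* A function on a subset A of T is represented by a total function on T; only
   its values on A matter in everything below. *)

Section Trace.
Variables (R : realType) (T : Type).

(* A quadratic form is given by its diagonal part E, with domain F. *)
Definition trace_dom (F : set (T -> R)) (Y : set T) : set (T -> R) :=
  [set v | exists2 u, F u & {in Y, u =1 v}].

Definition trace_form (E : (T -> R) -> \bar R) (F : set (T -> R)) (Y : set T)
    (v : T -> R) : \bar R :=
  ereal_inf [set E u | u in [set u | F u /\ {in Y, u =1 v}]].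

(* Polarization: the symmetric bilinear form with diagonal part E. *)
Definition polar (E : (T -> R) -> \bar R) (u v : T -> R) : R :=
  4^-1 * (fine (E (u \+ v)) - fine (E (u \- v))).

End Trace.

Section Gasket.
Variable R : realType.
Implicit Types (z : R * R) (m : nat) (K : set (R * R)).

Definition vertex (i : 'I_3) : R * R :=
  nth (0, 0) [:: (0, 0); (1, 0); (2^-1, Num.sqrt 3 / 2)] i.

Definition contraction (i : 'I_3) z : R * R :=
  2^-1 *: (z - vertex i) + vertex i.

Definition contraction_word (w : seq 'I_3) z : R * R := foldr contraction z w.

Definition is_gasket K : Prop :=
  [/\ K !=set0, compact K & K = \bigcup_i (contraction i @` K)].

Definition edges m : set ((R * R) * (R * R)) :=
  [set e | exists (w : m.-tuple 'I_3) (i j : 'I_3), i != j /\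
     e = (contraction_word w (vertex i), contraction_word w (vertex j))].

Definition gasket_energy m (u : R * R -> R) : R :=
  2^-1 * (5 / 3) ^+ m * \sum_(e \in edges m) (u e.1 - u e.2) ^+ 2.

Definition dilation m z : R * R := 2 ^+ m *: z.

Definition infinite_gasket K : set (R * R) := \bigcup_m (dilation m @` K).

Definition infinite_gasket_energy m (u : R * R -> R) : R :=
  (3 / 5) ^+ m * gasket_energy (2 * m) (u \o dilation m)
  + 5 / 6 * (3 / 5) ^+ m
    * (u (dilation m (vertex 1)) - u (dilation m (vertex 2))) ^+ 2.

Definition Einf (u : R * R -> R) : \bar R :=
  limn (fun m => (infinite_gasket_energy m u)%:E).

Definition Finf K : set (R * R -> R) :=
  [set u : R * R -> R | {within infinite_gasket K, continuous u} /\ (Einf u < +oo)%E].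

End Gasket.

Section HalfLine.
Variable R : realType.
Implicit Types (K : set (R * R)) (u v : R -> R).

Definition half_line : set R := `[0, +oo[.

Definition half_line_plane : set (R * R) := half_line `*` [set 0].

(* u \o fst is the function on half_line_plane that corresponds to u under the
   identification of x with (x, 0). *)
Definition FI K : set (R -> R) :=
  [set u : R -> R | trace_dom (Finf K) half_line_plane (u \o fst)].

Definition EI K u : \bar R :=
  trace_form (@Einf R) (Finf K) half_line_plane (u \o fst).

Definition C0 : set (R -> R) :=
  [set u : R -> R | {within half_line, continuous u} /\
           compact (closure [set x | half_line x /\ u x != 0])].

Definition L2 : set (R -> R) :=
  [set u : R -> R | measurable_fun half_line u /\
    (\int[lebesgue_measure]_(x in half_line) (u x ^+ 2)%R%:E < +oo)%E].

Definition normEI K u : \bar R :=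
  sqrte (EI K u + \int[lebesgue_measure]_(x in half_line) (u x ^+ 2)%R%:E)%E.

Definition DI K : set (R -> R) :=
  [set u : R -> R | (FI K `&` L2) u /\
    forall eps : R, 0 < eps ->
      exists2 w, (FI K `&` C0) w & (normEI K (u \- w)%R < eps%:E)%E].

Definition cell_lower (n : int) (i : nat) : set (R * R) :=
  `](2 * i%:R - 1) / 2 ^ n, (2 * i%:R) / 2 ^ n] `*`
  `[(2 * i%:R - 2) / 2 ^ n, (2 * i%:R - 1) / 2 ^ n[.

Definition cell_upper (n : int) (i : nat) : set (R * R) :=
  `[(2 * i%:R - 2) / 2 ^ n, (2 * i%:R - 1) / 2 ^ n[ `*`
  `](2 * i%:R - 1) / 2 ^ n, (2 * i%:R) / 2 ^ n].

Definition cell (n : int) (i : nat) : set (R * R) := cell_lower n i `|` cell_upper n i.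

End HalfLine.

(* Main.v *)
From mathcomp Require Import ring lra zify measurable_realfun.
Require Import Defs.

(**
The trace form is computed explicitly in terms of dyadic means, first from the
gasket and then from the jump kernel, and the two expressions are compared.

Let C be a cell of side h of the gasket whose bottom edge is the dyadic interval
I = [k h, (k + 1) h], let u be a function on I, and fix the value t at the top
corner of C.  The least renormalized energy of a function on C with these data is

   S(u, I) + 7/3 (t - mean of u over I)^2,

where S(u, I) = 5/3 (S(u, I_l) + S(u, I_r) + 21/32 (mean over I_l - mean over
I_r)^2), with I_l and I_r the halves of I: [haar_sup] is S, and [haar] its
truncation at a finite depth.  This comes from minimizing over the values a and c
at the tops of the two lower subcells: the weight 7/3 is the fixed point of the
recursion b |-> 10/3 b / (1 + b), and 21/32 its companion for the difference of
the means.

The bound from below ([cell_energy_lower], [haar_le_Einf]) holds at every finite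
level, with the weights [beta] and [gamma] instead of their limits and
trapezoidal means instead of means; the key step is the completion of squares in
[cascade].  For the bound from above ([extension]) let u vanish beyond s = 2^M.
The minimizers a and c define the values at the tops of the cells along the
half-line, the harmonic rule (2 p + 2 q + r) / 5 defines all other values, and
the energy of the result is at most (3/5)^M (S + 2 (mean of u)^2) by
[trace_ext_energy] and [coarse_energy].  A maximum principle ([in_range_child])
and a contraction of oscillations ([osc_bound_step]) turn the values at lattice
points into a continuous function on the infinite gasket ([glue_continuous]).
Since the mean term disappears as M grows, the trace form of u is
sup_M (3/5)^M S(u, [0, 2^M]), written [limit_energy], first for u of compact
support and then, by Young's inequality, on the closure ([EI_approximable]).

On the side of the kernel, the cells S_{n,i} inside a dyadic square I x I are
arranged in a binary tree, and the kernel is multiplied by 20/3 when the side is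
halved.  The integral of (u(x) - u(y))^2 over a product of intervals is a
combination of variances and of the squared difference of means
([rectangle_integral]); summing over the tree yields

   c h^2 (136/245 S(u, I) - 3/7 Var(u, I))

as the integral over I x I, where c is the value of the kernel on the largest
cell ([piece_sumE], [strict_square_integral]); the variances at small scales
disappear because Var(u, I) <= 8/35 S(u, I).  For I = [0, 2^M] the constants
35/16 and 14/17 make the coefficient of S equal to (3/5)^M ([jump_coef_scale]),
and the variance term tends to 0 since u is square integrable.  Letting M tend to
infinity, the integral over the quadrant equals [limit_energy u].  Polarization
and Fubini's theorem give the statement.
*)

Import Order.TTheory GRing.Theory Num.Theory.
Local Open Scope classical_set_scope.
Local Open Scope ring_scope.

Set Implicit Arguments.
Unset Strict Implicit.
Unset Printing Implicit Defensive.

(** * Renormalized energies on the triangular lattice *)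

Section Cells.
Variable R : realType.
Implicit Types (g : nat -> nat -> nat -> R).

(** An array [g n k l] holds values at the points of the triangular lattice of
    mesh 2^-n, in the skew coordinates (k, l). The upward triangle (k, l) has
    the corners (k, l), (k + 1, l) and (k, l + 1); [tri] is the sum of the
    squared increments along its three sides. *)
Definition tri g n k l : R :=
  (g n k l - g n k.+1 l) ^+ 2 + (g n k l - g n k l.+1) ^+ 2
  + (g n k.+1 l - g n k l.+1) ^+ 2.

(** The energy, renormalized by 5/3 per step, of the values at the lattice
    points obtained from the triangle (k, l) of level n by m subdivisions of the
    gasket. *)
Fixpoint cell_energy g m n k l : R :=
  if m is m'.+1 then
    5 / 3 * (cell_energy g m' n.+1 k.*2 l.*2
             + cell_energy g m' n.+1 k.*2.+1 l.*2
             + cell_energy g m' n.+1 k.*2 l.*2.+1)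
  else tri g n k l.

(** Consistency of the levels: the point (k, l) of one mesh is the point (2k,
    2l) of the next. *)
Definition refines g := forall n k l, g n.+1 k.*2 l.*2 = g n k l.

Lemma tri_ge0 g n k l : 0 <= tri g n k l.
Proof. by rewrite /tri !addr_ge0 ?sqr_ge0. Qed.

Lemma cell_energy_ge0 g m n k l : 0 <= cell_energy g m n k l.
Proof.
elim: m n k l => [|m IH] n k l /=; first exact: tri_ge0.
by rewrite mulr_ge0 ?addr_ge0 ?IH //; lra.
Qed.

(** Subdivision with the factor 5/3 does not decrease the energy. The
    differences X, Y and Z of the new values from the harmonic ones, given by
    the 2-2-1 rule, turn the gap into a sum of squares. *)
Lemma tri_refine (a b c x y z : R) :
  (a - b) ^+ 2 + (a - c) ^+ 2 + (b - c) ^+ 2 <=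
  5 / 3 * (((a - x) ^+ 2 + (a - y) ^+ 2 + (x - y) ^+ 2)
           + ((x - b) ^+ 2 + (x - z) ^+ 2 + (b - z) ^+ 2)
           + ((y - z) ^+ 2 + (y - c) ^+ 2 + (z - c) ^+ 2)).
Proof.
pose X := x - (2 * a + 2 * b + c) / 5.
pose Y := y - (2 * a + b + 2 * c) / 5.
pose Z := z - (a + 2 * b + 2 * c) / 5.
have : 0 <= 2 * X ^+ 2 + 2 * Y ^+ 2 + 2 * Z ^+ 2
         + (X - Y) ^+ 2 + (X - Z) ^+ 2 + (Y - Z) ^+ 2.
  by do ![apply: addr_ge0]; rewrite ?sqr_ge0 //; apply: mulr_ge0; rewrite ?sqr_ge0.
rewrite /X /Y /Z; lra.
Qed.

Lemma cell_energyS g m n k l : refines g ->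
  cell_energy g m n k l <= cell_energy g m.+1 n k l.
Proof.
move=> gP; elim: m n k l => [|m IH] n k l; last first.
  by rewrite [leLHS]/= [leRHS]/=; apply: ler_wpM2l; [lra | rewrite !lerD // IH].
rewrite /= /tri -!doubleS !gP.
exact: tri_refine.
Qed.

Lemma cell_energy_le g m m' n k l : refines g -> (m <= m')%N ->
  cell_energy g m n k l <= cell_energy g m' n k l.
Proof.
move=> gP /subnK <-; elim: (m' - m)%N => // j IH.
by rewrite addSn; apply: le_trans IH _; apply: cell_energyS.
Qed.

(** The coordinates of the 3^m cells of level m of the gasket. *)
Fixpoint cells m : seq (nat * nat) :=
  if m is m'.+1 then
    flatten [seq [:: (p.1.*2, p.2.*2); (p.1.*2.+1, p.2.*2); (p.1.*2, p.2.*2.+1)]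
            | p <- cells m']
  else [:: (0%N, 0%N)].

Lemma cell_energy_cells g m j :
  cell_energy g (m + j) 0 0 0 =
  (5 / 3) ^+ m * \sum_(p <- cells m) cell_energy g j m p.1 p.2.
Proof.
elim: m j => [|m IH] j; first by rewrite /= big_seq1 expr0 mul1r.
rewrite addSnnS IH /= big_flatten /= big_map exprSr -mulrA; congr (_ * _).
by rewrite big_distrr /=; apply: eq_bigr => p _; rewrite !big_cons big_nil /= addr0 addrA.
Qed.

End Cells.

Lemma mem_cellsS m k l : (k, l) \in cells m.+1 ->
  (k./2, l./2) \in cells m /\ ~~ (odd k && odd l).
Proof.
move=> /= /flattenP[_ /mapP[[a b] abm ->]]; rewrite !inE /= => /or3P[] /eqP[-> ->];
  by rewrite /= ?doubleK ?uphalf_double ?doubleK /= ?odd_double ?andbF.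
Qed.

Lemma uniq_cells m : uniq (cells m).
Proof.
elim: m => //= m; elim: (cells m) => //= p s IH /andP[pNs us].
rewrite IH // !inE !negb_or !xpair_eqE andbT.
have nin x : x \in flatten [seq [:: (p0.1.*2, p0.2.*2); (p0.1.*2.+1, p0.2.*2);
    (p0.1.*2, p0.2.*2.+1)] | p0 <- s] -> (x.1./2, x.2./2) \in s.
  move=> /flattenP[_ /mapP[[a b] abm ->]]; rewrite !inE /= => /or3P[] /eqP-> /=;
  by rewrite ?doubleK ?uphalf_double.
case: p pNs => [a b] /= pNs.
have nin' x : (x.1./2, x.2./2) = (a, b) -> x \notin flatten [seq [:: (p0.1.*2, p0.2.*2);
    (p0.1.*2.+1, p0.2.*2); (p0.1.*2, p0.2.*2.+1)] | p0 <- s].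
  by move=> xab; apply: contra pNs => /nin; rewrite xab.
rewrite !nin' /= ?doubleK ?uphalf_double //.
by apply/and3P; split; try lia; apply/and3P; split; lia.
Qed.

(** * The vertices of the gasket as lattice points *)

Section Lattice.
Variable R : realType.
Implicit Types (u : R * R -> R) (h : R).

(** The point of the plane with skew coordinates (k, l) in the triangular
    lattice of mesh h. *)
Definition lattice_pt h (k l : nat) : R * R :=
  (h * (k%:R + l%:R / 2), h * (l%:R * (Num.sqrt 3 / 2))).

Lemma sqrt3_gt0 : 0 < Num.sqrt 3 :> R.
Proof. by rewrite sqrtr_gt0. Qed.

Lemma lattice_pt_inj h k l k' l' : 0 < h ->
  lattice_pt h k l = lattice_pt h k' l' -> k = k' /\ l = l'.
Proof.
move=> h0 [].
move=> /(mulfI (lt0r_neq0 h0)) e1 /(mulfI (lt0r_neq0 h0)) /mulIf e2.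
have ll : l = l'.
  apply/eqP; rewrite -(eqr_nat R); apply/eqP/e2.
  by rewrite mulf_neq0 // ?invr_neq0 // lt0r_neq0 // sqrt3_gt0.
move: e1; rewrite ll => /addIr /eqP; rewrite eqr_nat => /eqP ->; by [].
Qed.

Lemma lattice_pt_double h k l : lattice_pt (h / 2) k.*2 l.*2 = lattice_pt h k l.
Proof. by rewrite /lattice_pt -!muln2 !natrM; congr pair; field. Qed.

(** [dx i] and [dy i] are the skew coordinates of the vertex p_i of the unit
    triangle. *)
Definition dx (i : 'I_3) : nat := (i == 1).
Definition dy (i : 'I_3) : nat := (i == 2%:R).

Lemma vertexE (i : 'I_3) : vertex R i = lattice_pt 1 (dx i) (dy i).
Proof.
rewrite /lattice_pt /dx /dy !mul1r.
by case: i => [[|[|[|//]]] ?]; rewrite /vertex /= ?mul0r ?mul1r ?addr0 ?add0r.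
Qed.

(** The i-th subcell of the cell p, in coordinates of the next level. *)
Definition child (p : nat * nat) (i : 'I_3) : nat * nat :=
  (p.1.*2 + dx i, p.2.*2 + dy i)%N.

(** The coordinates of the cell F_w(K). *)
Definition pos (w : seq 'I_3) : nat * nat := foldl child (0%N, 0%N) w.

Lemma contraction_wordE w z :
  contraction_word w z = lattice_pt (2^-1 ^+ size w) (pos w).1 (pos w).2
                         + 2^-1 ^+ size w *: z.
Proof.
elim/last_ind: w z => [|w i IH] z.
  by rewrite /= /lattice_pt /= !mulr0n /= !mul0r addr0 !mulr0 scale1r add0r.
rewrite /contraction_word foldr_rcons -/(contraction_word _ _) IH /contraction.
rewrite vertexE size_rcons /pos foldl_rcons -/(pos w) exprSr.
rewrite /lattice_pt /child /=; congr pair; rewrite /= /GRing.scale /= !natrD -!muln2 !natrM;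
  by field; rewrite ?expf_neq0.
Qed.

Lemma mem_cells_pos m p : reflect (exists2 w, size w = m & p = pos w) (p \in cells m).
Proof.
apply: (iffP idP) => [|[w <- ->]]; last first.
  elim/last_ind: w => [|w i IH] //.
  rewrite size_rcons /pos foldl_rcons -/(pos w) /=.
  apply/flattenP; eexists; first by apply: map_f IH.
  rewrite !inE /child /dx /dy.
  by case: i => [[|[|[|//]]] ?]; rewrite /= ?addn0 ?addn1 eqxx ?orbT.
elim: m p => [|m IH] p /=; first by rewrite inE => /eqP ->; exists [::].
case/flattenP => _ /mapP[q qm ->].
have [w sw qE] := IH _ qm.
rewrite !inE => /or3P[] /eqP ->.
- exists (rcons w ord0); first by rewrite size_rcons sw.
  by rewrite /pos foldl_rcons -/(pos w) -qE /child /dx /dy /= !addn0.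
- exists (rcons w 1); first by rewrite size_rcons sw.
  by rewrite /pos foldl_rcons -/(pos w) -qE /child /dx /dy /= addn0 addn1.
- exists (rcons w 2%:R); first by rewrite size_rcons sw.
  by rewrite /pos foldl_rcons -/(pos w) -qE /child /dx /dy /= addn0 addn1.
Qed.

(** The ordered pairs of distinct indices of vertices. *)
Definition dirs : seq ('I_3 * 'I_3) :=
  [:: (0, 1); (1, 0); (0, 2%:R); (2%:R, 0); (1, 2%:R); (2%:R, 1)].

(** The ordered edges of level m, listed without repetition. *)
Definition edge_seq m : seq ((R * R) * (R * R)) :=
  [seq (lattice_pt (2^-1 ^+ m) (p.1 + dx e.1) (p.2 + dy e.1),
        lattice_pt (2^-1 ^+ m) (p.1 + dx e.2) (p.2 + dy e.2)) | p <- cells m, e <- dirs].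

Lemma contraction_word_vertex w (i : 'I_3) :
  contraction_word w (vertex R i) =
  lattice_pt (2^-1 ^+ size w) ((pos w).1 + dx i) ((pos w).2 + dy i).
Proof.
rewrite contraction_wordE vertexE /lattice_pt !natrD /=.
by congr pair; rewrite /= -[_ *: _]/(_ * _); field; rewrite ?expf_neq0 //.
Qed.

Lemma mem_dirs (i j : 'I_3) : ((i, j) \in dirs) = (i != j).
Proof.
by case: i => [[|[|[|//]]] ?]; case: j => [[|[|[|//]]] ?]; rewrite /dirs !inE !xpair_eqE.
Qed.

Lemma edgesE m : @edges R m = [set` edge_seq m].
Proof.
apply/seteqP; split => e /=.
  move=> [w [i [j [ij ->]]]]; apply/allpairsP.
  exists (pos w, (i, j)); split; rewrite /= ?mem_dirs //.
    by apply/mem_cells_pos; exists w => //; rewrite size_tuple.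
  by rewrite !contraction_word_vertex size_tuple.
move=> /allpairsP[[p [i j]] [/= /mem_cells_pos[w sw ->]]]; rewrite mem_dirs => ij ->.
have sw' : size w == m by rewrite sw.
exists (Tuple sw'), i, j; split => //=.
by rewrite !contraction_word_vertex sw.
Qed.

Lemma uniq_edge_seq m : uniq (edge_seq m).
Proof.
apply: allpairs_uniq; [exact: uniq_cells|by []|].
have h0 : 0 < (2^-1 : R) ^+ m by rewrite exprn_gt0.
move=> _ _ /allpairsP[[[a b] [i j]] [_ + ->]] /allpairsP[[[a' b'] [i' j']] [_ + ->]].
rewrite /= !mem_dirs => nij nij' E.
have /(lattice_pt_inj h0)[e1 e2] := congr1 fst E; have /(lattice_pt_inj h0)[e3 e4] := congr1 snd E.
have [ii jj aa bb] : [/\ i = i', j = j', a = a' & b = b'].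
  move: i j i' j' nij nij' e1 e2 e3 e4 {E}.
  do 4! case=> [[|[|[|//]]] ?]; rewrite /dx /dy //= => _ _ e1 e2 e3 e4;
    try (exfalso; lia); split; try lia; exact: val_inj.
by rewrite ii jj aa bb.
Qed.

(** The sum over edges in the energy of the gasket, in recursive form. The
    factor 1/2 compensates for the two orientations of each edge. *)
Lemma gasket_energyE m u :
  gasket_energy m u = cell_energy (fun n k l => u (lattice_pt (2^-1 ^+ n) k l)) m 0 0 0.
Proof.
rewrite -[m in RHS]addn0 cell_energy_cells /gasket_energy edgesE -fsbig_seq ?uniq_edge_seq //.
rewrite -mulrA [LHS]mulrCA; congr (_ * _).
rewrite /edge_seq big_allpairs_dep big_distrr /=; apply: eq_bigr => p _.
rewrite /dirs !big_cons big_nil /= /tri /dx /dy /= !addn0 !addn1; by field.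
Qed.

End Lattice.

(** * Cells of the infinite gasket *)

Section Geometry.
Variable R : realType.
Implicit Types (z : R * R) (h : R) (K : set (R * R)).

(** [skew1 z] and [skew2 z] are the skew coordinates of a point of the plane in
    the lattice of mesh 1. *)
Definition skew2 z : R := z.2 / (Num.sqrt 3 / 2).
Definition skew1 z : R := z.1 - skew2 z / 2.

(** z lies in the closed triangle with corners [lattice_pt h k l], [lattice_pt h
    k.+1 l] and [lattice_pt h k l.+1]. *)
Definition in_cell h (k l : nat) z :=
  [/\ h * k%:R <= skew1 z, h * l%:R <= skew2 z & skew1 z + skew2 z <= h * (k + l).+1%:R].

Lemma skew2_lin h z z' : skew2 (h *: z + z') = h * skew2 z + skew2 z'.
Proof. by rewrite /skew2 /= -[_ *: _]/(_ * _) mulrDl mulrA. Qed.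

Lemma skew1_lin h z z' : skew1 (h *: z + z') = h * skew1 z + skew1 z'.
Proof. by rewrite /skew1 skew2_lin /= -[_ *: _]/(_ * _); ring. Qed.

Lemma s32_neq0 : Num.sqrt 3 / 2 != 0 :> R.
Proof. by rewrite mulf_neq0 ?invr_neq0 // lt0r_neq0 // sqrt3_gt0. Qed.

Lemma skew2_lattice_pt h k l : skew2 (lattice_pt h k l) = h * l%:R.
Proof. by rewrite /skew2 /= [h * (_ * _)]mulrA mulfK // s32_neq0. Qed.

Lemma skew1_lattice_pt h k l : skew1 (lattice_pt h k l) = h * k%:R.
Proof. by rewrite /skew1 skew2_lattice_pt /=; ring. Qed.

Lemma continuous_skew2 : continuous skew2.
Proof. by move=> z; apply: cvgMr_tmp; exact: cvg_snd. Qed.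

Lemma continuous_skew1 : continuous skew1.
Proof.
move=> z; apply: cvgB; first exact: cvg_fst.
by apply: cvgMr_tmp; exact: continuous_skew2.
Qed.

Lemma contraction_in K (i : 'I_3) z : is_gasket K -> K z -> K (contraction i z).
Proof. by move=> [_ _ KE] Kz; rewrite KE; exists i => //; exists z. Qed.

(** A continuous function that every contraction turns into its half plus a
    constant is bounded on the gasket by twice the largest constant. *)
Lemma gasket_bound K (f : R * R -> R) (c : 'I_3 -> R) C z : is_gasket K ->
  continuous f -> (forall i z, f (contraction i z) = f z / 2 + c i) ->
  (forall i, c i <= C / 2) -> K z -> f z <= C.
Proof.
move=> [K0 Kc KE] fc fi c1 Kz.
(* The maximum is attained at a point of the i-th copy of K, so that it is at
   most its own half plus c i. *)
have [y yK ymax] := compact_EVT_max K0 Kc (continuous_subspaceT fc).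
rewrite inE in yK; have := yK; rewrite KE => -[i _ [y' Ky' y'E]].
have := ymax y'; rewrite inE => /(_ Ky'); have := ymax z; rewrite inE => /(_ Kz).
have := fi i y'; rewrite y'E; have := c1 i; lra.
Qed.

Lemma skew2_contraction (i : 'I_3) z : skew2 (contraction i z) = skew2 z / 2 + (dy i)%:R / 2.
Proof.
rewrite /skew2 /contraction vertexE /lattice_pt /= -![_ *: _]/(_ * _); field.
by rewrite lt0r_neq0 // sqrt3_gt0.
Qed.

Lemma skew1_contraction (i : 'I_3) z : skew1 (contraction i z) = skew1 z / 2 + (dx i)%:R / 2.
Proof.
rewrite {1}/skew1 skew2_contraction /skew1 /contraction vertexE /lattice_pt /=.
by rewrite -![_ *: _]/(_ * _); field.
Qed.

Lemma gasket_triangle K z : is_gasket K -> K z -> in_cell 1 0 0 z.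
Proof.
move=> gK Kz.
have dd (i : 'I_3) : 0 <= (dx i)%:R :> R /\ 0 <= (dy i)%:R :> R /\
    (dx i)%:R + (dy i)%:R <= 1 :> R.
  rewrite !ler0n -natrD (ler_nat R _ 1); split => //; split => //.
  by case: i => [[|[|[|//]]] ?].
split; rewrite ?mulr0n ?mulr0 ?mul1r.
- rewrite -oppr_le0; apply: (gasket_bound (f := fun z => - skew1 z)
    (c := fun i => - ((dx i)%:R / 2)) gK) => // [x|i x|i].
  + by apply: cvgN; exact: continuous_skew1.
  + by rewrite skew1_contraction; field.
  + by have [? _] := dd i; lra.
- rewrite -oppr_le0; apply: (gasket_bound (f := fun z => - skew2 z)
    (c := fun i => - ((dy i)%:R / 2)) gK) => // [x|i x|i].
  + by apply: cvgN; exact: continuous_skew2.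
  + by rewrite skew2_contraction; field.
  + by have [_ [? _]] := dd i; lra.
- apply: (gasket_bound (f := fun z => skew1 z + skew2 z)
    (c := fun i => (dx i)%:R / 2 + (dy i)%:R / 2) gK) => // [x|i x|i].
  + by apply: cvgD; [exact: continuous_skew1 | exact: continuous_skew2].
  + by rewrite skew1_contraction skew2_contraction; field.
  + by have [_ [_ ?]] := dd i; lra.
Qed.

Lemma gasket_word K z j : is_gasket K -> K z ->
  exists w z', [/\ size w = j, K z' & z = contraction_word w z'].
Proof.
move=> gK Kz; elim: j => [|j [w [z' [sw Kz' ->]]]]; first by exists [::], z.
have [_ _ KE] := gK; have [i _ [y Ky <-]] : (\bigcup_i (contraction i @` K)) z' by rewrite -KE.
exists (rcons w i), y; rewrite size_rcons sw; split => //.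
by rewrite [RHS]/contraction_word foldr_rcons.
Qed.

(** (k, l) is the position of a cell of some level of the gasket. As p_0 is the
    origin, it is then the position of a cell of every later level, so that
    these positions are those of the cells of the infinite gasket, at every
    scale. *)
Definition ok (k l : nat) := exists m, (k, l) \in cells m.

Lemma ok0 : ok 0 0. Proof. by exists 0%N. Qed.

Lemma ok_child k l (i : 'I_3) : ok k l -> ok (k.*2 + dx i)%N (l.*2 + dy i)%N.
Proof.
move=> [m /mem_cells_pos[w sw wE]]; exists m.+1; apply/mem_cells_pos.
by exists (rcons w i); rewrite ?size_rcons ?sw // /pos foldl_rcons -/(pos w) -wE.
Qed.

Lemma ok_half k l : ok k l -> ok k./2 l./2 /\ ~~ (odd k && odd l).
Proof.
move=> [[|m] klm].
  by move: klm; rewrite inE => /eqP[-> ->]; split => //; exact: ok0.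
by have [? ?] := mem_cellsS klm; split => //; exists m.
Qed.

Lemma gasket_in_cell K z j : is_gasket K -> K z ->
  exists k l, ok k l /\ in_cell (2^-1 ^+ j) k l z.
Proof.
move=> gK Kz; have [w [z' [sw Kz' ->]]] := gasket_word j gK Kz.
exists (pos w).1, (pos w).2; split.
  by exists j; apply/mem_cells_pos; exists w => //; case: (pos w).
have [/= t1 t2 t3] := gasket_triangle gK Kz'.
have h0 : 0 < (2^-1 : R) ^+ j by rewrite exprn_gt0.
rewrite contraction_wordE sw addrC.
rewrite /in_cell skew2_lin skew1_lin skew2_lattice_pt skew1_lattice_pt -addn1 !natrD.
move: t1 t2 t3; rewrite ?mulr0n ?mulr0 ?mul1r => t1 t2 t3; split; nra.
Qed.

Lemma geometric_lt (C q e : R) : 0 <= q < 1 -> 0 < e ->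
  \forall n \near \oo, C * q ^+ n < e.
Proof.
move=> /andP[q0 q1] e0.
have : (fun n => C * q ^+ n) @ \oo --> C * 0.
  by apply: cvgMl_tmp; apply: cvg_expr; rewrite ger0_norm.
by rewrite mulr0 => /cvgr_lt; apply.
Qed.

(** The gasket contains its bottom edge. *)
Lemma half_segment K x : is_gasket K -> 0 <= x <= 1 -> K (x, 0).
Proof.
move=> gK x01; have [[z0 Kz0] Kc _] := gK.
pose C := 1 + `|z0.1| + `|z0.2|.
(* n steps of the binary expansion of y bring a point of K within C / 2^n of (y,
   0). *)
have near n y : 0 <= y <= 1 -> exists2 z, K z &
    `|y - z.1| <= C * 2^-1 ^+ n /\ `|z.2| <= C * 2^-1 ^+ n.
  elim: n y => [|n IH] y y01.
    exists z0 => //; rewrite expr0 mulr1 /C.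
    have := ler_normB y z0.1; rewrite (ger0_norm (x := y)); last by lra.
    have := normr_ge0 z0.1; have := normr_ge0 z0.2; split; lra.
  have [yh|yh] := lerP y 2^-1.
    have [|z Kz [z1 z2]] := IH (y * 2); first lra.
    exists (contraction ord0 z); first exact: contraction_in.
    have -> : contraction ord0 z = (z.1 / 2, z.2 / 2).
      by rewrite /contraction /vertex /= subr0 addr0; congr pair;
        rewrite /= -[_ *: _]/(_ * _) mulrC.
    rewrite /= exprSr mulrA; split; last by rewrite normrM (ger0_norm (x := 2^-1)) //; nra.
    rewrite (_ : y - z.1 / 2 = (y * 2 - z.1) / 2); last by field.
    by rewrite normrM (ger0_norm (x := 2^-1)) //; nra.
  have [|z Kz [z1 z2]] := IH (y * 2 - 1); first lra.
  exists (contraction 1 z); first exact: contraction_in.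
  have -> : contraction 1 z = ((z.1 + 1) / 2, z.2 / 2).
    by rewrite /contraction /vertex /=; congr pair; rewrite /= -[_ *: _]/(_ * _); field.
  rewrite /= exprSr mulrA; split; last by rewrite normrM (ger0_norm (x := 2^-1)) //; nra.
  rewrite (_ : y - _ / 2 = (y * 2 - 1 - z.1) / 2); last by field.
  by rewrite normrM (ger0_norm (x := 2^-1)) //; nra.
have Kcl : closed K by apply: compact_closed => //; exact: norm_hausdorff.
apply: Kcl => B /nbhs_ballP[e /= e0 eB].
have [n Hn] : exists n, C * 2^-1 ^+ n < e.
  have hq : 0 <= (2^-1 : R) < 1 by lra.
  have [N _ HN] := geometric_lt C hq e0.
  by exists N; apply: HN => /=.
have [z Kz [z1 z2]] := near n x x01.
exists z; split => //; apply: eB; split => /=; rewrite -ball_normE /ball_ /=.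
  exact: le_lt_trans z1 Hn.
by rewrite sub0r normrN; exact: le_lt_trans z2 Hn.
Qed.

Lemma dilation_sub K m m' : is_gasket K -> (m <= m')%N ->
  dilation m @` K `<=` dilation m' @` K.
Proof.
move=> gK /subnK <-; elim: (m' - m)%N => // j IH z /IH [y Ky <-].
exists (contraction ord0 y); first exact: contraction_in.
by rewrite /dilation /contraction /vertex /= subr0 addr0 scalerA exprSr mulfK.
Qed.

(** At every scale 2^M / 2^n, the cells cover the infinite gasket. *)
Lemma infinite_gasket_in_cell K z M n : is_gasket K -> infinite_gasket K z ->
  exists k l, ok k l /\ in_cell (2 ^+ M / 2 ^+ n) k l z.
Proof.
move=> gK [m _ zm].
have [y Ky <-] : (dilation (m + M) @` K) z by apply: dilation_sub zm => //; exact: leq_addr.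
have [k [l [okkl [y1 y2 y3]]]] := gasket_in_cell (m + n) gK Ky.
exists k, l; split => //.
have dE : dilation (m + M) y = 2 ^+ (m + M) *: y + 0 by rewrite addr0.
have c0 : skew1 (0 : R * R) = 0 /\ skew2 (0 : R * R) = 0 by rewrite /skew1 /skew2 /= !mul0r subrr.
rewrite /in_cell dE skew1_lin skew2_lin c0.1 c0.2 !addr0.
have -> : (2 ^+ M / 2 ^+ n : R) = 2 ^+ (m + M) * 2^-1 ^+ (m + n).
  by rewrite exprVn !exprD; field; rewrite !expf_neq0.
have h0 : 0 < (2 : R) ^+ (m + M) by rewrite exprn_gt0.
by rewrite -!mulrA -mulrDr !ler_pM2l.
Qed.

Lemma half_line_sub_gasket K : is_gasket K ->
  half_line_plane (R := R) `<=` infinite_gasket K.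
Proof.
move=> gK [x y] [/= + ->]; rewrite /half_line /= in_itv /= andbT => x0.
have [m xm] : exists m, x <= 2 ^+ m.
  have hq : 0 <= (2^-1 : R) < 1 by lra.
  have [N _ /(_ N (leqnn N)) /= p] := geometric_lt x hq (@ltr01 R).
  by exists N; rewrite ltW //; move: p; rewrite exprVn ltr_pdivrMr ?mul1r // exprn_gt0.
exists m => //; exists (x / 2 ^+ m, 0).
  apply: half_segment => //; rewrite divr_ge0 ?exprn_ge0 //=.
  by rewrite ler_pdivrMr ?mul1r // exprn_gt0.
rewrite /dilation; congr pair; rewrite /= -[_ *: _]/(_ * _) ?mulr0 //.
by rewrite mulrC divfK // expf_neq0.
Qed.

End Geometry.

(** * Means over dyadic intervals *)

Section Means.
Variable R : realType.
Implicit Types (u v : R -> R) (h e x y : R) (k : nat).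

Notation mu := (@lebesgue_measure R).

(** The dyadic interval [h k, h (k + 1)]. *)
Definition seg h k : set R := `[h * k%:R, h * k.+1%:R].

(** The mean of u over [seg h k]. *)
Definition mean u h k : R := h^-1 * \int[mu]_(x in seg h k) u x.

Lemma segP h k x : seg h k x <-> h * k%:R <= x <= h * k.+1%:R.
Proof. by rewrite /seg /= in_itv. Qed.

Lemma measurable_seg h k : measurable (seg h k).
Proof. exact: measurable_itv. Qed.
#[local] Hint Resolve measurable_seg : core.

Lemma seg_integrable u h k : continuous u -> mu.-integrable (seg h k) (EFin \o u).
Proof.
move=> cu; apply: continuous_compact_integrable; first exact: segment_compact.
exact: continuous_subspaceT.
Qed.

Lemma seg_double h k : h / 2 * k.*2%:R = h * k%:R.
Proof. by rewrite -muln2 natrM; field. Qed.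

Lemma mulnatS h k : h * k.+1%:R = h * k%:R + h.
Proof. by rewrite -addn1 natrD mulrDr mulr1. Qed.

Lemma seg_left h k x : 0 < h -> seg (h / 2) k.*2 x -> seg h k x.
Proof.
move=> h0 /segP; rewrite seg_double mulnatS seg_double => xk.
by apply/segP; rewrite mulnatS; lra.
Qed.

Lemma seg_right h k x : 0 < h -> seg (h / 2) k.*2.+1 x -> seg h k x.
Proof.
move=> h0 /segP; rewrite -doubleS seg_double mulnatS seg_double => xk.
by apply/segP; lra.
Qed.

Lemma seg_cases h k x : seg h k x -> seg (h / 2) k.*2 x \/ seg (h / 2) k.*2.+1 x.
Proof.
move=> /segP /andP[xk xk1].
have [xm|xm] := lerP x (h / 2 * k.*2.+1%:R); [left|right]; apply/segP.
  by rewrite seg_double xk.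
by rewrite -doubleS seg_double (ltW xm).
Qed.

Lemma mean_split u h k : 0 < h -> continuous u ->
  mean u h k = (mean u (h / 2) k.*2 + mean u (h / 2) k.*2.+1) / 2.
Proof.
move=> h0 cu; rewrite /mean.
have H : \int[mu]_(x in seg h k) u x - \int[mu]_(x in seg (h / 2) k.*2) u x
    = \int[mu]_(x in seg (h / 2) k.*2.+1) u x.
  rewrite /seg -doubleS !seg_double.
  have iv : mu.-integrable `]h / 2 * k.*2.+1%:R, h * k.+1%:R] (EFin \o u).
    apply: (integrableS _ _ _ (@seg_integrable u (h / 2) k.*2.+1 cu)) => //;
      try exact: measurable_itv.
    by rewrite /seg -doubleS !seg_double => x /=; rewrite !in_itv /= => /andP[/ltW -> ->].
  rewrite -(Rintegral_itv_obnd_cbnd iv).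
  rewrite Rintegral_itvB //; first exact: seg_integrable.
    rewrite bnd_simp -[in leLHS]seg_double ler_pM2l ?ler_nat //; lra.
  by rewrite bnd_simp -[in leRHS]seg_double ler_pM2l ?ler_nat ?doubleS //; lra.
rewrite -mulrDr -H addrCA subrr addr0; field.
by rewrite lt0r_neq0.
Qed.

Lemma measure_seg h k : 0 < h -> mu (seg h k) = h%:E.
Proof.
move=> h0; have := @lebesgue_measure_itv R `[h * k%:R, h * k.+1%:R].
rewrite /= lte_fin ltr_pM2l // ltr_nat leqnn -EFinD (_ : _ - _ = h) //; last first.
  by rewrite mulnatS addrAC subrr add0r.
Qed.

Lemma mean_cst h k (c : R) : 0 < h -> mean (fun=> c) h k = c.
Proof.
move=> h0; rewrite /mean Rintegral_cst; last exact: measurable_seg.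
transitivity (h^-1 * (c * h)); last by rewrite mulrCA mulVf ?mulr1 // lt0r_neq0.
congr (_ * (_ * _)).
exact: (congr1 fine (measure_seg k h0)).
Qed.

Lemma meanD u v h k : continuous u -> continuous v ->
  mean (u \+ v) h k = mean u h k + mean v h k.
Proof.
move=> cu cv; rewrite /mean RintegralD ?mulrDr //;
  first [exact: measurable_seg | exact: seg_integrable].
Qed.

Lemma meanB u v h k : continuous u -> continuous v ->
  mean (u \- v) h k = mean u h k - mean v h k.
Proof.
move=> cu cv; rewrite /mean RintegralB ?mulrBr //;
  first [exact: measurable_seg | exact: seg_integrable].
Qed.

Lemma meanZ u h k (c : R) : continuous u ->
  mean (fun x => c * u x) h k = c * mean u h k.
Proof.
move=> cu; rewrite /mean [RHS]mulrCA; congr (_ * _).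
by apply: RintegralZl; [exact: measurable_seg | exact: seg_integrable].
Qed.

Lemma le_mean u v h k : 0 < h -> continuous u -> continuous v ->
  (forall x, seg h k x -> u x <= v x) -> mean u h k <= mean v h k.
Proof.
move=> h0 cu cv uv; rewrite ler_pM2l ?invr_gt0 //.
by apply: le_Rintegral => //; first [exact: measurable_seg | exact: seg_integrable].
Qed.

Lemma mean_ge u h k (c : R) : 0 < h -> continuous u ->
  (forall x, seg h k x -> c <= u x) -> c <= mean u h k.
Proof.
by move=> h0 cu uc; rewrite -[leLHS](mean_cst k c h0); apply: le_mean => //; exact: cst_continuous.
Qed.

Lemma mean_le u h k (c : R) : 0 < h -> continuous u ->
  (forall x, seg h k x -> u x <= c) -> mean u h k <= c.
Proof.
by move=> h0 cu uc; rewrite -[leRHS](mean_cst k c h0); apply: le_mean => //; exact: cst_continuous.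
Qed.

(** Uniform continuity on [0, A]. *)
Lemma heine u (A e : R) : continuous u -> 0 < e ->
  exists2 d : R, 0 < d & forall x y, 0 <= x <= A -> 0 <= y <= A -> `|x - y| <= d ->
    `|u x - u y| <= e.
Proof.
move=> cu e0.
have /compact_near_coveringP/(_ R (0^'+)
   (fun d x => forall y, `|x - y| <= d -> `|u x - u y| <= e)) := @segment_compact R 0 A.
move=> /(_ _)[].
  move=> x _.
  have /cvgrPdist_lt /(_ (e / 2)) := cu x.
  move=> /(_ ltac:(lra)) /nbhs_ballP[d /= d0 dP].
  exists (ball x (d / 2), [set t | t < d / 2]); first split => /=.
  - by apply/nbhsx_ballx; lra.
  - by apply: nbhs_right_lt; lra.
  move=> [x' t] /= [xx' td] y yt.
  have h1 : `|u x - u x'| < e / 2.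
    by apply: dP; apply: le_ball xx'; lra.
  have h2 : `|u x - u y| < e / 2.
    apply: dP; rewrite -ball_normE /ball_ /=; move: xx'; rewrite -ball_normE /ball_ /= => xx'.
    by have := ler_distD x' x y; lra.
  by have := ler_distD (u x) (u x') (u y); rewrite (distrC (u x') (u x)); lra.
move=> d /= d0 dP; exists (d / 2); first lra.
move=> x y xA yA xy; apply: (dP (d / 2) _ _ x _ y xy).
- by rewrite /= sub0r normrN gtr0_norm; lra.
- by lra.
- by rewrite /= in_itv.
Qed.

(** Points of [seg h k] at distance at most h / 2^m have values at distance at
    most e. *)
Definition osc u h k m e :=
  forall x y, seg h k x -> seg h k y -> `|x - y| <= h / 2 ^+ m -> `|u x - u y| <= e.

Lemma osc_near u h k e : 0 < h -> continuous u -> 0 < e ->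
  \forall m \near \oo, osc u h k m e.
Proof.
move=> h0 cu e0; have [d d0 dP] := heine (h * k.+1%:R) cu e0.
have hq : 0 <= (2^-1 : R) < 1 by lra.
have := geometric_lt h hq d0; apply: filter_app; near=> m.
rewrite exprVn => hm x y /segP xk /segP yk xy.
have hk0 : 0 <= h * k%:R by rewrite mulr_ge0 // ltW.
by apply: dP; lra.
Unshelve. all: by end_near. Qed.

Lemma osc_left u h k m e : 0 < h -> osc u h k m.+1 e -> osc u (h / 2) k.*2 m e.
Proof.
move=> h0 o x y xk yk xy; apply: o; [exact: seg_left|exact: seg_left|].
by apply: le_trans xy _; rewrite exprS invfM mulrA.
Qed.

Lemma osc_right u h k m e : 0 < h -> osc u h k m.+1 e -> osc u (h / 2) k.*2.+1 m e.
Proof.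
move=> h0 o x y xk yk xy; apply: o; [exact: seg_right|exact: seg_right|].
by apply: le_trans xy _; rewrite exprS invfM mulrA.
Qed.

Lemma osc0 u h k e x y : osc u h k 0 e -> seg h k x -> seg h k y -> `|u x - u y| <= e.
Proof.
move=> o xk yk; apply: o => //; rewrite expr0 divr1.
by move: xk yk => /segP + /segP; rewrite mulnatS ler_norml; lra.
Qed.

Lemma seg_l h k : 0 < h -> seg h k (h * k%:R).
Proof. by move=> h0; apply/segP; rewrite lexx ler_pM2l // ler_nat leqnSn. Qed.

Lemma seg_r h k : 0 < h -> seg h k (h * k.+1%:R).
Proof. by move=> h0; apply/segP; rewrite lexx andbT ler_pM2l // ler_nat leqnSn. Qed.

Lemma mean_osc u h k e x : 0 < h -> continuous u -> osc u h k 0 e -> seg h k x ->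
  `|u x - mean u h k| <= e.
Proof.
move=> h0 cu o xk.
have /(_ (u x - e)) := @mean_ge u h k _ h0 cu.
have /(_ (u x + e)) := @mean_le u h k _ h0 cu.
move=> /(_ _)/wrap[y yk|H1].
  by have := osc0 o xk yk; rewrite ler_norml; lra.
move=> /(_ _)/wrap[y yk|H2].
  by have := osc0 o xk yk; rewrite ler_norml; lra.
rewrite ler_norml; lra.
Qed.

End Means.

(** * The dyadic energy *)

Section Haar.
Variable R : realType.
Implicit Types (u v : R -> R) (h e x y : R) (k m N : nat).

(** The difference between the means over the two halves of [seg h k]. *)
Definition dmean u h k : R := mean u (h / 2) k.*2 - mean u (h / 2) k.*2.+1.

(** The dyadic energy of u on [seg h k], truncated at depth N. *)
Fixpoint haar u N h k : R :=
  if N is N'.+1 then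
    5 / 3 * (haar u N' (h / 2) k.*2 + haar u N' (h / 2) k.*2.+1
             + 21 / 32 * dmean u h k ^+ 2)
  else 0.

(** The sum of X over the dyadic intervals of generation N inside [seg h k],
    with the factor 5/3 per generation. *)
Fixpoint tree_sum (X : R -> nat -> R) N h k : R :=
  if N is N'.+1 then
    5 / 3 * (tree_sum X N' (h / 2) k.*2 + tree_sum X N' (h / 2) k.*2.+1)
  else X h k.

Lemma half_gt0 h : 0 < h -> 0 < h / 2. Proof. by move=> h0; rewrite divr_gt0. Qed.

Lemma haarS u N h k : haar u N h k <= haar u N.+1 h k.
Proof.
elim: N h k => [|N IH] h k.
  by rewrite /= !add0r; have := sqr_ge0 (dmean u h k); lra.
rewrite [leLHS]/= [leRHS]/=; apply: ler_wpM2l; first lra.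
by rewrite lerD2r lerD // IH.
Qed.

Lemma haar_nd u h k : nondecreasing_seq (fun N => haar u N h k).
Proof. by apply/nondecreasing_seqP => N; exact: haarS. Qed.

Lemma haar_ge0 u N h k : 0 <= haar u N h k.
Proof. exact: (haar_nd u h k (leq0n N)). Qed.

(** The dyadic energy of u on [seg h k] is finite. *)
Definition haar_bounded u h k := exists B : R, forall N, haar u N h k <= B.

(** The dyadic energy of u on [seg h k]. It is meaningful under [haar_bounded]
    only. *)
Definition haar_sup u h k : R := sup (range (fun N => haar u N h k)).

Lemma haar_sup_cvg u h k : haar_bounded u h k ->
  (fun N => haar u N h k) @ \oo --> haar_sup u h k.
Proof.
move=> [B HB]; apply: nondecreasing_cvgn; first exact: haar_nd.
by exists B => _ [N _ <-].
Qed.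

Lemma haar_le_haar_sup u h k N : haar_bounded u h k -> haar u N h k <= haar_sup u h k.
Proof.
move=> [B HB]; apply: ub_le_sup; first by exists B => _ [M _ <-].
by exists N.
Qed.

Lemma haar_sup_le u h k B : (forall N, haar u N h k <= B) -> haar_sup u h k <= B.
Proof.
move=> HB; apply: ge_sup; first by exists (haar u 0 h k), 0%N.
by move=> _ [N _ <-].
Qed.

Lemma haar_sup_ge0 u h k : haar_bounded u h k -> 0 <= haar_sup u h k.
Proof. by move=> /(haar_le_haar_sup 0). Qed.

Lemma haar_bounded_left u h k : haar_bounded u h k -> haar_bounded u (h / 2) k.*2.
Proof.
move=> [B HB]; exists B => N; apply: le_trans (HB N.+1); rewrite /=.
have := haar_ge0 u N (h / 2) k.*2; have := haar_ge0 u N (h / 2) k.*2.+1.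
by have := sqr_ge0 (dmean u h k); lra.
Qed.

Lemma haar_bounded_right u h k : haar_bounded u h k -> haar_bounded u (h / 2) k.*2.+1.
Proof.
move=> [B HB]; exists B => N; apply: le_trans (HB N.+1); rewrite /=.
have := haar_ge0 u N (h / 2) k.*2; have := haar_ge0 u N (h / 2) k.*2.+1.
by have := sqr_ge0 (dmean u h k); lra.
Qed.

(** Self-similarity of the dyadic energy. *)
Lemma haar_supE u h k : haar_bounded u h k ->
  haar_sup u h k = 5 / 3 * (haar_sup u (h / 2) k.*2 + haar_sup u (h / 2) k.*2.+1
                        + 21 / 32 * dmean u h k ^+ 2).
Proof.
move=> b; have cl := haar_sup_cvg (haar_bounded_left b).
have cr := haar_sup_cvg (haar_bounded_right b).
have c1 : (fun N => haar u N.+1 h k) @ \oo --> haar_sup u h k.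
  by have := haar_sup_cvg b; rewrite -(cvg_shiftS (fun N => haar u N h k)).
apply: (cvg_unique _ c1) => //=.
by apply: cvgMl_tmp; apply: cvgD; [exact: cvgD|exact: cvg_cst].
Qed.

(** When X is dominated by the dyadic energy, the sum of X over generation N is
    dominated by the tail of that energy beyond depth N, and hence tends to 0.
    *)
Lemma tree_sum_le X u (c : R) N h k : 0 <= c -> 0 < h ->
  (forall h k, 0 < h -> haar_bounded u h k -> X h k <= c * haar_sup u h k) ->
  haar_bounded u h k -> tree_sum X N h k <= c * (haar_sup u h k - haar u N h k).
Proof.
move=> c0 h0 HX; elim: N h k h0 => [|N IH] h k h0 b; first by rewrite subr0; exact: HX.
have := IH _ _ (half_gt0 h0) (haar_bounded_left b).
have := IH _ _ (half_gt0 h0) (haar_bounded_right b).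
rewrite (haar_supE b) /=; lra.
Qed.

Lemma tree_sum_ge0 X N h k : 0 < h -> (forall h k, 0 < h -> 0 <= X h k) ->
  0 <= tree_sum X N h k.
Proof.
move=> + X0; elim: N h k => [|N IH] h k h0 /=; first exact: X0.
by have := IH _ k.*2 (half_gt0 h0); have := IH _ k.*2.+1 (half_gt0 h0); lra.
Qed.

Lemma tree_sum_cvg0 X u (c : R) h k : 0 <= c -> 0 < h ->
  (forall h k, 0 < h -> 0 <= X h k) ->
  (forall h k, 0 < h -> haar_bounded u h k -> X h k <= c * haar_sup u h k) ->
  haar_bounded u h k -> (fun N => tree_sum X N h k) @ \oo --> (0 : R).
Proof.
move=> c0 h0 X0 HX b.
apply: (@squeeze_cvgr _ _ _ _ (fun=> 0) (fun N => c * (haar_sup u h k - haar u N h k))).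
- by apply: nearW => N; rewrite tree_sum_ge0 // (tree_sum_le N c0 h0 HX).
- exact: cvg_cst.
- rewrite -[X in _ --> X](mulr0 c) -[X in c * X](subrr (haar_sup u h k)).
  apply: cvgMl_tmp; apply: cvgB; first exact: cvg_cst.
  exact: haar_sup_cvg.
Qed.

(** Descending from [seg h k] to a dyadic interval around x changes the mean by
    |d| / 2 at each step, with d the value of [dmean]; r is the sum of these
    changes. The bound on r^2 follows inductively from (r + |d| / 2)^2 <= 5/3
    r^2 + 5/8 d^2. *)
Lemma pt_mean u N h k e x : 0 < h -> continuous u -> osc u h k N e -> seg h k x ->
  exists r, [/\ 0 <= r, `|u x - mean u h k| <= e + r & r ^+ 2 <= 4 / 7 * haar u N h k].
Proof.
move=> + cu; elim: N h k => [|N IH] h k h0 o xk.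
  by exists 0; rewrite addr0 expr0n /= mulr0; split => //; exact: mean_osc.
have h20 := half_gt0 h0.
(* 4/7 * 5/3 * 21/32 = 5/8. *)
have step (d r H1 H2 : R) : 0 <= r -> r ^+ 2 <= 4 / 7 * H1 -> 0 <= H2 ->
    (r + `|d| / 2) ^+ 2 <= 4 / 7 * (5 / 3 * (H1 + H2 + 21 / 32 * d ^+ 2)).
  rewrite -(real_normK (num_real d)) => r0 rH H20.
  have := sqr_ge0 (2 * r - 3 / 2 * `|d|); nra.
have ms := mean_split k h0 cu.
case: (seg_cases xk) => xk'.
  have [r [r0 ur rH]] := IH _ _ h20 (osc_left h0 o) xk'.
  exists (r + `|dmean u h k| / 2); split.
  - by rewrite addr_ge0 // divr_ge0.
  - have -> : u x - mean u h k = (u x - mean u (h / 2) k.*2) + dmean u h k / 2.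
      by rewrite ms /dmean; field.
    apply: le_trans (ler_normD _ _) _; rewrite addrA lerD // normrM.
    by rewrite (ger0_norm (x := 2^-1)).
  - by apply: step => //; exact: haar_ge0.
have [r [r0 ur rH]] := IH _ _ h20 (osc_right h0 o) xk'.
exists (r + `|dmean u h k| / 2); split.
- by rewrite addr_ge0 // divr_ge0.
- have -> : u x - mean u h k = (u x - mean u (h / 2) k.*2.+1) - dmean u h k / 2.
    by rewrite ms /dmean; field.
  apply: le_trans (ler_normB _ _) _; rewrite addrA lerD // normrM.
  by rewrite (ger0_norm (x := 2^-1)).
- rewrite /= [haar u N _ _ + haar u N _ _]addrC.
  by apply: step => //; exact: haar_ge0.
Qed.

Lemma pt_mean_le u h k x : 0 < h -> continuous u -> haar_bounded u h k -> seg h k x ->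
  (u x - mean u h k) ^+ 2 <= 8 / 7 * haar_sup u h k.
Proof.
move=> h0 cu b xk.
apply/ler_addgt0Pr => e e0.
pose d := Num.sqrt (e / 2).
have d0 : 0 < d by rewrite sqrtr_gt0; lra.
have d2 : d ^+ 2 = e / 2 by rewrite sqr_sqrtr; lra.
have [N _ /(_ N (leqnn N)) /= o] := osc_near k h0 cu d0.
have [r [r0 ur rH]] := pt_mean h0 cu o xk.
have H := haar_le_haar_sup N b.
rewrite -(real_normK (num_real (u x - _))).
have := normr_ge0 (u x - mean u h k); move: ur; set a := `|_| => ur a0.
have : a ^+ 2 <= (d + r) ^+ 2 by rewrite ler_sqr ?nnegrE // addr_ge0 // ltW.
by have := sqr_ge0 (d - r); nra.
Qed.

(** The variance of u over [seg h k]. *)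
Definition var u h k : R := mean (fun x => u x ^+ 2) h k - mean u h k ^+ 2.

Lemma continuous_sqr u : continuous u -> continuous (fun x => u x ^+ 2).
Proof.
move=> cu x; apply: (@continuous_comp _ _ _ u (fun y => y ^+ 2)); first exact: cu.
exact: exprn_continuous.
Qed.

Lemma mean_sqrB u h k c : 0 < h -> continuous u ->
  mean (fun x => (u x - c) ^+ 2) h k = var u h k + (mean u h k - c) ^+ 2.
Proof.
move=> h0 cu.
have -> : (fun x => (u x - c) ^+ 2) =
    ((fun x => u x ^+ 2) \- (fun x => (2 * c) * u x)) \+ (fun=> c ^+ 2).
  by apply/funext => x /=; ring.
have cu2 := continuous_sqr cu.
have cc : continuous (fun x => 2 * c * u x).
  by move=> x; apply: cvgMl_tmp; exact: cu.
rewrite meanD ?meanB // ?(meanZ _ _ _ cu) ?mean_cst //.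
- by rewrite /var; ring.
- by move=> x; apply: cvgB; [exact: cu2 | exact: cc].
- by move=> x; apply: cvg_cst.
Qed.

Lemma var_ge0 u h k : 0 < h -> continuous u -> 0 <= var u h k.
Proof.
move=> h0 cu; have := @mean_sqrB u h k (mean u h k) h0 cu.
rewrite subrr expr0n /= addr0 => <-; apply: mean_ge => // [|x _]; last exact: sqr_ge0.
by apply: continuous_sqr => x; apply: cvgB; [exact: cu | exact: cvg_cst].
Qed.

Lemma var_split u h k : 0 < h -> continuous u ->
  var u h k = (var u (h / 2) k.*2 + var u (h / 2) k.*2.+1) / 2 + dmean u h k ^+ 2 / 4.
Proof.
move=> h0 cu; rewrite /var /dmean !(mean_split k h0) //; last exact: continuous_sqr.
by field.
Qed.

(** By induction from [var_split]; the constant 8/35 solves 8/35 * 5/3 * 21/32 =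
    1/4. *)
Lemma var_osc u N h k e : 0 < h -> continuous u -> osc u h k N e ->
  var u h k <= 8 / 35 * haar u N h k + e ^+ 2.
Proof.
move=> + cu; elim: N h k => [|N IH] h k h0 o; last first.
  have := IH _ _ (half_gt0 h0) (osc_left h0 o).
  have := IH _ _ (half_gt0 h0) (osc_right h0 o).
  have := haar_ge0 u N (h / 2) k.*2; have := haar_ge0 u N (h / 2) k.*2.+1.
  rewrite (var_split k h0 cu) /=; lra.
rewrite /= mulr0 add0r.
have := @mean_sqrB u h k (u (h * k%:R)) h0 cu.
have : mean (fun x => (u x - u (h * k%:R)) ^+ 2) h k <= e ^+ 2.
  apply: mean_le => // [|x xk].
    by apply: continuous_sqr => x; apply: cvgB; [exact: cu | exact: cvg_cst].
  have := osc0 o xk (seg_l k h0); rewrite -(real_normK (num_real (u x - _))).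
  by move=> H; rewrite ler_sqr ?nnegrE // (le_trans _ H).
by have := sqr_ge0 (mean u h k - u (h * k%:R)); lra.
Qed.

Lemma var_le u h k : 0 < h -> continuous u -> haar_bounded u h k ->
  var u h k <= 8 / 35 * haar_sup u h k.
Proof.
move=> h0 cu b; apply/ler_addgt0Pr => e e0.
have d0 : 0 < Num.sqrt e by rewrite sqrtr_gt0.
have [N _ /(_ N (leqnn N)) /= o] := osc_near k h0 cu d0.
have := var_osc h0 cu o; rewrite sqr_sqrtr; last exact: ltW.
by have := haar_le_haar_sup N b; lra.
Qed.

End Haar.

(** * The energy on the gasket dominates the dyadic energy *)

Section LowerBound.
Variable R : realType.
Implicit Types (u v : R -> R) (f : R * R -> R) (h e x y s : R) (k m N : nat).

(** Weight of (t - mean)^2 in the least energy, after m subdivisions, of a cell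
    whose bottom row and top value t are prescribed. *)
Fixpoint beta m : R := if m is m'.+1 then 10 / 3 * (beta m' / (1 + beta m')) else 2.
(** Weight of the squared difference of the means over the two halves in that
    least energy, up to the factor 5/3. *)
Definition gamma m : R := 3 * beta m / (2 * (beta m + 3)).

Lemma beta_ge0 m : 0 <= beta m.
Proof. by elim: m => [|m IH] //=; rewrite mulr_ge0 // divr_ge0 // addr_ge0. Qed.

Lemma beta_err m : 0 <= 7 / 3 - beta m <= 2^-1 ^+ m.
Proof.
have H n : 0 <= 7 / 3 - beta n <= 2^-1 ^+ n /\ 2 <= beta n.
  elim: n => [|n [/andP[b0 bn] b2]] /=; first by rewrite expr0; split; lra.
  have e1 : 7 / 3 - 10 / 3 * (beta n / (1 + beta n)) = (7 / 3 - beta n) / (1 + beta n).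
    by field; apply/lt0r_neq0; lra.
  have e2 : (7 / 3 - beta n) / (1 + beta n) <= (7 / 3 - beta n) / 2.
    by rewrite ler_pdivrMr ?ler_pdivlMr //; nra.
  have e3 : 0 <= (7 / 3 - beta n) / (1 + beta n) by rewrite divr_ge0 //; lra.
  by rewrite exprSr; split; [rewrite e1; lra|lra].
by have [] := H m.
Qed.

Lemma beta_cvg : beta @ \oo --> (7 / 3 : R).
Proof.
have hq : 0 <= (2^-1 : R) < 1 by lra.
apply/cvgrPdist_lt => e e0; have := geometric_lt 1 hq e0.
apply: filter_app; near=> m; rewrite mul1r.
by have /andP[b1 b2] := beta_err m; rewrite ger0_norm //; lra.
Unshelve. all: by end_near. Qed.

Lemma gamma_cvg : gamma @ \oo --> (21 / 32 : R).
Proof.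
have -> : 21 / 32 = 3 * (7 / 3) / (2 * (7 / 3 + 3)) :> R by field.
apply: cvgM; first by apply: cvgMl_tmp; exact: beta_cvg.
apply: cvgV; first by apply/lt0r_neq0; lra.
apply: cvgMl_tmp; apply: cvgD; [exact: beta_cvg | exact: cvg_cst].
Qed.

(** The trapezoidal approximation of [mean u h k] with 2^m steps. *)
Fixpoint trapezoid u m h k : R :=
  if m is m'.+1 then (trapezoid u m' (h / 2) k.*2 + trapezoid u m' (h / 2) k.*2.+1) / 2
  else (u (h * k%:R) + u (h * k.+1%:R)) / 2.

Lemma trapezoid_osc u m h k e : 0 < h -> continuous u -> osc u h k m e ->
  `|trapezoid u m h k - mean u h k| <= e.
Proof.
move=> + cu; elim: m h k => [|m IH] h k h0 o /=.
  have := mean_osc h0 cu o (seg_l k h0); have := mean_osc h0 cu o (seg_r k h0).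
  by rewrite !ler_norml; lra.
have := IH _ _ (half_gt0 h0) (osc_left h0 o).
have := IH _ _ (half_gt0 h0) (osc_right h0 o).
by rewrite (mean_split k h0 cu) !ler_norml; lra.
Qed.

Lemma trapezoid_cvg u h k : 0 < h -> continuous u ->
  (fun m => trapezoid u m h k) @ \oo --> mean u h k.
Proof.
move=> h0 cu; apply/cvgrPdist_le => e e0.
have := osc_near k h0 cu e0; apply: filter_app; near=> m => o.
by rewrite distrC; exact: trapezoid_osc.
Unshelve. all: by end_near. Qed.

(** The counterpart of [haar u N h k] for a gasket of which only N + m
    subdivisions are taken into account. *)
Fixpoint discrete_haar u N m h k : R :=
  if N is N'.+1 then
    5 / 3 * (discrete_haar u N' m (h / 2) k.*2 + discrete_haar u N' m (h / 2) k.*2.+1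
       + gamma (N' + m) *
         (trapezoid u (N' + m) (h / 2) k.*2 - trapezoid u (N' + m) (h / 2) k.*2.+1) ^+ 2)
  else 0.

Lemma cvg_addl (a : R^nat) N (l : R) :
  a @ \oo --> l -> (fun m => a (N + m)%N) @ \oo --> l.
Proof.
move=> al; rewrite (_ : (fun m => _) = (fun m => a (m + N)%N)).
  by rewrite cvg_shiftn.
by apply/funext => m; rewrite addnC.
Qed.

Lemma discrete_haar_cvg u N h k : 0 < h -> continuous u ->
  (fun m => discrete_haar u N m h k) @ \oo --> haar u N h k.
Proof.
move=> + cu; elim: N h k => [|N IH] h k h0 /=; first exact: cvg_cst.
have h20 := half_gt0 h0.
apply: cvgMl_tmp; apply: cvgD; first by apply: cvgD; exact: IH.
have sq : (fun x : R => x ^+ 2) @ dmean u h k --> dmean u h k ^+ 2 by exact: exprn_continuous.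
apply: cvgM; first by apply: cvg_addl; exact: gamma_cvg.
apply: (cvg_comp _ _ _ sq); apply: cvgB; apply: (@cvg_addl (fun m => trapezoid u m _ _));
  exact: trapezoid_cvg.
Qed.

(** Minimization over the tops a and c of the two lower subcells, given the top
    t of the whole cell. At the minimum (a + c) / 2 is the mean of t and (mL +
    mR) / 2 with weights 1 and b, and a - c = b (mL - mR) / (b + 3). *)
Lemma cascade (b a c t mL mR : R) : 0 <= b ->
  3 * b / (2 * (b + 3)) * (mL - mR) ^+ 2
    + 3 / 5 * (10 / 3 * (b / (1 + b))) * (t - (mL + mR) / 2) ^+ 2
  <= b * (a - mL) ^+ 2 + b * (c - mR) ^+ 2
     + ((a - c) ^+ 2 + (a - t) ^+ 2 + (c - t) ^+ 2).
Proof.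
move=> b0; rewrite -subr_ge0.
have b1 : 0 < 1 + b by lra.
have b3 : 0 < b + 3 by lra.
pose m := (mL + mR) / 2.
have -> : b * (a - mL) ^+ 2 + b * (c - mR) ^+ 2 +
    ((a - c) ^+ 2 + (a - t) ^+ 2 + (c - t) ^+ 2) -
    (3 * b / (2 * (b + 3)) * (mL - mR) ^+ 2 +
     3 / 5 * (10 / 3 * (b / (1 + b))) * (t - (mL + mR) / 2) ^+ 2) =
  2 / (1 + b) * (b * ((a + c) / 2 - m) - (t - (a + c) / 2)) ^+ 2
  + (2 * (b + 3))^-1 * ((b + 3) * (a - c) - b * (mL - mR)) ^+ 2.
  by rewrite /m; field; rewrite !lt0r_neq0.
by rewrite addr_ge0 // mulr_ge0 ?sqr_ge0 ?invr_ge0 ?divr_ge0 //; lra.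
Qed.

(** Lower bound for the energy of any extension of u to a cell with bottom edge
    [seg (s / 2^n) k]; [g n k 1] is the value at its top. *)
Lemma cell_energy_lower (g : nat -> nat -> nat -> R) u s N m n k :
  refines g -> (forall n k, g n k 0%N = u (s / 2 ^+ n * k%:R)) ->
  discrete_haar u N m (s / 2 ^+ n) k
    + beta (N + m) * (g n k 1%N - trapezoid u (N + m) (s / 2 ^+ n) k) ^+ 2
  <= cell_energy g (N + m) n k 0.
Proof.
move=> rg gu.
have hS n' : s / 2 ^+ n' / 2 = s / 2 ^+ n'.+1 by rewrite exprSr invfM mulrA.
(* The upper subcell of a cell along the line joins the tops of the two lower
   subcells to the top of the cell. *)
have top j n' k' : (g n'.+1 k'.*2 1%N - g n'.+1 k'.*2.+1 1%N) ^+ 2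
    + (g n'.+1 k'.*2 1%N - g n' k' 1%N) ^+ 2
    + (g n'.+1 k'.*2.+1 1%N - g n' k' 1%N) ^+ 2 <= cell_energy g j n'.+1 k'.*2 1%N.
  apply: le_trans (cell_energy_le n'.+1 k'.*2 1 rg (leq0n j)).
  by rewrite /= /tri -(rg n' k' 1%N).
elim: N m n k => [|N IH] m n k.
  rewrite /= !add0n; elim: m n k => [|m IH] n k.
    by rewrite /= /tri !gu; set A := u _; set B := u _; have := sqr_ge0 (A - B); nra.
  have := IH n.+1 k.*2; have := IH n.+1 k.*2.+1; have := top m n k.
  have := cascade (g n.+1 k.*2 1%N) (g n.+1 k.*2.+1 1%N) (g n k 1%N)
    (trapezoid u m (s / 2 ^+ n.+1) k.*2) (trapezoid u m (s / 2 ^+ n.+1) k.*2.+1) (beta_ge0 m).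
  rewrite /= !add0r hS.
  have : 0 <= 3 * beta m / (2 * (beta m + 3)) *
    (trapezoid u m (s / 2 ^+ n.+1) k.*2 - trapezoid u m (s / 2 ^+ n.+1) k.*2.+1) ^+ 2.
    rewrite mulr_ge0 ?sqr_ge0 // divr_ge0 ?mulr_ge0 ?addr_ge0 ?beta_ge0 //.
  lra.
have := IH m n.+1 k.*2; have := IH m n.+1 k.*2.+1; have := top (N + m)%N n k.
have := cascade (g n.+1 k.*2 1%N) (g n.+1 k.*2.+1 1%N) (g n k 1%N)
    (trapezoid u (N + m) (s / 2 ^+ n.+1) k.*2) (trapezoid u (N + m) (s / 2 ^+ n.+1) k.*2.+1)
    (beta_ge0 (N + m)).
rewrite /= hS /gamma; lra.
Qed.

Lemma haar_le_energy (g : nat -> nat -> nat -> R) u s N B : 0 < s -> continuous u ->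
  refines g -> (forall n k, g n k 0%N = u (s / 2 ^+ n * k%:R)) ->
  (forall m, cell_energy g m 0 0 0 <= B) -> haar u N s 0 <= B.
Proof.
move=> s0 cu rg gu HB.
have c := @discrete_haar_cvg u N s 0 s0 cu.
rewrite -(cvg_lim _ c) //; apply: limr_le; first by apply/cvg_ex; eexists; exact: c.
apply: nearW => m; apply: le_trans (HB (N + m)%N).
have := cell_energy_lower N m 0 0 rg gu; rewrite expr0 divr1; apply: le_trans.
by rewrite lerDl mulr_ge0 ?sqr_ge0 ?beta_ge0.
Qed.

(** The values of f at the points of the lattice of mesh s / 2^n. *)
Definition lattice_vals f s n k l : R := f (lattice_pt (s / 2 ^+ n) k l).

Lemma lattice_vals_refines f s : refines (lattice_vals f s).
Proof. by move=> n k l; rewrite /lattice_vals exprSr invfM mulrA lattice_pt_double. Qed.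

Lemma cell_energy_shift (g : nat -> nat -> nat -> R) m n k l :
  cell_energy g m n.+1 k l = cell_energy (fun n => g n.+1) m n k l.
Proof. by elim: m n k l => [|m IH] n k l //=; rewrite !IH. Qed.

Lemma lattice_valsS f s : (fun n => lattice_vals f (2 * s) n.+1) = lattice_vals f s.
Proof.
apply/funext => n; apply/funext => k; apply/funext => l; rewrite /lattice_vals.
by rewrite exprS -mulf_div divff ?mul1r.
Qed.

Lemma cell_energy_lattice_vals f s m n k l :
  cell_energy (lattice_vals f (2 * s)) m n.+1 k l = cell_energy (lattice_vals f s) m n k l.
Proof. by rewrite cell_energy_shift lattice_valsS. Qed.

Lemma infinite_gasket_energyE m f :
  infinite_gasket_energy m f =
  (3 / 5) ^+ m * (cell_energy (lattice_vals f (2 ^+ m)) (2 * m) 0 0 0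
    + 5 / 6 * (lattice_vals f (2 ^+ m) 0 1 0 - lattice_vals f (2 ^+ m) 0 0 1) ^+ 2).
Proof.
have dl h k l : dilation m (lattice_pt h k l) = lattice_pt (2 ^+ m * h) k l.
  by rewrite /dilation /lattice_pt; congr pair; rewrite /= -[_ *: _]/(_ * _); ring.
rewrite /infinite_gasket_energy gasket_energyE mulrDr mulrA.
congr (_ * _ + _).
  congr cell_energy; apply/funext => n; apply/funext => k; apply/funext => l.
  by rewrite /lattice_vals /= dl exprVn.
rewrite /lattice_vals !vertexE !dl expr0 divr1 mulr1.
change (dx 1) with 1%N; change (dy 1) with 0%N.
by change (dx 2%:R) with 0%N; change (dy 2%:R) with 1%N; ring.
Qed.

(** The approximating energies increase. In the next level the additional edge,
    of conductance 5/6, joins two more distant points; together with the two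
    cells that separate them from the present level, it amounts to an edge of
    conductance 5/6 between the two old points, after renormalization. *)
Lemma energy_mono f m : infinite_gasket_energy m f <= infinite_gasket_energy m.+1 f.
Proof.
rewrite !infinite_gasket_energyE [(3 / 5) ^+ m.+1]exprSr -[X in _ <= X]mulrA.
rewrite ler_pM2l; last by rewrite exprn_gt0 //; lra.
rewrite mulnS -[(2 + _)%N]/((2 * m).+2) [2 ^+ m.+1]exprS.
set F := lattice_vals f (2 * 2 ^+ m); set j := (2 * m)%N.
have rF : refines F by exact: lattice_vals_refines.
have E k l : lattice_vals f (2 ^+ m) 0 k l = F 1%N k l by rewrite -lattice_valsS.
have e1 : cell_energy (lattice_vals f (2 ^+ m)) j 0 0 0 <= cell_energy F j.+1 1 0 0.
  by rewrite -cell_energy_lattice_vals; exact: cell_energyS.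
have h1 : tri F 1 1 0 <= cell_energy F j.+1 1 1 0 := cell_energy_le 1 1 0 rF (leq0n j.+1).
have h2 : tri F 1 0 1 <= cell_energy F j.+1 1 0 1 := cell_energy_le 1 0 1 rF (leq0n j.+1).
rewrite /tri in h1 h2; rewrite !E.
have -> : cell_energy F j.+2 0 0 0 = 5 / 3 * (cell_energy F j.+1 1 0 0 +
  cell_energy F j.+1 1 1 0 + cell_energy F j.+1 1 0 1) by [].
rewrite -(rF 0%N 1%N 0%N) -(rF 0%N 0%N 1%N) [1.*2]/= [0.*2]/=.
set a := F 1%N 1%N 0%N; set p := F 1%N 2%N 0%N; set q := F 1%N 1%N 1%N.
set b := F 1%N 0%N 1%N; set r := F 1%N 0%N 2%N.
move: h1 h2; rewrite -/a -/p -/q -/b -/r => h1 h2.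
(* The squares vanish at the values of p, q and r minimizing the energy of the
   next level for given a and b: q = (a + b) / 2, p + r = a + b and p - r = (a -
   b) / 3. *)
have := sqr_ge0 ((p - r) / 2 - (a - b) / 6).
pose c := (p + r - a - b) / 2; pose q' := q - (a + b) / 2.
have := sqr_ge0 c; have := sqr_ge0 (c - q'); have := sqr_ge0 q'.
rewrite /c /q'; lra.
Qed.

Lemma energy_nd f : nondecreasing_seq (fun m => infinite_gasket_energy m f).
Proof. by apply/nondecreasing_seqP => m; exact: energy_mono. Qed.

Lemma energy_ge0 f m : 0 <= infinite_gasket_energy m f.
Proof.
rewrite infinite_gasket_energyE; apply: mulr_ge0; first by rewrite exprn_ge0 //; lra.
by rewrite addr_ge0 ?cell_energy_ge0 //; apply: mulr_ge0; rewrite ?sqr_ge0 //; lra.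
Qed.

Lemma Einf_cvg f : (fun m => (infinite_gasket_energy m f)%:E) @ \oo -->
  ereal_sup (range (fun m => (infinite_gasket_energy m f)%:E)).
Proof.
by apply: ereal_nondecreasing_cvgn => i j ij; rewrite lee_fin; exact: energy_nd.
Qed.

Lemma energy_le_Einf f m : ((infinite_gasket_energy m f)%:E <= Einf f)%E.
Proof.
rewrite /Einf (cvg_lim _ (@Einf_cvg f)) //.
by apply: ereal_sup_ubound; exists m.
Qed.

Lemma Einf_le f (B : \bar R) : (forall m, ((infinite_gasket_energy m f)%:E <= B)%E) ->
  (Einf f <= B)%E.
Proof.
move=> HB; rewrite /Einf (cvg_lim _ (@Einf_cvg f)) //.
by apply: ge_ereal_sup => _ [m _ <-].
Qed.

Lemma cell_energy_dilate f s i j : 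
  (5 / 3) ^+ i * cell_energy (lattice_vals f s) j 0 0 0 <=
  cell_energy (lattice_vals f (2 ^+ i * s)) (i + j) 0 0 0.
Proof.
elim: i => [|i IH]; first by rewrite !expr0 !mul1r.
have -> : 2 ^+ i.+1 * s = 2 * (2 ^+ i * s) by rewrite exprS mulrA.
rewrite addSn [cell_energy _ _.+1 _ _ _]/= -[0.*2]/0%N cell_energy_lattice_vals.
rewrite [(5 / 3) ^+ i.+1]exprS -[X in X <= _]mulrA.
apply: ler_wpM2l; first lra.
by apply: le_trans IH _; rewrite -addrA lerDl addr_ge0 // cell_energy_ge0.
Qed.

(** The trace of f on the half-line has a dyadic energy bounded by the energy of
    f, on each interval [0, 2^M]. *)
Lemma haar_le_Einf f u N M (B : R) : continuous u ->
  (forall x, 0 <= x -> f (x, 0) = u x) ->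
  (forall m, infinite_gasket_energy m f <= B) -> (3 / 5) ^+ M * haar u N (2 ^+ M) 0 <= B.
Proof.
move=> cu fu HB.
have p0 : 0 < (3 / 5 : R) ^+ M by rewrite exprn_gt0 //; lra.
rewrite mulrC -ler_pdivlMr //.
have s0 : 0 < (2 : R) ^+ M by rewrite exprn_gt0.
apply: (haar_le_energy _ s0 cu (lattice_vals_refines f (2 ^+ M))) => [n k|m].
  by rewrite /lattice_vals /lattice_pt mulr0n !mul0r addr0 mulr0 fu.
apply: (le_trans (cell_energy_le 0 0 0 (lattice_vals_refines f _) (leq_addr (2 * M) m))).
rewrite ler_pdivlMr //; apply: le_trans (HB (m + M)%N).
rewrite infinite_gasket_energyE mulrDr.
have := cell_energy_dilate f (2 ^+ M) m (m + 2 * M).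
rewrite -exprD addnA (_ : (m + m + 2 * M)%N = (2 * (m + M))%N); last by lia.
move=> H; apply: (@le_trans _ _ ((3 / 5) ^+ (m + M) *
    cell_energy (lattice_vals f (2 ^+ (m + M))) (2 * (m + M)) 0 0 0)).
  set C := cell_energy _ (m + 2 * M) _ _ _ in H *.
  have pr : (3 / 5) ^+ m * (5 / 3) ^+ m = 1 :> R.
    by rewrite -exprMn (_ : 3 / 5 * (5 / 3) = 1) ?expr1n //; field.
  have -> : C * (3 / 5) ^+ M = (3 / 5) ^+ m * (3 / 5) ^+ M * ((5 / 3) ^+ m * C).
    by rewrite [RHS]mulrACA pr mul1r mulrC.
  by rewrite exprD ler_pM2l // mulr_gt0 // exprn_gt0 //; lra.
rewrite lerDl; apply: mulr_ge0; first by rewrite exprn_ge0 //; lra.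
by apply: mulr_ge0; rewrite ?sqr_ge0 //; lra.
Qed.

Lemma continuous_line K f : is_gasket K ->
  {within infinite_gasket K, continuous f} -> continuous (fun x : R => f (`|x|, 0)).
Proof.
move=> gK /subspace_continuousP cf x.
have Kx y : infinite_gasket K (`|y|, 0 : R).
  by apply: (half_line_sub_gasket gK); split => //=; rewrite /half_line /= in_itv /= normr_ge0.
apply: (cvg_comp _ _ _ (cf _ (Kx x))) => W WH.
have cn : (fun y : R => (`|y|, 0 : R)) @ x --> (`|x|, 0 : R).
  apply: (@cvg_pair _ _ _ (nbhs x) (nbhs `|x|) (nbhs (0 : R))).
    exact: norm_continuous.
  exact: cvg_cst.
have := cn _ WH; rewrite !near_simpl /=; apply: filterS => y /=; apply; exact: Kx.
Qed.

End LowerBound.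

(** * Continuous functions from values at lattice points *)

Section Glue.
Variable R : realType.
Implicit Types (z : R * R) (h s : R) (n k l j : nat) (i : 'I_3).

(** Two upward triangles whose positions differ by at most 1 in k, in l and in k
    + l have a common corner. *)
Lemma corner_share k l k' l' :
  (k' < k + 2 -> k < k' + 2 -> l' < l + 2 -> l < l' + 2 ->
   k' + l' < k + l + 2 -> k + l < k' + l' + 2 ->
   exists i i' : 'I_3, k + dx i = k' + dx i' /\ l + dy i = l' + dy i')%N.
Proof.
move=> k1 k2 l1 l2 s1 s2.
pose i0 : 'I_3 := ord0; pose i1 : 'I_3 := 1; pose i2 : 'I_3 := 2%:R.
have D : [/\ dx i0 = 0, dx i1 = 1 & dx i2 = 0]%N by [].
have E : [/\ dy i0 = 0, dy i1 = 0 & dy i2 = 1]%N by [].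
case: D E => D0 D1 D2 [E0 E1 E2].
have [kk|[kk|kk]] : k = k' \/ (k' = k.+1 \/ k = k'.+1) by lia.
- have [ll|[ll|ll]] : l = l' \/ (l' = l.+1 \/ l = l'.+1) by lia.
  + by exists i0, i0; rewrite kk ll.
  + by exists i2, i0; rewrite D0 D2 E0 E2; lia.
  + by exists i0, i2; rewrite D0 D2 E0 E2; lia.
- have [ll|ll] : l = l' \/ l = l'.+1 by lia.
  + by exists i1, i0; rewrite D0 D1 E0 E1; lia.
  + by exists i1, i2; rewrite D2 D1 E2 E1; lia.
- have [ll|ll] : l = l' \/ l' = l.+1 by lia.
  + by exists i0, i1; rewrite D0 D1 E0 E1; lia.
  + by exists i2, i1; rewrite D2 D1 E2 E1; lia.
Qed.

Lemma in_cell_share h k l k' l' z z' : 0 < h ->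
  in_cell h k l z -> in_cell h k' l' z' ->
  `|skew1 z - skew1 z'| < h / 2 -> `|skew2 z - skew2 z'| < h / 2 ->
  exists i i' : 'I_3, (k + dx i = k' + dx i' /\ l + dy i = l' + dy i')%N.
Proof.
move=> h0 [a1 b1 c1] [a2 b2 c2]; rewrite !ltr_norml => ha hb.
have cmp p q : h * p%:R < h * q%:R -> (p < q)%N by rewrite ltr_pM2l // ltr_nat.
have k1 : (k' < k + 2)%N.
  by apply: cmp; move: c1; rewrite !mulnatS !natrD !mulrDr; lra.
have k2 : (k < k' + 2)%N.
  by apply: cmp; move: c2; rewrite !mulnatS !natrD !mulrDr; lra.
have l1 : (l' < l + 2)%N.
  by apply: cmp; move: c1; rewrite !mulnatS !natrD !mulrDr; lra.
have l2 : (l < l' + 2)%N.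
  by apply: cmp; move: c2; rewrite !mulnatS !natrD !mulrDr; lra.
have s1 : (k' + l' < k + l + 2)%N.
  by apply: cmp; move: c1; rewrite !mulnatS !natrD !mulrDr; lra.
have s2 : (k + l < k' + l' + 2)%N.
  by apply: cmp; move: c2; rewrite !mulnatS !natrD !mulrDr; lra.
exact: corner_share.
Qed.

Lemma in_cell_half h k l z : 0 < h -> ok k l -> in_cell (h / 2) k l z ->
  in_cell h k./2 l./2 z.
Proof.
move=> h0 /ok_half[_ nodd] [a b c].
have hk p q : (p <= q.*2)%N -> h / 2 * p%:R <= h * q%:R.
  by move=> pq; rewrite -(seg_double h q) ler_pM2l ?divr_gt0 // ler_nat.
have hk' p q : (q.*2 <= p)%N -> h * q%:R <= h / 2 * p%:R.
  by move=> pq; rewrite -(seg_double h q) ler_pM2l ?divr_gt0 // ler_nat.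
split.
- by apply: le_trans a; apply: hk'; lia.
- by apply: le_trans b; apply: hk'; lia.
- apply: (le_trans c); apply: hk; move: nodd; lia.
Qed.

(** The j-th ancestor of a cell has the coordinates [halves j k] and [halves j
    l]. *)
Definition halves j k := iter j half k.

Lemma in_cell_halves s n j k l z : 0 < s -> ok k l -> in_cell (s / 2 ^+ (n + j)) k l z ->
  ok (halves j k) (halves j l) /\ in_cell (s / 2 ^+ n) (halves j k) (halves j l) z.
Proof.
move=> s0; elim: j k l => [|j IH] k l okkl; first by rewrite addn0.
rewrite /halves !iterSr addnS exprSr invfM mulrA => /in_cell_half H.
apply: IH; first by have [] := ok_half okkl.
by apply: H => //; rewrite divr_gt0 // exprn_gt0.
Qed.

Lemma in_cell_corner h k l i : 0 < h -> in_cell h k l (lattice_pt h (k + dx i)%N (l + dy i)%N).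
Proof.
move=> h0; rewrite /in_cell skew1_lattice_pt skew2_lattice_pt -mulrDr -natrD !ler_pM2l // !ler_nat.
rewrite !leq_addr; split => //.
by case: i => [[|[|[|//]]] ?]; rewrite /dx /dy /=; lia.
Qed.

Lemma ok_corner k l i j : ok k l ->
  exists k' l', [/\ ok k' l', (k' + dx i = 2 ^ j * (k + dx i)%N)%N
    & (l' + dy i = 2 ^ j * (l + dy i)%N)%N].
Proof.
move=> okkl; elim: j => [|j [k' [l' [okkl' k'E l'E]]]].
  by exists k, l; rewrite expn0 !mul1n.
exists (k'.*2 + dx i)%N, (l'.*2 + dy i)%N; split; first exact: ok_child.
- by rewrite expnS -mulnA -k'E; lia.
- by rewrite expnS -mulnA -l'E; lia.
Qed.

Variables (g : nat -> nat -> nat -> R) (rho : nat -> R) (s : R).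
Hypotheses (s0 : 0 < s) (rg : refines g) (rho0 : rho @ \oo --> (0 : R)).
Hypothesis g_osc : forall n j k l i i', ok k l ->
  `|g (n + j)%N (k + dx i)%N (l + dy i)%N
    - g n (halves j k + dx i')%N (halves j l + dy i')%N| <= rho n.

(** The values of the array at the corners of the cells of level n that contain
    z. *)
Let corner_val n z : set R :=
  [set r | exists k l i, [/\ ok k l, in_cell (s / 2 ^+ n) k l z
    & r = g n (k + dx i)%N (l + dy i)%N]].

(** The function on the plane that extends the array g, read at scale s. Every
    value in [corner_val n z] is within 2 * rho n of the limit to be defined, so
    that the supremum of these values decreased by 2 * rho n is that limit; a
    supremum makes the definition total. *)
Definition glue z : R := sup [set r | exists n r', corner_val n z r' /\ r = r' - 2 * rho n].

Lemma corner_val_close n j z r r' : corner_val n z r -> corner_val (n + j) z r' ->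
  `|r' - r| <= 2 * rho n.
Proof.
move=> [k [l [i [okkl zkl ->]]]] [k' [l' [i' [okkl' zkl' ->]]]].
have [okh zh] := in_cell_halves s0 okkl' zkl'.
have hn0 : 0 < s / 2 ^+ n by rewrite divr_gt0 // exprn_gt0.
have [||a [b [E1 E2]]] := in_cell_share hn0 zkl zh; try by rewrite subrr normr0 divr_gt0.
have := @g_osc n j k' l' i' b okkl'; rewrite -E1 -E2.
have := @g_osc n 0 k l i a okkl; rewrite addn0.
set x := g n (k + dx a)%N _; set y := g n (k + dx i)%N _; set w := g (n + j)%N _ _.
by rewrite !ler_norml; lra.
Qed.

Lemma rho_ge0 n : 0 <= rho n.
Proof. by have := @g_osc n 0 0 0 ord0 ord0 ok0; rewrite addn0 subrr normr0. Qed.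

(** All corner values of level n at z are uniformly close to [glue z]. *)
Lemma glue_close n z r : corner_val n z r -> `|glue z - r| <= 2 * rho n.
Proof.
move=> nr; have ubr : ubound [set r | exists n r', corner_val n z r' /\ r = r' - 2 * rho n]
    (r + 2 * rho n).
  move=> _ [n' [r' [n'r' ->]]].
  have := rho_ge0 n; have := rho_ge0 n'.
  have [nn'|/ltnW nn'] := leqP n n'.
    have := corner_val_close nr (j := n' - n); rewrite subnKC // => /(_ _ n'r').
    by rewrite ler_norml; lra.
  have := corner_val_close n'r' (j := n - n'); rewrite subnKC // => /(_ _ nr).
  by rewrite ler_norml; lra.
have h1 : glue z <= r + 2 * rho n.
  by apply: ge_sup => //; exists (r - 2 * rho n), n, r.
have h2 : r - 2 * rho n <= glue z.
  by apply: ub_le_sup; [exists (r + 2 * rho n) | exists n, r].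
by rewrite ler_norml; lra.
Qed.

Lemma refines_pow n j k l : g (n + j)%N (2 ^ j * k)%N (2 ^ j * l)%N = g n k l.
Proof.
elim: j => [|j IH]; first by rewrite addn0 !mul1n.
by rewrite addnS !expnS -!mulnA !mul2n rg.
Qed.

Lemma lattice_pt_pow n j k l :
  lattice_pt (s / 2 ^+ (n + j)) (2 ^ j * k) (2 ^ j * l) = lattice_pt (s / 2 ^+ n) k l.
Proof.
elim: j => [|j IH]; first by rewrite addn0 !mul1n.
by rewrite addnS !expnS -!mulnA !mul2n exprSr invfM mulrA lattice_pt_double.
Qed.

(** The glued function has the prescribed values at the vertices of the gasket.
    *)
Lemma glue_vertex n k l i : ok k l ->
  glue (lattice_pt (s / 2 ^+ n) (k + dx i)%N (l + dy i)%N) = g n (k + dx i)%N (l + dy i)%N.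
Proof.
move=> okkl; set z := lattice_pt _ _ _; set a := g _ _ _.
apply/eqP; rewrite -subr_eq0 -normr_le0; apply/ler_addgt0Pr => e e0; rewrite add0r.
have e2 : 0 < e / 2 by lra.
have /cvgrPdist_lt /(_ _ e2) [N _ /(_ (n + N)%N (leq_addl n N)) /=] := rho0.
rewrite sub0r normrN => rN.
have [k' [l' [okkl' k'E l'E]]] := ok_corner i N okkl.
have c : corner_val (n + N) z a.
  exists k', l', i; rewrite k'E l'E refines_pow; split => //.
  rewrite /z -(lattice_pt_pow n N) -k'E -l'E; apply: in_cell_corner.
  by rewrite divr_gt0 // exprn_gt0.
have := glue_close c; have := ler_norm (rho (n + N)); lra.
Qed.

Lemma glue_continuous K M : is_gasket K -> s = 2 ^+ M ->
  {within infinite_gasket K, continuous glue}.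
Proof.
move=> gK sM; apply/subspace_continuousP => z Kz; apply/cvgrPdist_lt => e e0.
have [n rn] : exists n, rho n < e / 4.
  have e4 : 0 < e / 4 by lra.
  have /cvgrPdist_lt /(_ _ e4) [N _ /(_ N (leqnn N)) /=] := rho0.
  rewrite sub0r normrN => rN; exists N; exact: le_lt_trans (ler_norm _) rN.
have hn0 : 0 < s / 2 ^+ n by rewrite divr_gt0 // exprn_gt0.
have [k [l [okkl zkl]]] := infinite_gasket_in_cell M n gK Kz; rewrite -sM in zkl.
have h2 : 0 < s / 2 ^+ n / 2 by rewrite divr_gt0.
have na := @continuous_skew1 R z; move/cvgrPdist_lt/(_ _ h2) in na.
have nb := @continuous_skew2 R z; move/cvgrPdist_lt/(_ _ h2) in nb.
rewrite near_withinE; near=> z' => Kz'.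
have [k' [l' [okkl' zkl']]] := infinite_gasket_in_cell M n gK Kz'; rewrite -sM in zkl'.
have [||a [b [E1 E2]]] := in_cell_share hn0 zkl zkl'.
- by near: z'.
- by near: z'.
have c1 : corner_val n z (g n (k + dx a)%N (l + dy a)%N) by exists k, l, a.
have c2 : corner_val n z' (g n (k + dx a)%N (l + dy a)%N).
  by rewrite E1 E2; exists k', l', b.
change (`|glue z - glue z'| < e).
have := glue_close c1; have := glue_close c2; rewrite !ler_norml ltr_norml.
set x := g n _ _; lra.
Unshelve. all: by end_near. Qed.

End Glue.

(** * Values of an almost optimal extension *)

Lemma perturbed_geometric (R : realType) (q : R) (x y : R^nat) : 0 <= q < 1 ->
  (forall n, 0 <= x n) -> (forall n, x n.+1 <= q * x n + y n) ->
  y @ \oo --> (0 : R) -> x @ \oo --> (0 : R).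
Proof.
move=> q01 x0 xS /cvgrPdist_lt y0; apply/cvgrPdist_lt => e e0.
have e1 : 0 < (1 - q) * (e / 2) by rewrite mulr_gt0 //; lra.
have [N _ yN] := y0 _ e1.
have H j : x (N + j)%N <= q ^+ j * x N + e / 2.
  elim: j => [|j IH]; first by rewrite addn0 expr0; lra.
  rewrite addnS exprS -mulrA; apply: le_trans (xS _) _.
  have := yN (N + j)%N (leq_addr j N); rewrite /= sub0r normrN ltr_norml => /andP[_ yj].
  have : q * x (N + j)%N <= q * (q ^+ j * x N + e / 2) by apply: ler_wpM2l => //; lra.
  by lra.
have e2 : 0 < e / 2 by lra.
have [M _ HM] := geometric_lt (x N) q01 e2.
exists (N + M)%N => // n /= NMn; rewrite sub0r normrN ger0_norm //.
have Nn : (N <= n)%N := leq_trans (leq_addr M N) NMn.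
have := H (n - N)%N; rewrite subnKC // => xn.
have := HM (n - N)%N; rewrite /= leq_subRL // mulrC => /(_ NMn); lra.
Qed.

Section Extension.
Variable R : realType.
Implicit Types (h e x y : R) (n k l j m : nat).
Variables (u : R -> R) (s : R).
Hypotheses (cu : continuous u) (s0 : 0 < s).
Hypothesis us : forall x, s <= x -> u x = 0.

(** The mesh of level n. *)
Definition mesh n : R := s / 2 ^+ n.

Lemma mesh_gt0 n : 0 < mesh n. Proof. by rewrite divr_gt0 // exprn_gt0. Qed.

Lemma meshS n : mesh n / 2 = mesh n.+1. Proof. by rewrite /mesh exprSr invfM mulrA. Qed.

Lemma mesh0 : mesh 0 = s. Proof. by rewrite /mesh expr0 divr1. Qed.

(** The extension of u. On level 0 it is u on the line, the mean of u over [0,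
    s] at the top of the first cell, and 0 elsewhere. On the next levels it is u
    on the line, the minimizer of [cascade] for b = 7/3 at the tops of the cells
    along the line, and the harmonic 2-2-1 rule at all other midpoints, and the
    old value at the old vertices. *)
Fixpoint trace_ext n k l : R :=
  match n, l with
  | 0, 0 => u (mesh 0 * k%:R)
  | 0, _ => if (k == 0%N) && (l == 1%N) then mean u s 0 else 0
  | n'.+1, 0 => u (mesh n'.+1 * k%:R)
  | n'.+1, 1 =>
      (7 * mean u (mesh n') k./2 + 3 * trace_ext n' k./2 1) / 10
      + (if odd k then -1 else 1) * (7 / 32 * dmean u (mesh n') k./2)
  | n'.+1, _ =>
      let a := trace_ext n' k./2 l./2 in
      let b := trace_ext n' k./2.+1 l./2 in
      let c := trace_ext n' k./2 l./2.+1 in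
      match odd k, odd l with
      | false, false => a
      | true, false => (2 * a + 2 * b + c) / 5
      | false, true => (2 * a + b + 2 * c) / 5
      | true, true => (a + 2 * b + 2 * c) / 5
      end
  end.

Lemma trace_ext_bottom n k : trace_ext n k 0 = u (mesh n * k%:R).
Proof. by case: n. Qed.

Lemma trace_ext_refines : refines trace_ext.
Proof.
move=> n k [|l]; first by rewrite !trace_ext_bottom -meshS seg_double.
by rewrite doubleS /= !odd_double /= !doubleK.
Qed.

Lemma trace_ext_l n k : trace_ext n.+1 k.*2 1 =
  (7 * mean u (mesh n) k + 3 * trace_ext n k 1) / 10 + 7 / 32 * dmean u (mesh n) k.
Proof. by rewrite /= odd_double doubleK mul1r. Qed.

Lemma trace_ext_r n k : trace_ext n.+1 k.*2.+1 1 =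
  (7 * mean u (mesh n) k + 3 * trace_ext n k 1) / 10 - 7 / 32 * dmean u (mesh n) k.
Proof. by rewrite /= odd_double /= uphalf_double mulN1r. Qed.

Lemma trace_ext_h1 n k l : trace_ext n.+1 k.*2.+1 l.+1.*2 =
  (2 * trace_ext n k l.+1 + 2 * trace_ext n k.+1 l.+1 + trace_ext n k l.+2) / 5.
Proof. by rewrite doubleS /= !odd_double /= ?uphalf_double ?doubleK ?uphalf_double. Qed.

Lemma trace_ext_h2 n k l : trace_ext n.+1 k.*2 l.+1.*2.+1 =
  (2 * trace_ext n k l.+1 + trace_ext n k.+1 l.+1 + 2 * trace_ext n k l.+2) / 5.
Proof. by rewrite doubleS /= !odd_double /= ?uphalf_double ?doubleK ?uphalf_double. Qed.

Lemma trace_ext_h3 n k l : trace_ext n.+1 k.*2.+1 l.+1.*2.+1 =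
  (trace_ext n k l.+1 + 2 * trace_ext n k.+1 l.+1 + 2 * trace_ext n k l.+2) / 5.
Proof. by rewrite doubleS /= !odd_double /= !uphalf_double. Qed.

(** Cells that do not touch the line are filled harmonically, so that
    subdivision preserves their energy. *)
Lemma harmonic_energy m n k l : cell_energy trace_ext m n k l.+1 = tri trace_ext n k l.+1.
Proof.
elim: m n k l => [|m IH] n k l //=.
rewrite doubleS !IH /tri -doubleS.
rewrite -!doubleS !(trace_ext_refines, trace_ext_h1, trace_ext_h2, trace_ext_h3).
by field.
Qed.

(** The value at the top minus the mean over the bottom edge. *)
Definition excess n k : R := trace_ext n k 1 - mean u (mesh n) k.

(** The sum of the squares of [excess] over the cells along the line, m
    generations below, with the factor 5/3 per generation. *)
Fixpoint excess_sum m n k : R :=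
  if m is m'.+1 then 5 / 3 * (excess_sum m' n.+1 k.*2 + excess_sum m' n.+1 k.*2.+1)
  else excess n k ^+ 2.

(** The sum of [tri] over the cells along the line, m generations below, with
    the factor 5/3 per generation. *)
Fixpoint rest m n k : R :=
  if m is m'.+1 then 5 / 3 * (rest m' n.+1 k.*2 + rest m' n.+1 k.*2.+1)
  else tri trace_ext n k 0.

Lemma excess_l n k : excess n.+1 k.*2 = 3 / 10 * excess n k - 9 / 32 * dmean u (mesh n) k.
Proof.
by rewrite /excess trace_ext_l (mean_split k (mesh_gt0 n) cu) /dmean !meshS; field.
Qed.

Lemma excess_r n k : excess n.+1 k.*2.+1 = 3 / 10 * excess n k + 9 / 32 * dmean u (mesh n) k.
Proof.
by rewrite /excess trace_ext_r (mean_split k (mesh_gt0 n) cu) /dmean !meshS; field.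
Qed.

(** At each subdivision the new energy is exactly the one given by the
    minimization, so that only the contributions of the last generation remain.
    *)
Lemma bottom_energy m n k : cell_energy trace_ext m n k 0 + 7 / 3 * excess_sum m n k =
  haar u m (mesh n) k + 7 / 3 * excess n k ^+ 2 + rest m n k.
Proof.
elim: m n k => [|m IH] n k; first by rewrite /= add0r addrC.
have := IH n.+1 k.*2; have := IH n.+1 k.*2.+1; rewrite /= harmonic_energy.
rewrite meshS excess_l excess_r.
have -> : tri trace_ext n.+1 k.*2 1 = (7 / 16 * dmean u (mesh n) k) ^+ 2
    + (- (7 / 10) * excess n k + 7 / 32 * dmean u (mesh n) k) ^+ 2
    + (- (7 / 10) * excess n k - 7 / 32 * dmean u (mesh n) k) ^+ 2.
  rewrite /tri (trace_ext_refines n k 1) trace_ext_l trace_ext_r /excess.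
  by move: (dmean u (mesh n) k) (mean u (mesh n) k) (trace_ext n k 1) => d a t; field.
set d := dmean _ _ _; set e := excess _ _; lra.
Qed.

Lemma excess_sum_step m n k : excess_sum m.+1 n k = 3 / 10 * excess_sum m n k
  + 135 / 512 * tree_sum (fun h k => dmean u h k ^+ 2) m (mesh n) k.
Proof.
elim: m n k => [|m IH] n k; first by rewrite /= excess_l excess_r; lra.
have -> : excess_sum m.+2 n k =
  5 / 3 * (excess_sum m.+1 n.+1 k.*2 + excess_sum m.+1 n.+1 k.*2.+1) by [].
have -> : excess_sum m.+1 n k = 5 / 3 * (excess_sum m n.+1 k.*2 + excess_sum m n.+1 k.*2.+1) by [].
by rewrite (IH n.+1 k.*2) (IH n.+1 k.*2.+1) [tree_sum _ m.+1 _ _]/= meshS; lra.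
Qed.

Lemma excess_sum_ge0 m n k : 0 <= excess_sum m n k.
Proof.
elim: m n k => [|m IH] n k /=; first exact: sqr_ge0.
by have := IH n.+1 k.*2; have := IH n.+1 k.*2.+1; lra.
Qed.

(** The squared distances of the values at the two ends from the mean. *)
Definition endsq h k : R :=
  (u (h * k%:R) - mean u h k) ^+ 2 + (u (h * k.+1%:R) - mean u h k) ^+ 2.

Lemma rest_le m n k : rest m n k <= 4 * tree_sum endsq m (mesh n) k + 4 * excess_sum m n k.
Proof.
elim: m n k => [|m IH] n k /=.
  rewrite /tri /endsq /excess !trace_ext_bottom.
  set p := u _; set q := u _; set t := trace_ext _ _ _; set a := mean _ _ _.
  have := sqr_ge0 (p + q - 2 * a); have := sqr_ge0 (p + t - 2 * a).
  have := sqr_ge0 (q + t - 2 * a); have := sqr_ge0 (p - a).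
  have := sqr_ge0 (q - a); have := sqr_ge0 (t - a); lra.
by have := IH n.+1 k.*2; have := IH n.+1 k.*2.+1; rewrite meshS; lra.
Qed.

Lemma excess_sum_cvg0 n k : haar_bounded u (mesh n) k ->
  (fun m => excess_sum m n k) @ \oo --> (0 : R).
Proof.
move=> b; have q01 : 0 <= (3 / 10 : R) < 1 by lra.
apply: (perturbed_geometric (q := 3 / 10) (y := fun m =>
  135 / 512 * tree_sum (fun h k => dmean u h k ^+ 2) m (mesh n) k)) => //.
- by move=> m; exact: excess_sum_ge0.
- by move=> m; rewrite excess_sum_step.
rewrite -[X in _ --> X](mulr0 (135 / 512)); apply: cvgMl_tmp.
apply: (tree_sum_cvg0 (u := u) (c := 32 / 35)) => //; first exact: mesh_gt0.
  by move=> h i _; exact: sqr_ge0.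
move=> h i h0 bi; have := haar_le_haar_sup 1 bi; rewrite /= !add0r; lra.
Qed.

Lemma trace_ext_energy m : haar_bounded u s 0 -> cell_energy trace_ext m 0 0 0 <= haar_sup u s 0.
Proof.
move=> b; have b' : haar_bounded u (mesh 0) 0 by rewrite mesh0.
have cY := excess_sum_cvg0 b'.
have cX : (fun m => tree_sum endsq m s 0) @ \oo --> (0 : R).
  apply: (tree_sum_cvg0 (u := u) (c := 16 / 7)) => //.
    by move=> h k h0; rewrite /endsq addr_ge0 ?sqr_ge0.
  move=> h k h0 bk; rewrite /endsq.
  have := pt_mean_le h0 cu bk (seg_l k h0); have := pt_mean_le h0 cu bk (seg_r k h0).
  lra.
apply/ler_addgt0Pr => e e0; have e8 : 0 < e / 8 by lra.
have [N1 _ H1] : \forall m \near \oo, excess_sum m 0 0 < e / 8.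
  by apply: cvgr_lt cY _ e8.
have [N2 _ H2] : \forall m \near \oo, tree_sum endsq m s 0 < e / 8.
  by apply: cvgr_lt cX _ e8.
(* Energies increase with the depth, and at a large depth the boundary
   contributions are small. *)
pose M := (m + (N1 + N2))%N.
have h1 : excess_sum M 0 0 < e / 8 by apply: H1 => /=; rewrite /M; lia.
have h2 : tree_sum endsq M s 0 < e / 8 by apply: H2 => /=; rewrite /M; lia.
apply: (le_trans (cell_energy_le 0 0 0 trace_ext_refines (leq_addr (N1 + N2) m))).
rewrite -/M; have := bottom_energy M 0 0; have := rest_le M 0 0.
have := haar_le_haar_sup M b; have := excess_sum_ge0 M 0 0; rewrite mesh0.
have -> : excess 0 0 = 0 by rewrite /excess mesh0 /= subrr.
rewrite expr0n /=; lra.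
Qed.

Lemma zero_energy m n k : (forall x, seg (mesh n) k x -> u x = 0) -> trace_ext n k 1 = 0 ->
  cell_energy trace_ext m n k 0 = 0.
Proof.
elim: m n k => [|m IH] n k u0 e0.
  rewrite /= /tri !trace_ext_bottom e0 !u0; first by rewrite !subrr expr0n /= !addr0.
    by apply: seg_r; exact: mesh_gt0.
  by apply: seg_l; exact: mesh_gt0.
have mz h i : 0 < h -> (forall x, seg h i x -> u x = 0) -> mean u h i = 0.
  move=> h0 z; apply/eqP; rewrite eq_le; apply/andP; split.
    by apply: mean_le => // x /z ->.
  by apply: mean_ge => // x /z ->.
have h0 := mesh_gt0 n; have h1 := mesh_gt0 n.+1.
have ul x : seg (mesh n.+1) k.*2 x -> u x = 0.
  by rewrite -meshS => /(seg_left h0); exact: u0.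
have ur x : seg (mesh n.+1) k.*2.+1 x -> u x = 0.
  by rewrite -meshS => /(seg_right h0); exact: u0.
have dz : dmean u (mesh n) k = 0.
  by rewrite /dmean meshS (mz _ _ h1 ul) (mz _ _ h1 ur) subrr.
have el : trace_ext n.+1 k.*2 1 = 0 by rewrite trace_ext_l dz e0 (mz _ _ h0 u0); field.
have er : trace_ext n.+1 k.*2.+1 1 = 0 by rewrite trace_ext_r dz e0 (mz _ _ h0 u0); field.
rewrite /= (IH _ _ ul el) (IH _ _ ur er) harmonic_energy /tri el er.
rewrite -(trace_ext_refines n k 1) in e0; rewrite e0.
by rewrite !subrr expr0n /= !addr0 mulr0.
Qed.

(** Among the cells of level 0, only the first one and the one above it carry
    energy. *)
Lemma coarse_energy m k l : cell_energy trace_ext m 0 k l <=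
  ((k, l) == (0%N, 0%N))%:R * cell_energy trace_ext m 0 0 0
  + ((k, l) == (0%N, 1%N))%:R * tri trace_ext 0 0 1.
Proof.
case: l => [|l]; last first.
  rewrite harmonic_energy !xpair_eqE andbF mul0r add0r eqSS.
  case: k => [|k]; case: l => [|l] /=; rewrite ?mul1r ?mul0r /tri /= ?subrr ?expr0n ?addr0 //.
rewrite !xpair_eqE andbT andbF mul0r addr0; case: k => [|k]; first by rewrite mul1r.
rewrite mul0r zero_energy // => x /segP /andP[xk _]; apply: us; apply: le_trans xk.
by rewrite mesh0 ler_peMr ?(ltW s0) // (ler_nat _ 1).
Qed.

End Extension.

(** * Maximum principle and decay of oscillations *)

Lemma half_even k : ~~ odd k -> k = k./2.*2.
Proof. lia. Qed.

Lemma half_odd k : odd k -> k = k./2.*2.+1.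
Proof. lia. Qed.

Arguments trace_ext : simpl never.

Section Oscillation.
Variable R : realType.
Implicit Types (h e x y : R) (n k l j m : nat) (i : 'I_3).
Variables (u : R -> R) (s : R).
Hypotheses (cu : continuous u) (s0 : 0 < s).
Hypothesis us : forall x, s <= x -> u x = 0.

Local Notation mesh := (mesh s).
Local Notation ext := (trace_ext u s).

(** All values that determine the extension below the cell (k, l) of level n lie
    in [lo, hi]: the three corners for a cell off the line, the bottom edge and
    the top for a cell on the line. *)
Definition in_range n k l lo hi :=
  if l is l'.+1 then
    [/\ lo <= ext n k l <= hi, lo <= ext n k.+1 l <= hi & lo <= ext n k l.+1 <= hi]
  else (forall x, seg (mesh n) k x -> lo <= u x <= hi) /\ lo <= ext n k 1 <= hi.

(** Maximum principle: a subcell takes its values from the range of the cell. *)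
Lemma in_range_child n k l lo hi : ~~ (odd k && odd l) ->
  in_range n k./2 l./2 lo hi -> in_range n.+1 k l lo hi.
Proof.
have m0 := mesh_gt0 s0 n; have m1 := mesh_gt0 s0 n.+1.
have top (i : nat) : (forall x, seg (mesh n) i x -> lo <= u x <= hi) -> lo <= ext n i 1 <= hi ->
    lo <= ext n.+1 i.*2 1 <= hi /\ lo <= ext n.+1 i.*2.+1 1 <= hi.
  move=> H t; rewrite trace_ext_l trace_ext_r (mean_split i m0 cu) /dmean meshS.
  have lb : forall x, seg (mesh n) i x -> lo <= u x by move=> x /H /andP[].
  have ub : forall x, seg (mesh n) i x -> u x <= hi by move=> x /H /andP[].
  have a1 : lo <= mean u (mesh n.+1) i.*2.
    by apply: mean_ge => // x; rewrite -meshS => /(seg_left m0)/lb.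
  have a2 : lo <= mean u (mesh n.+1) i.*2.+1.
    by apply: mean_ge => // x; rewrite -meshS => /(seg_right m0)/lb.
  have a3 : mean u (mesh n.+1) i.*2 <= hi.
    by apply: mean_le => // x; rewrite -meshS => /(seg_left m0)/ub.
  have a4 : mean u (mesh n.+1) i.*2.+1 <= hi.
    by apply: mean_le => // x; rewrite -meshS => /(seg_right m0)/ub.
  by move: (mean _ _ _) (mean _ _ _) (ext n i 1) t a1 a2 a3 a4 => a b c; lra.
move=> nodd; case El : l./2 => [|l'] /=.
  move=> [H t]; have [t1 t2] := top _ H t.
  have [l0|l1] : l = 0%N \/ l = 1%N by clear -El; lia.
    rewrite l0 /=; split.
      move=> x; case: (boolP (odd k)) => [/half_odd|/half_even] kE; rewrite kE -meshS.
        by move=> /(seg_right m0)/H.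
      by move=> /(seg_left m0)/H.
    by case: (boolP (odd k)) => [/half_odd|/half_even] ->; [exact: t2 | exact: t1].
  rewrite l1 /= in nodd *; rewrite andbT in nodd.
  move: t1 t2; rewrite -(half_even nodd) => t1 t2; split; [exact: t1 | exact: t2 |].
  by rewrite (half_even nodd) -[2%N]/(1.*2) trace_ext_refines.
move=> [h1 h2 h3].
case: (boolP (odd k)) (nodd) => [/half_odd|/half_even] kE;
  case: (boolP (odd l)) => [/half_odd|/half_even] lE //= _; rewrite kE lE El doubleS /=;
  rewrite -!doubleS !(trace_ext_refines, trace_ext_h1, trace_ext_h2, trace_ext_h3).
all: move: h1 h2 h3; move: (ext n _ _) (ext n _ _) (ext n _ _) => a b c *; split; lra.
Qed.

Lemma in_range_halves n j k l lo hi : ok k l ->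
  in_range n (halves j k) (halves j l) lo hi -> in_range (n + j)%N k l lo hi.
Proof.
elim: j k l => [|j IH] k l okkl; first by rewrite addn0.
have [ok2 nodd] := ok_half okkl.
by rewrite /halves !iterSr addnS => /(IH _ _ ok2); exact: in_range_child.
Qed.

Lemma corner_in_range n k l lo hi i : in_range n k l lo hi ->
  lo <= ext n (k + dx i)%N (l + dy i)%N <= hi.
Proof.
have m0 := mesh_gt0 s0 n.
case: l => [|l] /=.
  move=> [H t]; case: i => [[|[|[|//]]] ?]; rewrite /dx /dy /= ?addn0 ?addn1.
  - by rewrite trace_ext_bottom; apply: H; exact: seg_l.
  - by rewrite trace_ext_bottom; apply: H; exact: seg_r.
  - exact: t.
move=> [h1 h2 h3]; case: i => [[|[|[|//]]] ?]; rewrite /dx /dy /= ?addn0 ?addn1;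
  [exact: h1 | exact: h2 | exact: h3].
Qed.

(** A bounds the oscillations on level n: between the top and the bottom edge
    for the cells along the line, between corners for the others. *)
Definition osc_bound n (A : R) :=
  (forall k x, seg (mesh n) k x -> `|ext n k 1 - u x| <= A) /\
  (forall k l, ok k l.+1 -> [/\ `|ext n k l.+1 - ext n k.+1 l.+1| <= A,
     `|ext n k l.+1 - ext n k l.+2| <= A & `|ext n k.+1 l.+1 - ext n k l.+2| <= A]).

(** w bounds the oscillation of u on the dyadic intervals of level n. *)
Definition u_osc n (w : R) :=
  forall k x y, seg (mesh n) k x -> seg (mesh n) k y -> `|u x - u y| <= w.

(** Passing to the next level multiplies the oscillations by at most 7/10, up to
    the oscillation of u. *)
Lemma osc_bound_step n A w : osc_bound n A -> u_osc n w ->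
  osc_bound n.+1 (7 / 10 * A + w).
Proof.
have m0 := mesh_gt0 s0 n; have m1 := mesh_gt0 s0 n.+1.
move=> [B1 B2] uw.
have w0 : 0 <= w by apply: le_trans (uw 0%N _ _ (seg_l 0 m0) (seg_l 0 m0)); exact: normr_ge0.
have mL (q : nat) x : seg (mesh n) q x -> `|mean u (mesh n.+1) q.*2 - u x| <= w /\
    `|mean u (mesh n.+1) q.*2.+1 - u x| <= w.
  move=> xq; rewrite !ler_norml !lerBrDr !lerBlDr; split; apply/andP; split.
  - apply: mean_ge => // y; rewrite -meshS => /(seg_left m0) yq.
    by have := uw q x y xq yq; rewrite ler_norml; lra.
  - apply: mean_le => // y; rewrite -meshS => /(seg_left m0) yq.
    by have := uw q x y xq yq; rewrite ler_norml; lra.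
  - apply: mean_ge => // y; rewrite -meshS => /(seg_right m0) yq.
    by have := uw q x y xq yq; rewrite ler_norml; lra.
  - apply: mean_le => // y; rewrite -meshS => /(seg_right m0) yq.
    by have := uw q x y xq yq; rewrite ler_norml; lra.
have tL (q : nat) : `|mean u (mesh n.+1) q.*2 - ext n q 1| <= A /\
    `|mean u (mesh n.+1) q.*2.+1 - ext n q 1| <= A.
  rewrite !ler_norml !lerBrDr !lerBlDr; split; apply/andP; split.
  - apply: mean_ge => // y; rewrite -meshS => /(seg_left m0)/B1.
    by rewrite ler_norml; lra.
  - apply: mean_le => // y; rewrite -meshS => /(seg_left m0)/B1.
    by rewrite ler_norml; lra.
  - apply: mean_ge => // y; rewrite -meshS => /(seg_right m0)/B1.
    by rewrite ler_norml; lra.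
  - apply: mean_le => // y; rewrite -meshS => /(seg_right m0)/B1.
    by rewrite ler_norml; lra.
have tops (q : nat) x : seg (mesh n) q x ->
    `|ext n.+1 q.*2 1 - u x| <= 7 / 10 * A + w /\
    `|ext n.+1 q.*2.+1 1 - u x| <= 7 / 10 * A + w.
  move=> xq; have [] := mL _ _ xq; have := B1 _ _ xq.
  rewrite trace_ext_l trace_ext_r (mean_split q m0 cu) /dmean meshS.
  have A0 := le_trans (normr_ge0 _) (B1 _ _ xq).
  move: (mean _ _ _) (mean _ _ _) (ext n q 1) (u x) => a b c d.
  by rewrite !ler_norml; lra.
split.
  move=> k x; case: (boolP (odd k)) => [/half_odd|/half_even] ->; rewrite -meshS.
    by move=> /(seg_right m0)/tops[].
  by move=> /(seg_left m0)/tops[].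
move=> k l okkl; have [ok2 nodd] := ok_half okkl.
case El : l.+1./2 ok2 => [|l'] ok2.
  have l1 : l = 0%N by clear -El; lia.
  rewrite l1 /= andbT in nodd.
  rewrite l1 (half_even nodd); set q := k./2.
  have -> : ext n.+1 q.*2 2 = ext n q 1 by rewrite -[2%N]/(1.*2) trace_ext_refines.
  have [] := tL q; have [] := mL _ _ (seg_l q m0).
  have A0 := le_trans (normr_ge0 _) (B1 _ _ (seg_l q m0)).
  rewrite trace_ext_l trace_ext_r (mean_split q m0 cu) /dmean meshS.
  move: (mean _ _ _) (mean _ _ _) (ext n q 1) (u _) => a b c d.
  by rewrite !ler_norml => *; split; lra.
have [h1 h2 h3] := B2 _ _ ok2.
have A0 := le_trans (normr_ge0 _) (B1 _ _ (seg_l 0 m0)).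
case: (boolP (odd k)) (nodd) => [/half_odd|/half_even] kE;
  case: (boolP (odd l.+1)) => [/half_odd|/half_even] lE //= _; rewrite kE lE El doubleS /=;
  rewrite -!doubleS !(trace_ext_refines, trace_ext_h1, trace_ext_h2, trace_ext_h3).
all: move: h1 h2 h3; move: (ext n _ _) (ext n _ _) (ext n _ _) => a b c.
all: by rewrite !ler_norml => *; split; lra.
Qed.

Lemma cell_in_range n k l i A w : ok k l -> osc_bound n A -> u_osc n w ->
  in_range n k l (ext n (k + dx i)%N (l + dy i)%N - (A + w))
                 (ext n (k + dx i)%N (l + dy i)%N + (A + w)).
Proof.
have m0 := mesh_gt0 s0 n.
move=> okkl [B1 B2] uw.
have w0 : 0 <= w by apply: le_trans (uw 0%N _ _ (seg_l 0 m0) (seg_l 0 m0)); exact: normr_ge0.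
have A0 := le_trans (normr_ge0 _) (B1 _ _ (seg_l 0 m0)).
case: l okkl => [|l] okkl /=.
  have vx (x : R) : seg (mesh n) k x -> (u x - (A + w) <= ext n k 1 <= u x + (A + w)) /\
    forall y, seg (mesh n) k y -> u x - (A + w) <= u y <= u x + (A + w).
    move=> xk; split; first by have := B1 _ _ xk; rewrite ler_norml; lra.
    by move=> y yk; have := uw _ _ _ xk yk; rewrite ler_norml; lra.
  case: i => [[|[|[|//]]] ?]; rewrite /dx /dy /= ?addn0 ?addn1 ?trace_ext_bottom.
  - by have [] := vx _ (seg_l k m0).
  - by have [] := vx _ (seg_r k m0).
  - split; last lra.
    by move=> y /B1; rewrite ler_norml; lra.
have [] := B2 _ _ okkl.
case: i => [[|[|[|//]]] ?]; rewrite /dx /dy /= ?addn0 ?addn1;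
  move: (ext n _ _) (ext n _ _) (ext n _ _) => a b c;
  by rewrite !ler_norml => *; split; lra.
Qed.

Lemma u_bounded : exists2 C, 0 <= C & forall x, 0 <= x -> `|u x| <= C.
Proof.
have cn : {within `[0, s], continuous (fun x => `|u x|)}.
  by apply: continuous_subspaceT => x; apply: cvg_norm; exact: cu.
have [c _ cmax] := EVT_max (ltW s0) cn.
exists `|u c| => // x x0; have [xs|sx] := lerP x s.
  by apply: cmax; rewrite in_itv /= x0.
by rewrite (us (ltW sx)) normr0.
Qed.

Lemma u_osc_ex : exists w : R^nat, (forall n, u_osc n (w n)) /\ w @ \oo --> (0 : R).
Proof.
have [C C0 uC] := u_bounded.
pose W n : set R := [set r | exists x y, [/\ 0 <= x, 0 <= y, `|x - y| <= mesh n
  & r = `|u x - u y|]].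
have Wb n : has_ubound (W n).
  exists (C + C) => _ [x [y [x0 y0 _ ->]]].
  by apply: le_trans (ler_normB _ _) _; rewrite lerD // uC.
have m0 n := mesh_gt0 s0 n.
have W0 n : W n 0.
  by exists 0, 0; rewrite !subrr normr0; split => //; rewrite ltW.
exists (fun n => sup (W n)); split.
  move=> n k x y /segP /andP[xk xk1] /segP /andP[yk yk1].
  apply: ub_le_sup => //; exists x, y.
  have k0 : 0 <= mesh n * k%:R by rewrite mulr_ge0 // ltW.
  rewrite mulnatS in xk1 yk1.
  by split => //; [lra|lra|rewrite ler_norml; lra].
apply/cvgrPdist_lt => e e0; have e2 : 0 < e / 2 by lra.
have [d d0 dP] := heine (2 * s) cu e2.
have d1 : 0 < Num.min d s by rewrite lt_min d0.
have q01 : 0 <= (2^-1 : R) < 1 by lra.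
have := geometric_lt s q01 d1; apply: filter_app; near=> n.
rewrite exprVn -/(mesh n) lt_min => /andP[md ms].
rewrite sub0r normrN ger0_norm; last exact: ub_le_sup (W0 n).
apply: (@le_lt_trans _ _ (e / 2)); last lra.
apply: ge_sup; first by exists 0.
move=> _ [x [y [x0 y0 xy ->]]].
have [xs|sx] := lerP x (2 * s); last first.
  rewrite !us ?subrr ?normr0; [lra| |lra].
  by move: xy; rewrite ler_norml; lra.
have [ys|sy] := lerP y (2 * s); last first.
  rewrite !us ?subrr ?normr0; [lra|lra| ].
  by move: xy; rewrite ler_norml; lra.
by apply: dP => //; [rewrite x0|rewrite y0|lra].
Unshelve. all: by end_near. Qed.

Lemma osc_bound_ex : exists A w : R^nat, [/\ forall n, osc_bound n (A n),
  forall n, u_osc n (w n), A @ \oo --> (0 : R) & w @ \oo --> (0 : R)].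
Proof.
have [w [uw w0]] := u_osc_ex.
have [C C0 uC] := u_bounded.
have m0 n := mesh_gt0 s0 n.
have wge n : 0 <= w n.
  by apply: le_trans (uw n 0%N _ _ (seg_l 0 (m0 n)) (seg_l 0 (m0 n))); exact: normr_ge0.
pose fix A n := if n is n'.+1 then 7 / 10 * A n' + w n' else 2 * C.
have A0 n : 0 <= A n.
  by elim: n => [|n IH] /=; [lra | have := wge n; lra].
exists A, w; split => //; last first.
  apply: (perturbed_geometric (q := 7 / 10) (y := w)) => //; lra.
elim => [|n IH]; last exact: osc_bound_step.
have mC : `|mean u s 0| <= C.
  rewrite ler_norml; apply/andP; split.
    apply: mean_ge => // x /segP; rewrite mulr0 => /andP[x0 _].
    by have := uC _ x0; rewrite ler_norml => /andP[].
  apply: mean_le => // x /segP; rewrite mulr0 => /andP[x0 _].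
  by have := uC _ x0; rewrite ler_norml => /andP[].
have eC k l : `|ext 0 k l.+1| <= C.
  by rewrite /trace_ext; case: ifP => _ //; rewrite normr0.
split.
  move=> k x /segP /andP[xk _]; apply: le_trans (ler_normB _ _) _.
  have x0 : 0 <= x by apply: le_trans xk; rewrite mulr_ge0 // ltW.
  by have := eC k 0%N; have := uC _ x0; rewrite /=; lra.
move=> k l _; have := eC k l; have := eC k.+1 l; have := eC k l.+1.
move: (ext _ _ _) (ext _ _ _) (ext _ _ _) => a b c *.
by split; apply: le_trans (ler_normB _ _) _; rewrite /=; lra.
Qed.

End Oscillation.

(** * The extension and its energy *)

Lemma dxE : ((dx ord0 = 0%N) * (dx 1 = 1%N) * (dx 2%:R = 0%N)
  * (dy ord0 = 0%N) * (dy 1 = 0%N) * (dy 2%:R = 1%N))%type.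
Proof. by []. Qed.

Lemma ok_row k : ok k 0.
Proof.
have [n] := ubnP k; elim: n k => // n IH k kn.
case: (posnP k) => [->|k0]; first exact: ok0.
have okh : ok k./2 0 by apply: IH; lia.
case: (boolP (odd k)) => [/half_odd|/half_even] ->.
  by have := ok_child 1 okh; rewrite !dxE addn1.
by have := ok_child ord0 okh; rewrite !dxE !addn0.
Qed.

Section UpperBound.
Variable R : realType.
Implicit Types (h e x y : R) (n k l j m : nat) (i : 'I_3).

Lemma cell_energy_eq (g g' : nat -> nat -> nat -> R) m n k l :
  (forall n k l i, ok k l ->
    g n (k + dx i)%N (l + dy i)%N = g' n (k + dx i)%N (l + dy i)%N) ->
  ok k l -> cell_energy g m n k l = cell_energy g' m n k l.
Proof.
move=> E; elim: m n k l => [|m IH] n k l okkl.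
  have := E n _ _ ord0 okkl; have := E n _ _ 1 okkl; have := E n _ _ 2%:R okkl.
  by rewrite /= !dxE !addn0 !addn1 /tri => -> -> ->.
rewrite /=; have := ok_child ord0 okkl; have := ok_child 1 okkl; have := ok_child 2%:R okkl.
by rewrite !dxE !addn0 !addn1 => /IH -> /IH -> /IH ->.
Qed.

Lemma cell_energy_lattice_vals_iter (f : R * R -> R) s r m n k l :
  cell_energy (lattice_vals f (2 ^+ r * s)) m (r + n) k l = cell_energy (lattice_vals f s) m n k l.
Proof.
elim: r => [|r IH]; first by rewrite expr0 mul1r.
by rewrite exprS -mulrA addSn cell_energy_lattice_vals.
Qed.

(** A sum bounded termwise by a function carried by the two points a and b. *)
Lemma sum_two (T : eqType) (r : seq T) (F : T -> R) (a b : T) (A B : R) : uniq r ->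
  0 <= A -> 0 <= B ->
  (forall p, p \in r -> F p <= (p == a)%:R * A + (p == b)%:R * B) ->
  \sum_(p <- r) F p <= A + B.
Proof.
move=> ur A0 B0 FP.
have one c C : 0 <= C -> \sum_(p <- r) (p == c)%:R * C <= C.
  move=> C0; have -> : \sum_(p <- r) (p == c)%:R * C = (c \in r)%:R * C.
    elim: r ur {FP} => [|p r IH] /=; first by rewrite big_nil mul0r.
    move=> /andP[pr ur]; rewrite big_cons IH // in_cons eq_sym.
    by case: eqP pr => [->|_] /=; [move=> /negbTE ->; rewrite mul0r addr0 | rewrite mul0r add0r].
  by case: (c \in r); rewrite ?mul1r ?mul0r.
apply: (@le_trans _ _ (\sum_(p <- r) ((p == a)%:R * A + (p == b)%:R * B))).
  by rewrite big_seq [leRHS]big_seq; apply: ler_sum => p; exact: FP.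
by rewrite big_split /= lerD ?one.
Qed.

Variables (u : R -> R) (M : nat).
Let s : R := 2 ^+ M.
Hypotheses (cu : continuous u).
Hypothesis us : forall x, s <= x -> u x = 0.

(** A function u of finite dyadic energy that vanishes beyond 2^M has an
    extension to the infinite gasket whose energy is at most (3/5)^M times the
    sum of the dyadic energy and twice the square of the mean of u. *)
Lemma extension K : is_gasket K -> haar_bounded u s 0 ->
  exists f : R * R -> R, [/\ {within infinite_gasket K, continuous f},
    forall x, 0 <= x -> f (x, 0) = u x &
    forall m, (M < m)%N -> infinite_gasket_energy m f <=
      (3 / 5) ^+ M * (haar_sup u s 0 + 2 * mean u s 0 ^+ 2)].
Proof.
move=> gK hb; have s0 : 0 < s by rewrite exprn_gt0.
have [A [w [oA ow A0 w0]]] := osc_bound_ex cu s0 us.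
pose rho n := A n + w n.
have rho0 : rho @ \oo --> (0 : R) by rewrite -[X in _ --> X]addr0; exact: cvgD.
have m0 n := mesh_gt0 s0 n.
have g_osc n j k l i i' : ok k l ->
  `|trace_ext u s (n + j)%N (k + dx i)%N (l + dy i)%N
    - trace_ext u s n (halves j k + dx i')%N (halves j l + dy i')%N| <= rho n.
  move=> okkl.
  have okh : ok (halves j k) (halves j l).
    elim: j k l okkl => // j IH k l okkl.
    by rewrite /halves !iterSr; apply: IH; have [] := ok_half okkl.
  have := cell_in_range s0 i' okh (oA n) (ow n).
  move=> /(in_range_halves cu s0 okkl) /(corner_in_range s0 i).
  by rewrite ler_norml -/(rho n); set a := trace_ext _ _ _ _ _; set b := trace_ext _ _ _ _ _; lra.
pose f := glue (trace_ext u s) rho s.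
have fv n k l i : ok k l ->
    lattice_vals f s n (k + dx i)%N (l + dy i)%N = trace_ext u s n (k + dx i)%N (l + dy i)%N.
  by move=> okkl; apply: glue_vertex => //; exact: trace_ext_refines.
exists f; split.
- exact: (glue_continuous s0 rho0 g_osc gK (erefl s)).
- move=> x x0; apply/eqP; rewrite -subr_eq0 -normr_le0; apply/ler_addgt0Pr => e e0.
  rewrite add0r; have e3 : 0 < e / 4 by lra.
  have [N1 _ H1] : \forall n \near \oo, rho n < e / 4 by apply: cvgr_lt rho0 _ e3.
  have [N2 _ H2] : \forall n \near \oo, w n < e / 4 by apply: cvgr_lt w0 _ e3.
  pose n := (N1 + N2)%N.
  have h1 : rho n < e / 4 by apply: H1; rewrite /= leq_addr.
  have h2 : w n < e / 4 by apply: H2; rewrite /= leq_addl.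
  pose k := Num.truncn (x / mesh s n).
  have /truncn_itv/andP[k1 k2] : 0 <= x / mesh s n by rewrite divr_ge0 // ltW.
  rewrite -/k ler_pdivlMr // ltr_pdivrMr // in k1 k2; rewrite mulrC in k1; rewrite mulrC in k2.
  have xk : seg (mesh s n) k x by apply/segP; rewrite k1 ltW.
  have c : in_cell (mesh s n) k 0 (x, 0).
    rewrite /in_cell /skew1 /skew2 /= !mul0r subr0 addr0 mulr0 addn0 k1; split => //.
    exact: ltW.
  have := glue_close s0 g_osc (n := n) (z := (x, 0)) (r := trace_ext u s n k 0).
  rewrite -/f => /(_ _)/wrap[|H].
    by exists k, 0%N, ord0; rewrite !addn0; split => //; exact: ok_row.
  have := ow n _ _ _ xk (seg_l k (m0 n)).
  rewrite trace_ext_bottom in H; move: H; rewrite !ler_norml.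
  by set a := f _; set b := u x; set d := u _; lra.
move=> m Mm; rewrite infinite_gasket_energyE.
have [r rE] : exists r, m = (r.+1 + M)%N by exists (m - M).-1; lia.
have mE : 2 ^+ m = 2 ^+ r.+1 * s by rewrite rE exprD.
(* The vertices of the coarse mesh 2^m are vertices of the mesh s of level 0 of
   the extension. *)
have far k l i : ok k l -> lattice_vals f (2 ^+ m) 0 (k + dx i)%N (l + dy i)%N =
    trace_ext u s 0 (2 ^ r.+1 * (k + dx i))%N (2 ^ r.+1 * (l + dy i))%N.
  move=> okkl; have [k' [l' [ok' k'E l'E]]] := ok_corner i r.+1 okkl.
  rewrite -k'E -l'E -fv // k'E l'E /lattice_vals; congr f.
  rewrite mE -(lattice_pt_pow (2 ^+ r.+1 * s) 0 r.+1) add0n expr0 divr1 mulrAC.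
  by rewrite divff ?mul1r // expf_neq0.
(* Both ends of the additional edge lie beyond the support of the extension. *)
have e1 : lattice_vals f (2 ^+ m) 0 1 0 = 0.
  have := far 0%N 0%N 1 ok0; rewrite !dxE !add0n muln1 muln0 => ->.
  rewrite trace_ext_bottom us // mesh0 ler_peMr ?(ltW s0) // ler1n expn_gt0 //.
have e2 : lattice_vals f (2 ^+ m) 0 0 1 = 0.
  have := far 0%N 0%N 2%:R ok0; rewrite !dxE !add0n muln1 muln0 => ->.
  have : (2 ^ r.+1 > 1)%N by rewrite -[1%N]/(2 ^ 0)%N ltn_exp2l.
  by case: (2 ^ r.+1)%N => [|[|q]].
rewrite e1 e2 subrr expr0n /= mulr0 addr0.
have -> : (2 * m = r.+1 + (r.+1 + 2 * M))%N by rewrite rE; lia.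
rewrite cell_energy_cells mE.
set S := \sum_(p <- _) _.
have -> : (3 / 5) ^+ m * ((5 / 3) ^+ r.+1 * S) = (3 / 5) ^+ M * S.
  rewrite rE exprD mulrCA !mulrA -exprMn (_ : 5 / 3 * (3 / 5) = 1) ?expr1n ?mul1r //.
  by field.
rewrite ler_pM2l; last by rewrite exprn_gt0 //; lra.
have -> : 2 * mean u s 0 ^+ 2 = tri (trace_ext u s) 0 0 1.
  have -> : tri (trace_ext u s) 0 0 1 =
      (mean u s 0 - 0) ^+ 2 + (mean u s 0 - 0) ^+ 2 + (0 - 0) ^+ 2.
    by [].
  by rewrite !subr0 expr0n /= addr0 mulr_natl mulr2n.
apply: (@le_trans _ _ (cell_energy (trace_ext u s) (r.+1 + 2 * M) 0 0 0
  + tri (trace_ext u s) 0 0 1)).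
  apply: (sum_two (a := (0, 0)%N) (b := (0, 1)%N)); rewrite ?uniq_cells ?cell_energy_ge0 //.
    exact: tri_ge0.
  move=> [k l] pr; rewrite [(k, l).1]/= [(k, l).2]/=.
  have okkl : ok k l by exists r.+1.
  have := cell_energy_lattice_vals_iter f s r.+1 (r.+1 + 2 * M) 0 k l; rewrite addn0 => ->.
  rewrite (cell_energy_eq _ 0 fv okkl).
  exact: coarse_energy.
by rewrite lerD2r; exact: trace_ext_energy.
Qed.

End UpperBound.

(** * The trace form as a limit of dyadic energies *)

Section Closure.
Variable R : realType.
Implicit Types (u v w : R -> R) (f g : R * R -> R) (K : set (R * R)).

(** Young's inequality; c is a sign, so that the lemma covers sums and
    differences. *)
Lemma young (d c x y : R) : 0 < d -> c ^+ 2 = 1 ->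
  (x + c * y) ^+ 2 <= (1 + d) * x ^+ 2 + (1 + d^-1) * y ^+ 2.
Proof.
move=> d0 c1; have := sqr_ge0 (d * x - c * y).
have di : 0 < d^-1 by rewrite invr_gt0.
have -> : (d * x - c * y) ^+ 2 = d * (d * x ^+ 2 - 2 * c * x * y) + c ^+ 2 * y ^+ 2 by ring.
rewrite c1 mul1r -(pmulr_rge0 _ di) mulrDr mulKf ?lt0r_neq0 //.
have -> : (x + c * y) ^+ 2 = x ^+ 2 + 2 * c * x * y + c ^+ 2 * y ^+ 2 by ring.
by rewrite c1; lra.
Qed.

Lemma cell_energy_young (G H : nat -> nat -> nat -> R) d c m n k l : 0 < d -> c ^+ 2 = 1 ->
  cell_energy (fun n k l => G n k l + c * H n k l) m n k l <=
  (1 + d) * cell_energy G m n k l + (1 + d^-1) * cell_energy H m n k l.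
Proof.
move=> d0 c1; elim: m n k l => [|m IH] n k l /=.
  rewrite /tri.
  have sub a b a' b' : (a + c * b - (a' + c * b')) ^+ 2 <=
      (1 + d) * (a - a') ^+ 2 + (1 + d^-1) * (b - b') ^+ 2.
    have -> : a + c * b - (a' + c * b') = (a - a') + c * (b - b') by ring.
    exact: young.
  rewrite !mulrDr.
  have := sub (G n k l) (H n k l) (G n k.+1 l) (H n k.+1 l).
  have := sub (G n k l) (H n k l) (G n k l.+1) (H n k l.+1).
  have := sub (G n k.+1 l) (H n k.+1 l) (G n k l.+1) (H n k l.+1).
  lra.
have := IH n.+1 k.*2 l.*2; have := IH n.+1 k.*2.+1 l.*2; have := IH n.+1 k.*2 l.*2.+1.
lra.
Qed.

Lemma energy_young f g d c m : 0 < d -> c ^+ 2 = 1 ->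
  infinite_gasket_energy m (fun z => f z + c * g z) <=
  (1 + d) * infinite_gasket_energy m f + (1 + d^-1) * infinite_gasket_energy m g.
Proof.
move=> d0 c1; rewrite !infinite_gasket_energyE.
have p0 : 0 <= (3 / 5 : R) ^+ m by rewrite exprn_ge0 //; lra.
rewrite [(1 + d) * _]mulrCA [(1 + d^-1) * _]mulrCA -mulrDr; apply: ler_wpM2l => //.
have := cell_energy_young (lattice_vals f (2 ^+ m)) (lattice_vals g (2 ^+ m)) (2 * m) 0 0 0 d0 c1.
have := young (lattice_vals f (2 ^+ m) 0 1 0 - lattice_vals f (2 ^+ m) 0 0 1)
  (lattice_vals g (2 ^+ m) 0 1 0 - lattice_vals g (2 ^+ m) 0 0 1) d0 c1.
have -> : lattice_vals (fun z => f z + c * g z) (2 ^+ m) =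
   (fun n k l => lattice_vals f (2 ^+ m) n k l + c * lattice_vals g (2 ^+ m) n k l) by [].
have -> : lattice_vals f (2 ^+ m) 0 1 0 + c * lattice_vals g (2 ^+ m) 0 1 0 -
    (lattice_vals f (2 ^+ m) 0 0 1 + c * lattice_vals g (2 ^+ m) 0 0 1) =
  lattice_vals f (2 ^+ m) 0 1 0 - lattice_vals f (2 ^+ m) 0 0 1 +
  c * (lattice_vals g (2 ^+ m) 0 1 0 - lattice_vals g (2 ^+ m) 0 0 1) by ring.
set A := _ ^+ 2; set B := _ ^+ 2; set C := _ ^+ 2; set D := cell_energy _ _ _ _ _.
set E := cell_energy _ _ _ _ _; set F := cell_energy _ _ _ _ _.
rewrite !mulrDr; lra.
Qed.

Lemma haar_young u v d c N h k : 0 < d -> c ^+ 2 = 1 -> continuous u -> continuous v ->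
  haar (fun x => u x + c * v x) N h k <= (1 + d) * haar u N h k + (1 + d^-1) * haar v N h k.
Proof.
move=> d0 c1 cu cv; elim: N h k => [|N IH] h k /=; first by rewrite !mulr0 addr0.
have cc : continuous (fun x => c * v x) by move=> x; apply: cvgMl_tmp; exact: cv.
have -> : dmean (fun x => u x + c * v x) h k = dmean u h k + c * dmean v h k.
  rewrite /dmean -!/(mean (u \+ (fun x => c * v x)) _ _) !meanD // !(meanZ _ _ _ cv); ring.
have := young (dmean u h k) (dmean v h k) d0 c1.
have := IH (h / 2) k.*2; have := IH (h / 2) k.*2.+1; rewrite !mulrDr; lra.
Qed.

(** The even extension of u to the whole line. It makes u, which matters on the
    half-line only, continuous everywhere. *)
Definition mirror u : R -> R := fun x => u `|x|.

(** Membership in the domain of the resistance form, with an explicit bound on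
    the energies. *)
Definition finite_energy K f := {within infinite_gasket K, continuous f} /\
  exists B, forall m, infinite_gasket_energy m f <= B.

Lemma FinfP K f : Finf K f <-> finite_energy K f.
Proof.
split=> [[cf Ef]|[cf [B HB]]]; split => //.
  have E0 : (0 <= Einf f)%E.
    by apply: le_trans (energy_le_Einf f 0); rewrite lee_fin energy_ge0.
  exists (fine (Einf f)) => m; rewrite -lee_fin fineK; first exact: energy_le_Einf.
  by rewrite ge0_fin_numE.
apply: (@le_lt_trans _ _ B%:E); last exact: ltry.
by apply: Einf_le => m; rewrite lee_fin.
Qed.

(** The restriction of f to the half-line is u. *)
Definition extends f u := forall x : R, 0 <= x -> f (x, 0) = u x.

Lemma extendsP f u : extends f u <-> {in half_line_plane (R := R), f =1 u \o fst}.
Proof.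
split=> [H [x y]|H x x0].
  by rewrite inE => -[/= + ->]; rewrite /half_line /= in_itv /= andbT; exact: H.
by rewrite H // inE; split => //=; rewrite /half_line /= in_itv /= andbT.
Qed.

Lemma FIP K u : FI K u <-> exists2 f, finite_energy K f & extends f u.
Proof.
split=> [[f /FinfP Ff /extendsP fu]|[f /FinfP Ff /extendsP fu]]; by exists f.
Qed.

Lemma finite_energyD K f g c : finite_energy K f -> finite_energy K g -> c ^+ 2 = 1 ->
  finite_energy K (fun z => f z + c * g z).
Proof.
move=> [cf [B HB]] [cg [C HC]] c1; split.
  move=> z; apply: cvgD; first exact: cf.
  by apply: cvgMl_tmp; exact: cg.
exists (2 * B + 2 * C) => m; have := energy_young f g m (@ltr01 R) c1; rewrite invr1.
by have := HB m; have := HC m; lra.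
Qed.

Lemma continuous_mirror K f u : is_gasket K -> finite_energy K f -> extends f u ->
  continuous (mirror u).
Proof.
move=> gK [cf _] fu; have := continuous_line gK cf.
by rewrite (_ : (fun x => _) = mirror u) //; apply/funext => x; rewrite fu.
Qed.

(** The renormalized truncated dyadic energies of u on the intervals [0, 2^M].
    *)
Definition energy_set u : set R :=
  [set r | exists M N : nat, r = (3 / 5) ^+ M * haar (mirror u) N (2 ^+ M) 0].
(** The supremum of these energies, which is the value of the trace form at u.
    *)
Definition limit_energy u : R := sup (energy_set u).

Lemma energy_set_le K f u B : is_gasket K -> finite_energy K f -> extends f u ->
  (forall m, infinite_gasket_energy m f <= B) -> ubound (energy_set u) B.
Proof.
move=> gK Ff fu HB _ [M [N ->]]; apply: haar_le_Einf HB.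
  exact: continuous_mirror gK Ff fu.
by move=> x x0; rewrite fu // /mirror ger0_norm.
Qed.

Lemma energy_set_neq0 u : energy_set u !=set0.
Proof. by exists ((3 / 5) ^+ 0 * haar (mirror u) 0 (2 ^+ 0) 0), 0%N, 0%N. Qed.

Lemma limit_energy_le K f u B : is_gasket K -> finite_energy K f -> extends f u ->
  (forall m, infinite_gasket_energy m f <= B) -> limit_energy u <= B.
Proof.
move=> gK Ff fu HB; apply: ge_sup; first exact: energy_set_neq0.
exact: energy_set_le gK Ff fu HB.
Qed.

Lemma limit_energy_ge K u M N : is_gasket K -> FI K u ->
  (3 / 5) ^+ M * haar (mirror u) N (2 ^+ M) 0 <= limit_energy u.
Proof.
move=> gK /FIP[f Ff fu]; have [_ [B HB]] := Ff.
by apply: ub_le_sup; [exists B; exact: (energy_set_le gK Ff fu HB) | exists M, N].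
Qed.

Lemma limit_energy_ge0 K u : is_gasket K -> FI K u -> 0 <= limit_energy u.
Proof. by move=> gK /(limit_energy_ge 0 0 gK); rewrite /= mulr0. Qed.

Lemma FI_haar_bounded K u M : is_gasket K -> FI K u -> haar_bounded (mirror u) (2 ^+ M) 0.
Proof.
move=> gK Fu; have p0 : 0 < (3 / 5 : R) ^+ M by rewrite exprn_gt0 //; lra.
exists (limit_energy u / (3 / 5) ^+ M) => N; rewrite ler_pdivlMr // mulrC.
exact: limit_energy_ge gK Fu.
Qed.

Lemma EI_ge K u : is_gasket K -> FI K u -> ((limit_energy u)%:E <= EI K u)%E.
Proof.
move=> gK Fu; apply: le_ereal_inf_tmp => _ [f [Ff /extendsP fu] <-].
have /FinfP Ff' := Ff.
have E0 : (0 <= Einf f)%E.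
  by apply: le_trans (energy_le_Einf f 0); rewrite lee_fin energy_ge0.
have Efin : Einf f \is a fin_num by rewrite ge0_fin_numE //; case: Ff.
rewrite -(fineK Efin) lee_fin; apply: (limit_energy_le gK Ff' fu) => m.
by rewrite -lee_fin fineK //; exact: energy_le_Einf.
Qed.

Lemma EI_le K u f B : finite_energy K f -> extends f u ->
  (forall m, infinite_gasket_energy m f <= B) -> (EI K u <= B%:E)%E.
Proof.
move=> Ff fu HB; apply: ge_ereal_inf; exists (Einf f).
  by exists f => //; split; [exact/FinfP | exact/extendsP].
by apply: Einf_le => m; rewrite lee_fin.
Qed.

(** u vanishes far away. *)
Definition far_zero u := exists M : nat, forall x, 2 ^+ M <= x -> u x = 0.

Lemma far_zero_extension K w e : is_gasket K -> FI K w -> far_zero w -> 0 < e ->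
  exists f, [/\ finite_energy K f, extends f w &
    forall m, infinite_gasket_energy m f <= limit_energy w + e].
Proof.
move=> gK Fw [M0 wz] e0.
have /FIP[f0 Ff0 f0w] := Fw.
have cw := continuous_mirror gK Ff0 f0w.
have zf M x : (M0 <= M)%N -> 2 ^+ M <= x -> mirror w x = 0.
  move=> M0M xM; have x0 : 0 <= x by apply: le_trans xM; rewrite exprn_ge0.
  rewrite /mirror ger0_norm // wz //; apply: le_trans xM.
  by rewrite ler_eXn2l // ltr1n.
have s0 M : 0 < (2 : R) ^+ M by rewrite exprn_gt0.
have [C C0 uC] := u_bounded cw (s0 M0) (fun x => @zf M0 x (leqnn M0)).
have q01 : 0 <= (3 / 5 : R) < 1 by lra.
have [M1 _ HM1] := geometric_lt (2 * C ^+ 2) q01 e0.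
pose M := (M0 + M1)%N.
have [f [cf fw fE]] := extension cw (fun x => @zf M x (leq_addr M1 M0)) gK
  (FI_haar_bounded M gK Fw).
have fw' : extends f w by move=> x x0; rewrite fw // /mirror ger0_norm.
have HB m : infinite_gasket_energy m f <= limit_energy w + e.
  apply: (le_trans (energy_nd f (leq_addr M.+1 m))).
  apply: (le_trans (fE _ _)); first by rewrite addnS ltnS leq_addl.
  rewrite mulrDr; apply: lerD.
    have p0 : 0 < (3 / 5 : R) ^+ M by rewrite exprn_gt0 //; lra.
    rewrite mulrC -ler_pdivlMr //; apply: haar_sup_le => N; rewrite ler_pdivlMr // mulrC.
    exact: limit_energy_ge gK Fw.
  have := HM1 M (leq_addl M0 M1); rewrite mulrC => /ltW; apply: le_trans.
  apply: ler_wpM2l; first by rewrite exprn_ge0 //; lra.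
  rewrite ler_pM2l // -(real_normK (num_real (mean _ _ _))) ler_sqr ?nnegrE //.
  rewrite ler_norml; apply/andP; split.
    apply: mean_ge => // x /segP; rewrite mulr0 => /andP[x0 _].
    by have := uC _ x0; rewrite ler_norml => /andP[].
  apply: mean_le => // x /segP; rewrite mulr0 => /andP[x0 _].
  by have := uC _ x0; rewrite ler_norml => /andP[].
by exists f; split => //; split => //; exists (limit_energy w + e).
Qed.

(** u is a limit in energy of traces that vanish far away. *)
Definition approximable K u := FI K u /\ forall e, 0 < e ->
  exists w f, [/\ FI K w, far_zero w, finite_energy K f, extends f (fun x => u x - w x)
    & forall m, infinite_gasket_energy m f <= e].

Lemma sqrN1 : (-1) ^+ 2 = 1 :> R. Proof. by rewrite sqrrN expr1n. Qed.

Lemma EI_approximable K u : is_gasket K -> approximable K u -> EI K u = (limit_energy u)%:E.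
Proof.
move=> gK [Fu Au]; apply/eqP; rewrite eq_le EI_ge // andbT.
apply/lee_addgt0Pr => e e0; rewrite -EFinD.
have H0 := limit_energy_ge0 gK Fu; set H := limit_energy u in H0 *.
(* u = w + (u - w), where w has an almost optimal extension f and u - w an
   extension g of energy at most e'. In Young's inequality the weight 1 + d of f
   is chosen first, then e' according to the weight 1 + 1 / d of g. *)
pose d := Num.min 1 (e / (6 * (H + 1))).
have d0 : 0 < d by rewrite lt_min ltr01 divr_gt0 // mulr_gt0 //; lra.
have d1 : d <= 1 by rewrite ge_min lexx.
have dH : d * H <= e / 6.
  have : d <= e / (6 * (H + 1)) by rewrite ge_min lexx orbT.
  rewrite ler_pdivlMr; last by rewrite mulr_gt0 //; lra.
  nra.
have di0 : 0 < d^-1 by rewrite invr_gt0.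
pose q := d^-1.
pose e' := (e / 2) / (6 + 4 * q).
have e'0 : 0 < e' by rewrite !divr_gt0 // addr_gt0 // mulr_gt0.
have e'E : e' * (6 + 4 * q) = e / 2 by rewrite divfK // lt0r_neq0 // addr_gt0 // mulr_gt0.
have [w [g [Fw zw Fg gE gB]]] := Au _ e'0.
have [f [Ff fw fB]] := far_zero_extension gK Fw zw e'0.
have /FIP[fu Ffu fuE] := Fu.
have cu := continuous_mirror gK Ffu fuE.
have cp := continuous_mirror gK Fg gE.
have Hw : limit_energy w <= (1 + d) * H + (1 + q) * e'.
  apply: ge_sup; first exact: energy_set_neq0.
  move=> _ [M [N ->]].
  have -> : mirror w = (fun x => mirror u x + (-1) * mirror (fun x => u x - w x) x).
    by apply/funext => x; rewrite /mirror; ring.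
  have p0 : 0 <= (3 / 5 : R) ^+ M by rewrite exprn_ge0 //; lra.
  apply: (le_trans (ler_wpM2l p0 (haar_young N (2 ^+ M) 0 d0 sqrN1 cu cp))).
  rewrite mulrDr mulrCA [X in _ + X]mulrCA.
  apply: lerD; first by apply: ler_wpM2l; [lra | exact: limit_energy_ge gK Fu].
  apply: ler_wpM2l; first by rewrite addr_ge0 // ltW.
  by apply: (energy_set_le gK Fg gE gB); exists M, N.
have FF := finite_energyD Ff Fg (expr1n R 2).
have FE : extends (fun z => f z + 1 * g z) u.
  by move=> x x0; rewrite fw // gE // mul1r; ring.
apply: (EI_le FF FE) => m.
apply: (le_trans (energy_young f g m d0 (expr1n R 2))).
have := fB m; have := gB m; rewrite -/q.
set Qf := infinite_gasket_energy m f; set Qg := infinite_gasket_energy m g => hg hf.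
have q0 : 0 < q := di0.
have dq : d * q = 1 by rewrite mulfV // lt0r_neq0.
have k1 : (1 + d) * Qf <= (1 + d) * ((1 + d) * H + (1 + q) * e' + e').
  by apply: ler_wpM2l; lra.
have k2 : (1 + q) * Qg <= (1 + q) * e' by apply: ler_wpM2l; lra.
have k3 : d * (d * H) <= d * H by rewrite ler_piMl // mulr_ge0 // ltW.
have k4 : d * e' <= e' by rewrite ler_piMl // ltW.
have k5 : d * (q * e') = e' by rewrite mulrA dq mul1r.
have k6 : 0 < q * e' by rewrite mulr_gt0.
lra.
Qed.

Lemma FI_comb K u v c : FI K u -> FI K v -> c ^+ 2 = 1 -> FI K (fun x => u x + c * v x).
Proof.
move=> /FIP[f Ff fu] /FIP[g Fg gv] c1; apply/FIP; exists (fun z => f z + c * g z).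
  exact: finite_energyD.
by move=> x x0; rewrite fu // gv.
Qed.

Lemma approximable_comb K u v c : c ^+ 2 = 1 -> approximable K u -> approximable K v ->
  approximable K (fun x => u x + c * v x).
Proof.
move=> c1 [Fu Au] [Fv Av]; split; first exact: FI_comb.
move=> e e0; have e4 : 0 < e / 4 by lra.
have [w [f [Fw [M zw] Ff fE fB]]] := Au _ e4.
have [w' [f' [Fw' [M' zw'] Ff' fE' fB']]] := Av _ e4.
exists (fun x => w x + c * w' x), (fun z => f z + c * f' z); split.
- exact: FI_comb.
- exists (M + M')%N => x xM; rewrite zw ?zw' ?mulr0 ?addr0 //; apply: le_trans xM;
  by rewrite ler_eXn2l ?ltr1n // ?leq_addr ?leq_addl.
- exact: finite_energyD.
- by move=> x x0; rewrite fE // fE' //; ring.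
- move=> m; have := energy_young f f' m (@ltr01 R) c1; rewrite invr1.
  by have := fB m; have := fB' m; lra.
Qed.

Lemma C0_far_zero w : C0 w -> far_zero w.
Proof.
move=> [_ /compact_bounded/ex_strict_bound_gt0 [C C0 HC]].
have q01 : 0 <= (2^-1 : R) < 1 by lra.
have [M _ /(_ M (leqnn M)) /=] := geometric_lt C q01 (@ltr01 R).
rewrite exprVn ltr_pdivrMr ?exprn_gt0 // mul1r => CM.
exists M => x Mx; apply/eqP; apply: contraT => wx.
have x0 : 0 <= x by apply: le_trans Mx; rewrite exprn_ge0.
have /HC /= : closure [set x | half_line x /\ w x != 0] x.
  by apply: subset_closure; split => //; rewrite /half_line /= in_itv /= andbT.
by rewrite ger0_norm // => xC; lra.
Qed.

Lemma sqrte_lt (x : \bar R) (e : R) : 0 < e -> (sqrte x < e%:E)%E -> (x < (e ^+ 2)%:E)%E.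
Proof.
case: x => [r||] e0 //=; last by rewrite ltNyr.
rewrite !lte_fin => re; have [r0|r0] := ltP r 0.
  by apply: lt_trans r0 _; rewrite exprn_gt0.
by rewrite -(sqr_sqrtr r0) ltr_sqr ?nnegrE ?sqrtr_ge0 // ltW.
Qed.

Lemma DI_approximable K u : DI K u -> approximable K u.
Proof.
move=> [[Fu _] Du]; split => // e e0.
have se : 0 < Num.sqrt e by rewrite sqrtr_gt0.
have [w [Fw cw] /(sqrte_lt se)] := Du _ se.
rewrite sqr_sqrtr ?(ltW e0) // => lt_e.
have : (EI K (u \- w)%R < e%:E)%E.
  apply: le_lt_trans lt_e; apply: leeDl.
  by apply: integral_ge0 => x _; rewrite lee_fin sqr_ge0.
move=> /ereal_inf_lt[_ [f [/FinfP Ff /extendsP fE] <-] Ef].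
exists w, f; split => //; first exact: C0_far_zero.
move=> m; rewrite -lee_fin; apply: le_trans (ltW Ef); exact: energy_le_Einf.
Qed.

End Closure.

(** * The jump energy of a dyadic square *)

Section Rectangles.
Variable R : realType.
Implicit Types (U : R -> R) (h : R) (k : nat).

Notation mu := (@lebesgue_measure R).
Notation mu2 := ((@lebesgue_measure R) \x (@lebesgue_measure R))%E.

(** [lft h k] and [rgt h k] are the halves of [seg h k] without the midpoint. *)
Definition lft h k : set R := `[h * k%:R, h / 2 * k.*2.+1%:R[.
Definition rgt h k : set R := `]h / 2 * k.*2.+1%:R, h * k.+1%:R].

Lemma measurable_lft h k : measurable (lft h k). Proof. exact: measurable_itv. Qed.
Lemma measurable_rgt h k : measurable (rgt h k). Proof. exact: measurable_itv. Qed.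

Lemma continuous_measurable U (D : set R) : continuous U -> measurable D -> measurable_fun D U.
Proof.
move=> cU mD; apply: (measurable_funS measurableT) => //.
exact: continuous_measurable_fun.
Qed.

(** Integration over A of continuous functions is h times the mean over [seg h
    k]; the end points of A are immaterial. *)
Definition averages (A : set R) h k := forall f : R -> R, continuous f ->
  (\int[mu]_(x in A) (f x)%:E = (h * mean f h k)%:E)%E.

Lemma seg_averages h k : 0 < h -> averages (seg h k) h k.
Proof.
move=> h0 f cf; rewrite /mean mulrA mulfV ?lt0r_neq0 // mul1r /Rintegral fineK //.
apply: integrable_fin_num; first exact: measurable_seg.
exact: seg_integrable.
Qed.

Lemma lft_averages h k : 0 < h -> averages (lft h k) (h / 2) k.*2.
Proof.
move=> h0 f cf; rewrite -(seg_averages k.*2 (half_gt0 h0) cf) /lft /seg seg_double.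
apply: integral_itv_bndo_bndc; apply/measurable_EFinP.
by apply: continuous_measurable => //; exact: measurable_itv.
Qed.

Lemma rgt_averages h k : 0 < h -> averages (rgt h k) (h / 2) k.*2.+1.
Proof.
move=> h0 f cf; rewrite -(seg_averages k.*2.+1 (half_gt0 h0) cf) /rgt /seg.
rewrite -[in RHS]doubleS seg_double.
apply: integral_itv_obnd_cbnd; apply/measurable_EFinP.
by apply: continuous_measurable => //; exact: measurable_itv.
Qed.

Lemma measurable_diff2 U : continuous U ->
  measurable_fun [set: R * R] (fun z : R * R => (U z.1 - U z.2) ^+ 2).
Proof.
move=> cU.
have mU : measurable_fun [set: R] U by exact: continuous_measurable.
apply: (@measurable_funX _ _ _ _ (fun z : R * R => U z.1 - U z.2)).
apply: measurable_funB.
  exact: (measurableT_comp mU measurable_fst).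
exact: (measurableT_comp mU measurable_snd).
Qed.

(** The integral of the squared difference over a product of two intervals of
    length h. *)
Lemma rectangle_integral U A B h ka kb : 0 < h -> continuous U ->
  measurable A -> measurable B -> averages A h ka -> averages B h kb ->
  (\int[mu2]_(z in A `*` B) ((U z.1 - U z.2) ^+ 2)%:E =
   (h ^+ 2 * (var U h ka + var U h kb + (mean U h ka - mean U h kb) ^+ 2))%:E)%E.
Proof.
move=> h0 cU mA mB aA aB.
rewrite integral_mkcond.
have mf : measurable_fun [set: R * R]
    ((fun z : R * R => ((U z.1 - U z.2) ^+ 2)%:E) \_ (A `*` B)).
  apply/(measurable_restrictT _ _).1; first exact: measurableX.
  apply: (measurable_funS measurableT) => //.
  by apply/measurable_EFinP; exact: measurable_diff2.
rewrite fubini_tonelli1 //; last first.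
  by move=> z; apply: erestrict_ge0 => z' _; rewrite lee_fin sqr_ge0.
have cd c : continuous (fun x => (U x - c) ^+ 2).
  by apply: continuous_sqr => x; apply: cvgB; [exact: cU | exact: cvg_cst].
pose g x : R := h * (var U h kb + (mean U h kb - U x) ^+ 2).
transitivity (\int[mu]_x (((EFin \o g) \_ A) x))%E.
  apply: eq_integral => x _; rewrite /fubini_F patchE; case: ifPn => xA.
    transitivity (\int[mu]_(y in B) ((U y - U x) ^+ 2)%:E)%E.
      rewrite [RHS]integral_mkcond; apply: eq_integral => y _.
      rewrite !patchE in_setX /= xA /=; case: ifP => // _.
      by rewrite -sqrrN opprB.
    by rewrite aB // mean_sqrB.
  by apply: integral0_eq => y _; rewrite patchE in_setX /= (negbTE xA).
rewrite -integral_mkcond aA; last first.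
  move=> x; apply: cvgMl_tmp; apply: cvgD; first exact: cvg_cst.
  by under eq_fun do rewrite -sqrrN opprB; rewrite -sqrrN opprB; exact: cd.
have -> : g = (fun x => h * ((fun=> var U h kb) \+ (fun x => (U x - mean U h kb) ^+ 2)) x).
  by apply/funext => x; rewrite /g /= -[in LHS]sqrrN opprB.
have cc : continuous (fun _ : R => var U h kb) by move=> x; exact: cvg_cst.
rewrite meanZ; last by move=> x; apply: cvgD; [exact: cc | exact: cd].
rewrite (meanD _ _ cc (cd _)).
by rewrite mean_cst // mean_sqrB //; congr EFin; ring.
Qed.

(** The two off-diagonal quarters of the square [seg h k] x [seg h k]. *)
Definition dcell h k : set (R * R) := rgt h k `*` lft h k `|` lft h k `*` rgt h k.

Lemma measurable_dcell h k : measurable (dcell h k).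
Proof.
apply: measurableU; apply: measurableX;
  first [exact: measurable_lft | exact: measurable_rgt].
Qed.

Lemma lftP h k x : lft h k x -> seg (h / 2) k.*2 x /\ x < h / 2 * k.*2.+1%:R.
Proof.
by rewrite /lft /= in_itv /= => /andP[h1 h2]; split => //; apply/segP; rewrite seg_double h1 ltW.
Qed.

Lemma rgtP h k x : rgt h k x -> seg (h / 2) k.*2.+1 x /\ h / 2 * k.*2.+1%:R < x.
Proof.
rewrite /rgt /= in_itv /= => /andP[h1 h2]; split => //; apply/segP.
by rewrite -[in X in _ && X]doubleS seg_double h2 ltW.
Qed.

(** The first N generations of the decomposition of that square, off its
    diagonal, into cells [dcell]. *)
Fixpoint pieces N h k : set (R * R) :=
  if N is N'.+1 then
    dcell h k `|` (pieces N' (h / 2) k.*2 `|` pieces N' (h / 2) k.*2.+1)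
  else set0.

Lemma measurable_pieces N h k : measurable (pieces N h k).
Proof.
elim: N h k => [|N IH] h k /=; first exact: measurable0.
by apply: measurableU; [exact: measurable_dcell | exact: measurableU].
Qed.

Lemma pieces_sub N h k z : 0 < h -> pieces N h k z ->
  [/\ seg h k z.1, seg h k z.2 & z.1 != z.2].
Proof.
elim: N h k => //= N IH h k h0 [|[/(IH _ _ (half_gt0 h0))|/(IH _ _ (half_gt0 h0))]].
- move=> [[/rgtP[a1 a2] /lftP[b1 b2]]|[/lftP[b1 b2] /rgtP[a1 a2]]].
  + split; [exact: seg_right a1 | exact: seg_left b1 |].
    by rewrite neq_lt (lt_trans b2 a2) orbT.
  + split; [exact: seg_left b1 | exact: seg_right a1 |].
    by rewrite neq_lt (lt_trans b2 a2).
- by move=> [a b c]; split => //; exact: seg_left.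
- by move=> [a b c]; split => //; exact: seg_right.
Qed.

Lemma piecesS N h k : pieces N h k `<=` pieces N.+1 h k.
Proof.
elim: N h k => [|N IH] h k z //= [zc|[zl|zr]]; first by left.
  by right; left; exact: IH.
by right; right; exact: IH.
Qed.

Lemma pieces_cover N h k (x y : R) : 0 < h -> seg h k x -> seg h k y ->
  h / 2 ^+ N < `|x - y| -> pieces N h k (x, y).
Proof.
elim: N h k => [|N IH] h k h0 xk yk xy.
  have := xk; have := yk; move: xy => + /segP + /segP; rewrite expr0 divr1 mulnatS.
  by rewrite ltr_normr; lra.
have hN : h / 2 / 2 ^+ N = h / 2 ^+ N.+1 by rewrite exprS invfM mulrA.
have h20 := half_gt0 h0.
pose c := h / 2 * k.*2.+1%:R.
have sl t : seg h k t -> t <= c -> seg (h / 2) k.*2 t.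
  by move=> /segP /andP[t1 _] tc; apply/segP; rewrite seg_double t1.
have sr t : seg h k t -> c <= t -> seg (h / 2) k.*2.+1 t.
  by move=> /segP /andP[_ t2] tc; apply/segP; rewrite -[in X in _ && X]doubleS seg_double tc.
have L t : seg h k t -> t < c -> lft h k t.
  by move=> /segP /andP[t1 _] tc; rewrite /lft /= in_itv /= t1.
have Rr t : seg h k t -> c < t -> rgt h k t.
  by move=> /segP /andP[_ t2] tc; rewrite /rgt /= in_itv /= t2 andbT.
have [xc|cx] := lerP x c; have [yc|cy] := lerP y c.
- by right; left; apply: IH; rewrite ?hN //; exact: sl.
- have [xc'|xc'] := ltP x c; first by left; right; split => /=; [exact: L | exact: Rr].
  by right; right; apply: IH; rewrite ?hN //; apply: sr => //; exact: ltW.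
- have [yc'|yc'] := ltP y c; first by left; left; split => /=; [exact: Rr | exact: L].
  by right; right; apply: IH; rewrite ?hN //; apply: sr => //; exact: ltW.
- by right; right; apply: IH; rewrite ?hN //; apply: sr => //; exact: ltW.
Qed.

Lemma dcell_disjoint N h k : 0 < h ->
  [disjoint dcell h k & (pieces N (h / 2) k.*2 `|` pieces N (h / 2) k.*2.+1)].
Proof.
move=> h0; have h20 := half_gt0 h0; apply/disj_setPS => z [zc zp].
have sr t : seg (h / 2) k.*2.+1 t -> h / 2 * k.*2.+1%:R <= t by move=> /segP/andP[].
have sl t : seg (h / 2) k.*2 t -> t <= h / 2 * k.*2.+1%:R by move=> /segP/andP[].
move: zc zp => [[/rgtP[_ a2] /lftP[_ b2]]|[/lftP[_ b2] /rgtP[_ a2]]]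
  [/(pieces_sub h20)[p1 p2 _]|/(pieces_sub h20)[p1 p2 _]];
  move: a2 b2; rewrite ?ltNge ?(sl _ p1) ?(sl _ p2) ?(sr _ p1) ?(sr _ p2) //.
Qed.

Lemma pieces_disjoint N h k : 0 < h ->
  [disjoint pieces N (h / 2) k.*2 & pieces N (h / 2) k.*2.+1].
Proof.
move=> h0; have h20 := half_gt0 h0; apply/disj_setPS => z [].
move=> /(pieces_sub h20)[p1 p2 +] /(pieces_sub h20)[q1 q2 _].
move: p1 p2 q1 q2 => /segP/andP[_ p1] /segP/andP[_ p2] /segP/andP[q1 _] /segP/andP[q2 _].
by rewrite (le_anti (introT andP (conj p1 q1))) (le_anti (introT andP (conj p2 q2))) eqxx.
Qed.

Lemma dcell_disjoint2 h k : [disjoint (rgt h k `*` lft h k) & (lft h k `*` rgt h k)].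
Proof.
apply/disj_setPS => z [[/rgtP[_ a2] _] [/lftP[_ b2] _]].
by have := lt_trans a2 b2; rewrite ltxx.
Qed.

(** The integral over [pieces N h k] of the squared difference of U times the
    jump kernel, divided by h^2 and by the value of the kernel on [dcell h k].
    Halving h multiplies the kernel by 20/3 and h^2 by 1/4, hence the factor
    5/3. *)
Fixpoint piece_sum U N h k : R :=
  if N is N'.+1 then
    (var U (h / 2) k.*2 + var U (h / 2) k.*2.+1 + dmean U h k ^+ 2) / 2
    + 5 / 3 * (piece_sum U N' (h / 2) k.*2 + piece_sum U N' (h / 2) k.*2.+1)
  else 0.

(** By [var_split], the variances telescope along the tree. *)
Lemma piece_sumE U N h k : 0 < h -> continuous U ->
  piece_sum U N h k = 136 / 245 * haar U N h k
    + 3 / 7 * (tree_sum (var U) N h k - var U h k).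
Proof.
move=> + cU; elim: N h k => [|N IH] h k h0 /=; first by rewrite subrr !mulr0 addr0.
rewrite !IH ?half_gt0 // (var_split k h0 cU).
move: (haar _ _ _ _) (haar _ _ _ _) (tree_sum _ _ _ _) (tree_sum _ _ _ _) (var _ _ _) (var _ _ _)
  (dmean _ _ _) => a b c d e f g; lra.
Qed.

Variables (U : R -> R) (J : R * R -> R).
Hypothesis cU : continuous U.

(** The integrand of the jump form. *)
Definition jump_density (z : R * R) : R := (U z.1 - U z.2) ^+ 2 * J z.

(** J is c on the off-diagonal cells of side h, and increases by the factor 20/3
    when the side is halved. *)
Definition kernel_level h (c : R) :=
  forall j k z, dcell (h / 2 ^+ j) k z -> J z = c * (20 / 3) ^+ j.

Lemma kernel_level_half h c : kernel_level h c -> kernel_level (h / 2) (20 / 3 * c).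
Proof.
move=> H j k z zc; rewrite (H j.+1 k z) ?exprS; last by rewrite invfM mulrA.
by ring.
Qed.

Lemma kernel_level0 h c k z : kernel_level h c -> dcell h k z -> J z = c.
Proof. by move=> H zc; rewrite (H 0%N k) ?expr0 ?mulr1 // divr1. Qed.

Lemma measurable_density_dcell h c k : kernel_level h c ->
  measurable_fun (dcell h k) jump_density.
Proof.
move=> Hc; apply: (eq_measurable_fun (fun z : R * R => (U z.1 - U z.2) ^+ 2 * c)).
  by move=> z; rewrite inE => zc; rewrite /jump_density (kernel_level0 Hc zc).
apply: (measurable_funS measurableT) => //.
by apply: measurable_funM => //; exact: measurable_diff2.
Qed.

Lemma measurable_density N h c k : kernel_level h c ->
  measurable_fun (pieces N h k) jump_density.
Proof.
elim: N h c k => [|N IH] h c k Hc /=; first exact: measurable_fun_set0.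
have Hc' := kernel_level_half Hc.
apply/measurable_funU; first exact: measurable_dcell.
  by apply: measurableU; exact: measurable_pieces.
split; first exact: measurable_density_dcell Hc.
apply/measurable_funU; [exact: measurable_pieces | exact: measurable_pieces |].
by split; exact: IH Hc'.
Qed.

Lemma density_ge0 N h c k z : 0 <= c -> kernel_level h c -> pieces N h k z ->
  0 <= jump_density z.
Proof.
move=> + Hc; rewrite /jump_density; elim: N h c k Hc => //= N IH h c k Hc c0.
have Hc' := kernel_level_half Hc.
have c0' : 0 <= 20 / 3 * c by rewrite mulr_ge0 //; lra.
move=> [zc|[zl|zr]]; [|exact: IH Hc' c0' zl | exact: IH Hc' c0' zr].
by rewrite (kernel_level0 Hc zc) mulr_ge0 ?sqr_ge0.
Qed.

Lemma dcell_integral h c k : 0 < h -> 0 <= c -> kernel_level h c ->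
  (\int[mu2]_(z in dcell h k) (jump_density z)%:E =
  (c * h ^+ 2 * ((var U (h / 2) k.*2 + var U (h / 2) k.*2.+1 + dmean U h k ^+ 2) / 2))%:E)%E.
Proof.
move=> h0 c0 Hc.
transitivity (\int[mu2]_(z in dcell h k) (c%:E * ((U z.1 - U z.2) ^+ 2)%:E))%E.
  apply: eq_integral => z; rewrite inE => zc.
  by rewrite /jump_density (kernel_level0 Hc zc) -EFinM mulrC.
have md (D : set (R * R)) : measurable D ->
    measurable_fun D (fun z : R * R => ((U z.1 - U z.2) ^+ 2)%:E).
  move=> mD; apply/measurable_EFinP; apply: (measurable_funS measurableT) => //.
  exact: measurable_diff2.
rewrite ge0_integralZl //; [|exact: measurable_dcell|exact: md (measurable_dcell h k)|]; last first.
  by move=> z _; rewrite lee_fin sqr_ge0.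
have h20 := half_gt0 h0.
have mL := measurable_lft h k; have mR := measurable_rgt h k.
have aL := lft_averages k h0; have aR := rgt_averages k h0.
rewrite /dcell ge0_integral_setU //; first last.
- exact: dcell_disjoint2.
- by move=> z _; rewrite lee_fin sqr_ge0.
- exact: md (measurable_dcell h k).
- exact: measurableX.
- exact: measurableX.
rewrite (rectangle_integral h20 cU mR mL aR aL) (rectangle_integral h20 cU mL mR aL aR).
by rewrite -EFinD -EFinM /dmean; congr EFin; field.
Qed.

Lemma pieces_integral N h c k : 0 < h -> 0 <= c -> kernel_level h c ->
  (\int[mu2]_(z in pieces N h k) (jump_density z)%:E =
  (c * h ^+ 2 * piece_sum U N h k)%:E)%E.
Proof.
elim: N h c k => [|N IH] h c k h0 c0 Hc.
  by rewrite integral_set0 /= mulr0.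
have Hc' := kernel_level_half Hc.
have c0' : 0 <= 20 / 3 * c by rewrite mulr_ge0 //; lra.
have h20 := half_gt0 h0.
have mp := measurable_pieces N (h / 2).
have mf := @measurable_density N.+1 h c k Hc.
rewrite /= ge0_integral_setU //; first last.
- exact: dcell_disjoint.
- by move=> z zp; rewrite lee_fin; exact: (density_ge0 (N := N.+1) c0 Hc zp).
- by apply/measurable_EFinP.
- by apply: measurableU; exact: measurable_pieces.
- exact: measurable_dcell.
rewrite (dcell_integral k h0 c0 Hc) ge0_integral_setU //; first last.
- exact: pieces_disjoint.
- move=> z zp; rewrite lee_fin; apply: (density_ge0 (N := N.+1) (k := k) c0 Hc).
  by right.
- apply/measurable_EFinP; apply/measurable_funU; try exact: measurable_pieces.
  by split; exact: measurable_density Hc'.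
- exact: measurable_pieces.
- exact: measurable_pieces.
rewrite !(IH _ (20 / 3 * c)) // -!EFinD; congr EFin.
by move: (piece_sum _ _ _ _) (piece_sum _ _ _ _) => a b; field.
Qed.

End Rectangles.

(** * The jump form on the half-line *)

Section JumpForm.
Variable R : realType.
Implicit Types (u v U : R -> R) (M N k : nat) (K : set (R * R)).

Notation mu := (@lebesgue_measure R).
Notation mu2 := ((@lebesgue_measure R) \x (@lebesgue_measure R))%E.

Variable J : R * R -> R.
Hypothesis hJ : forall (n : int) (z : R * R),
  (\bigcup_(i in [set i : nat | (0 < i)%N]) cell n i) z ->
  J z = 35 / 16 * (14 / 17) * (20 / 3) ^ (n - 1).

(** The value of the kernel on the cells S_{n,i} with n = 1 - M, which consist
    of two squares of side 2^M / 2. *)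
Definition jump_coef M : R := 35 / 16 * (14 / 17) * (3 / 20) ^+ M.

Lemma jump_coef_ge0 M : 0 <= jump_coef M.
Proof. by rewrite /jump_coef mulr_ge0 ?exprn_ge0 //; lra. Qed.

(** [dcell (2^M / 2^j) k] is the cell S_{n,i} with n = j + 1 - M and i = k + 1.
    *)
Lemma J_level M : kernel_level J (2 ^+ M) (jump_coef M).
Proof.
move=> j k z zc.
(* S_{n,i} is made of squares of side 2^-n, and the squares in [dcell (2^M /
   2^j) k] have side 2^(M - j - 1). *)
pose n : int := j.+1%:Z - M%:Z.
have two_n : (2 : R) ^ n = 2 ^+ j.+1 / 2 ^+ M.
  by rewrite /n expfzDr // -exprnN.
have hE (q : R) : q / 2 ^ n = 2 ^+ M / 2 ^+ j / 2 * q.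
  by rewrite two_n exprS; field; rewrite !expf_neq0.
rewrite (hJ (n := n)).
  have -> : n - 1 = j%:Z - M%:Z by rewrite /n -addn1 PoszD addrAC addrK.
  have q0 : (20 / 3 : R) != 0 by apply: lt0r_neq0; lra.
  have -> : (20 / 3 : R) ^ (j%:Z - M%:Z) = (20 / 3) ^+ j * (3 / 20) ^+ M.
    by rewrite expfzDr // -exprnN -exprVn; congr (_ * _ ^+ _); field.
  by rewrite /jump_coef; ring.
exists k.+1 => //.
have dbl (q : nat) : q.*2%:R = 2 * q%:R :> R by rewrite -mul2n natrM.
have suc (q : nat) : q.+1%:R = q%:R + 1 :> R by rewrite -natr1.
have e0 : 2 * k.+1%:R - 2 = k.*2%:R :> R by rewrite dbl (suc k); ring.
have e1 : 2 * k.+1%:R - 1 = k.*2.+1%:R :> R by rewrite (suc k.*2) dbl (suc k); ring.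
have e2 : 2 * k.+1%:R = k.+1.*2%:R :> R by rewrite dbl.
case: zc => [[zr zl]|[zl zr]]; [left|right]; split => /=;
  move: zr zl; rewrite /rgt /lft /= !in_itv /= !hE ?e0 ?e1 ?e2 ?seg_double => zr zl //.
Qed.

(** The normalization of the kernel: its constants turn the coefficient 136/245
    of the dyadic energy in [piece_sumE] into (3/5)^M. *)
Lemma jump_coef_scale M : jump_coef M * (2 ^+ M) ^+ 2 * (136 / 245) = (3 / 5) ^+ M.
Proof.
rewrite /jump_coef; have -> : (3 / 5 : R) ^+ M = (3 / 20) ^+ M * (2 ^+ M) ^+ 2.
  by rewrite -exprM mulnC exprM -exprMn; congr (_ ^+ _); field.
by move: (_ ^+ M) (_ ^+ 2) => a b; field.
Qed.

(** The square [0, 2^M] x [0, 2^M] without its diagonal. *)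
Definition strict_square M : set (R * R) := \bigcup_N pieces N (2 ^+ M) 0.

Lemma strict_squareP M z : strict_square M z <->
  [/\ 0 <= z.1 <= 2 ^+ M, 0 <= z.2 <= 2 ^+ M & z.1 != z.2].
Proof.
have s0 : 0 < (2 : R) ^+ M by rewrite exprn_gt0.
split=> [[N _ /(pieces_sub s0)[/segP + /segP]]|[z1 z2 z12]].
  by rewrite mulr0 mulr1 => a b c.
have d0 : 0 < `|z.1 - z.2| by rewrite normr_gt0 subr_eq0.
have q01 : 0 <= (2^-1 : R) < 1 by lra.
have [N _ /(_ N (leqnn N)) /=] := geometric_lt (2 ^+ M) q01 d0.
rewrite exprVn => dN; exists N => //; rewrite [z]surjective_pairing.
by apply: pieces_cover => //; apply/segP; rewrite mulr0 mulr1.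
Qed.

Lemma measurable_strict_square M : measurable (strict_square M).
Proof. by apply: bigcup_measurable => N _; exact: measurable_pieces. Qed.

Lemma pieces_nd M : nondecreasing_seq (fun N => pieces N ((2 : R) ^+ M) 0).
Proof. by apply/nondecreasing_seqP => N; apply/subsetPset; exact: piecesS. Qed.

Lemma strict_square_nd : nondecreasing_seq strict_square.
Proof.
apply/nondecreasing_seqP => M; apply/subsetPset => z /strict_squareP[z1 z2 z12].
apply/strict_squareP; have : (2 : R) ^+ M <= 2 ^+ M.+1 by rewrite ler_eXn2l ?ltr1n.
by split => //; lra.
Qed.

Section OneFunction.
Variable U : R -> R.
Hypothesis cU : continuous U.
Hypothesis bU : forall M, haar_bounded U (2 ^+ M) 0.
Variable C : R.
Hypothesis sU : forall M, 2 ^+ M * mean (fun x => U x ^+ 2) (2 ^+ M) 0 <= C.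
Variable H : R.
Hypothesis HU : (fun M => (3 / 5) ^+ M * haar_sup U (2 ^+ M) 0) @ \oo --> H.

Let G := jump_density U J.

Lemma measurable_strict M : measurable_fun (strict_square M) G.
Proof.
apply/measurable_fun_bigcup => N; first exact: measurable_pieces.
exact: measurable_density (J_level (M := M)).
Qed.

Lemma strict_ge0 M z : strict_square M z -> 0 <= G z.
Proof. by move=> [N _ zN]; exact: density_ge0 (jump_coef_ge0 M) (J_level (M := M)) zN. Qed.

Lemma strict_square_integral M :
  (\int[mu2]_(z in strict_square M) (G z)%:E =
   ((3 / 5) ^+ M * haar_sup U (2 ^+ M) 0
    - 3 / 7 * (jump_coef M * (2 ^+ M) ^+ 2 * var U (2 ^+ M) 0))%:E)%E.
Proof.
have s0 : 0 < (2 : R) ^+ M by rewrite exprn_gt0.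
have c1 : (fun N => \int[mu2]_(z in pieces N (2 ^+ M) 0) (G z)%:E)%E @ \oo -->
    (\int[mu2]_(z in strict_square M) (G z)%:E)%E.
  apply: ge0_nondecreasing_set_cvg_integral.
  - exact: pieces_nd.
  - by move=> N; exact: measurable_pieces.
  - move=> N; apply/measurable_EFinP.
    exact: measurable_density (J_level (M := M)).
  - move=> N z zN; rewrite lee_fin.
    exact: density_ge0 (jump_coef_ge0 M) (J_level (M := M)) zN.
apply: (cvg_unique _ c1) => //.
have -> : (fun N => \int[mu2]_(z in pieces N (2 ^+ M) 0) (G z)%:E)%E =
    EFin \o (fun N => jump_coef M * (2 ^+ M) ^+ 2 * piece_sum U N (2 ^+ M) 0).
  apply/funext => N /=.
  by apply: pieces_integral => //; [exact: jump_coef_ge0 | exact: J_level].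
apply: cvg_EFin; first exact: nearW.
rewrite -(jump_coef_scale M).
have -> : jump_coef M * (2 ^+ M) ^+ 2 * (136 / 245) * haar_sup U (2 ^+ M) 0 -
    3 / 7 * (jump_coef M * (2 ^+ M) ^+ 2 * var U (2 ^+ M) 0) =
  jump_coef M * (2 ^+ M) ^+ 2 *
    (136 / 245 * haar_sup U (2 ^+ M) 0 + 3 / 7 * (0 - var U (2 ^+ M) 0)).
  by ring.
apply: cvgMl_tmp.
have -> : (fun N => piece_sum U N (2 ^+ M) 0) = (fun N => 136 / 245 * haar U N (2 ^+ M) 0
    + 3 / 7 * (tree_sum (var U) N (2 ^+ M) 0 - var U (2 ^+ M) 0)).
  by apply/funext => N; exact: piece_sumE.
apply: cvgD; apply: cvgMl_tmp; first exact: haar_sup_cvg.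
apply: cvgB; last exact: cvg_cst.
apply: (tree_sum_cvg0 (u := U) (c := 8 / 35)) => //.
  by move=> h k h0; exact: var_ge0.
by move=> h k h0; exact: var_le.
Qed.

(** The quadrant without its diagonal. *)
Definition off_diagonal : set (R * R) := \bigcup_M strict_square M.

Lemma measurable_off_diagonal : measurable off_diagonal.
Proof. by apply: bigcup_measurable => M _; exact: measurable_strict_square. Qed.

Lemma off_diagonalP z : off_diagonal z <->
  [/\ half_line z.1, half_line z.2 & z.1 != z.2].
Proof.
rewrite /half_line /= !in_itv /= !andbT; split.
  by move=> [M _ /strict_squareP[/andP[-> _] /andP[-> _] ->]].
move=> [z1 z2 z12].
have q01 : 0 <= (2^-1 : R) < 1 by lra.
have [M _ /(_ M (leqnn M)) /=] := geometric_lt (z.1 + z.2) q01 (@ltr01 R).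
rewrite exprVn ltr_pdivrMr ?exprn_gt0 // mul1r => zM.
by exists M => //; apply/strict_squareP; split => //; lra.
Qed.

Lemma off_diagonal_integral : (\int[mu2]_(z in off_diagonal) (G z)%:E = H%:E)%E.
Proof.
have c1 : (fun M => \int[mu2]_(z in strict_square M) (G z)%:E)%E @ \oo -->
    (\int[mu2]_(z in off_diagonal) (G z)%:E)%E.
  apply: ge0_nondecreasing_set_cvg_integral.
  - exact: strict_square_nd.
  - by move=> M; exact: measurable_strict_square.
  - by move=> M; apply/measurable_EFinP; exact: measurable_strict.
  - by move=> M z zM; rewrite lee_fin; exact: strict_ge0 zM.
apply: (cvg_unique _ c1) => //.
rewrite (_ : (fun M => _) = EFin \o (fun M => (3 / 5) ^+ M * haar_sup U (2 ^+ M) 0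
    - 3 / 7 * (jump_coef M * (2 ^+ M) ^+ 2 * var U (2 ^+ M) 0))); last first.
  by apply/funext => M; rewrite strict_square_integral.
apply: cvg_EFin; first exact: nearW.
rewrite -[X in _ --> X]subr0; apply: cvgB; first exact: HU.
rewrite -(mulr0 (3 / 7)); apply: cvgMl_tmp.
have g35 : (fun M : nat => 2 * C * (3 / 5) ^+ M) @ \oo --> (0 : R).
  rewrite -[X in _ --> X](mulr0 (2 * C)); apply: cvgMl_tmp; apply: cvg_expr.
  by rewrite ger0_norm; lra.
apply: (squeeze_cvgr _ (cvg_cst _) g35); apply: nearW => M.
have s0 : 0 < (2 : R) ^+ M by rewrite exprn_gt0.
have v0 := var_ge0 0 s0 cU.
rewrite mulr_ge0 //=; last by rewrite mulr_ge0 ?sqr_ge0 ?jump_coef_ge0.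
(* The variance over [0, 2^M] is at most the integral of U^2, and its
   coefficient is of order (3/5)^M. *)
have kE : jump_coef M * (2 ^+ M) ^+ 2 = 245 / 136 * (3 / 5) ^+ M.
  by rewrite -jump_coef_scale; move: (jump_coef M * _) => a; field.
have vle : var U (2 ^+ M) 0 <= C.
  have := sU M; have := sqr_ge0 (mean U (2 ^+ M) 0).
  have m0 : 0 <= mean (fun x => U x ^+ 2) (2 ^+ M) 0.
    by apply: mean_ge => // [|x _]; [exact: continuous_sqr | exact: sqr_ge0].
  have p1 : 1 <= (2 : R) ^+ M by rewrite exprn_ege1 // ler1n.
  have : mean (fun x => U x ^+ 2) (2 ^+ M) 0 <= 2 ^+ M * mean (fun x => U x ^+ 2) (2 ^+ M) 0.
    by rewrite ler_peMl.
  rewrite /var; lra.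
rewrite kE; have p0 : 0 <= (3 / 5 : R) ^+ M by rewrite exprn_ge0 //; lra.
have := ler_wpM2l p0 vle; have := mulr_ge0 p0 v0.
by move: (_ ^+ M) (var _ _ _) => a b; lra.
Qed.

Lemma measurable_off : measurable_fun off_diagonal G.
Proof.
apply/measurable_fun_bigcup => M; first exact: measurable_strict_square.
exact: measurable_strict.
Qed.

Lemma off_ge0 z : off_diagonal z -> 0 <= G z.
Proof. by move=> [M _ zM]; exact: strict_ge0 zM. Qed.

Lemma measurable_half_square : measurable (half_line (R := R) `*` half_line (R := R)).
Proof. by apply: measurableX; exact: measurable_itv. Qed.

Lemma measurable_square : measurable_fun (half_line (R := R) `*` half_line (R := R)) G.
Proof.
have mO := measurable_off_diagonal.
have mS := measurable_half_square.
have -> : half_line (R := R) `*` half_line (R := R) =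
    off_diagonal `|` ((half_line (R := R) `*` half_line (R := R)) `\` off_diagonal).
  rewrite setDUK // => z /off_diagonalP[z1 z2 _]; by split.
apply/measurable_funU; [exact: mO | exact: measurableD |].
split; first exact: measurable_off.
apply: (eq_measurable_fun (fun _ : R * R => 0 : R)); last exact: measurable_cst.
move=> z; rewrite inE => -[[z1 z2] nz]; rewrite /G /jump_density.
have [->|z12] := eqVneq z.1 z.2; first by rewrite subrr expr0n mul0r.
by case: nz; apply/off_diagonalP.
Qed.

Lemma square_integral :
  (\int[mu2]_(z in half_line (R := R) `*` half_line (R := R)) (G z)%:E = H%:E)%E.
Proof.
rewrite -off_diagonal_integral integral_mkcond [RHS]integral_mkcond.
apply: eq_integral => z _; rewrite !patchE.
case: ifPn => [/set_mem[z1 z2]|zn].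
  case: ifPn => // /negP zo; rewrite /G /jump_density.
  have [->|z12] := eqVneq z.1 z.2; first by rewrite subrr expr0n mul0r.
  by case: zo; apply/mem_set/off_diagonalP.
case: ifPn => // /set_mem/off_diagonalP[z1 z2 _].
by move: zn; rewrite notin_setE => -[].
Qed.

Lemma square_ge0 z : half_line z.1 -> half_line z.2 -> 0 <= G z.
Proof.
move=> z1 z2; have [z12|z12] := eqVneq z.1 z.2.
  by rewrite /G /jump_density z12 subrr expr0n mul0r.
by apply: off_ge0; apply/off_diagonalP.
Qed.

Lemma square_integrable :
  mu2.-integrable (half_line (R := R) `*` half_line (R := R)) (EFin \o G).
Proof.
apply/integrableP; split; first by apply/measurable_EFinP; exact: measurable_square.
rewrite (_ : integral _ _ _ = H%:E) ?ltry // -square_integral.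
apply: eq_integral => z /set_mem[z1 z2] /=.
by rewrite ger0_norm // square_ge0.
Qed.

End OneFunction.

(** The integrals of U^2 over the intervals [0, 2^M] are bounded. *)
Definition square_bounded U := exists C, forall M,
  2 ^+ M * mean (fun x => U x ^+ 2) (2 ^+ M) 0 <= C.

Lemma square_bounded_comb U V c : continuous U -> continuous V -> c ^+ 2 = 1 ->
  square_bounded U -> square_bounded V -> square_bounded (fun x => U x + c * V x).
Proof.
move=> cU cV c1 [C HC] [D HD]; exists (2 * C + 2 * D) => M.
have s0 : 0 < (2 : R) ^+ M by rewrite exprn_gt0.
have cU2 := continuous_sqr cU; have cV2 := continuous_sqr cV.
have cUV : continuous (fun x => U x + c * V x).
  by move=> x; apply: cvgD; [exact: cU | apply: cvgMl_tmp; exact: cV].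
have c2U : continuous (fun x => 2 * U x ^+ 2) by move=> x; apply: cvgMl_tmp; exact: cU2.
have c2V : continuous (fun x => 2 * V x ^+ 2) by move=> x; apply: cvgMl_tmp; exact: cV2.
have : mean (fun x => (U x + c * V x) ^+ 2) (2 ^+ M) 0 <=
    mean ((fun x => 2 * U x ^+ 2) \+ (fun x => 2 * V x ^+ 2)) (2 ^+ M) 0.
  apply: le_mean => //; first exact: continuous_sqr.
    by move=> x; apply: cvgD; [exact: c2U | exact: c2V].
  move=> x _ /=; have := young (U x) (V x) (@ltr01 R) c1; rewrite invr1; lra.
rewrite (meanD _ _ c2U c2V) (meanZ _ _ _ cU2) (meanZ _ _ _ cV2).
have := HC M; have := HD M => h1 h2 h3.
apply: le_trans (ler_wpM2l (ltW s0) h3) _; lra.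
Qed.

Lemma L2_square_bounded u : continuous (mirror u) -> L2 u -> square_bounded (mirror u).
Proof.
move=> cu [mu_u lt_u].
have I0 : (0 <= \int[mu]_(x in @half_line R) (u x ^+ 2)%:E)%E.
  by apply: integral_ge0 => x _; rewrite lee_fin sqr_ge0.
exists (fine (\int[mu]_(x in @half_line R) (u x ^+ 2)%:E)%E) => M.
have s0 : 0 < (2 : R) ^+ M by rewrite exprn_gt0.
rewrite -lee_fin fineK ?ge0_fin_numE //.
rewrite -(seg_averages 0 s0 (continuous_sqr cu)).
have sub : seg ((2 : R) ^+ M) 0 `<=` half_line (R := R).
  by move=> x /segP; rewrite mulr0 /half_line /= in_itv /= => /andP[->].
have -> : (\int[mu]_(x in seg (2 ^+ M) 0) (mirror u x ^+ 2)%:E =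
    \int[mu]_(x in seg (2 ^+ M) 0) (u x ^+ 2)%:E)%E.
  apply: eq_integral => x /set_mem/sub; rewrite /half_line /= in_itv /= andbT => x0.
  by rewrite /mirror ger0_norm.
apply: ge0_subset_integral => //.
- exact: measurable_seg.
- exact: measurable_itv.
- by apply/measurable_EFinP; apply: measurable_funX.
- by move=> x _; rewrite lee_fin sqr_ge0.
Qed.

Lemma limit_energy_cvg K u : is_gasket K -> FI K u ->
  (fun M => (3 / 5) ^+ M * haar_sup (mirror u) (2 ^+ M) 0) @ \oo --> limit_energy u.
Proof.
move=> gK Fu.
have b M := FI_haar_bounded M gK Fu.
have p0 M : 0 < (3 / 5 : R) ^+ M by rewrite exprn_gt0 //; lra.
have le_H M : (3 / 5) ^+ M * haar_sup (mirror u) (2 ^+ M) 0 <= limit_energy u.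
  rewrite mulrC -ler_pdivlMr //; apply: haar_sup_le => N; rewrite ler_pdivlMr // mulrC.
  exact: limit_energy_ge gK Fu.
have nd : nondecreasing_seq (fun M => (3 / 5) ^+ M * haar_sup (mirror u) (2 ^+ M) 0).
  apply/nondecreasing_seqP => M; rewrite exprSr -mulrA ler_pM2l //.
  rewrite (haar_supE (b M.+1)) exprSr mulfK //.
  have := haar_sup_ge0 (haar_bounded_right (b M.+1)); rewrite exprSr mulfK //.
  have := sqr_ge0 (dmean (mirror u) (2 ^+ M * 2) 0).
  rewrite /=; move: (haar_sup _ _ _) (haar_sup _ _ _) (_ ^+ 2) => x y z; lra.
have ub : has_ubound (range (fun M => (3 / 5) ^+ M * haar_sup (mirror u) (2 ^+ M) 0)).
  by exists (limit_energy u) => _ [M _ <-].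
have -> : limit_energy u = sup (range (fun M => (3 / 5) ^+ M * haar_sup (mirror u) (2 ^+ M) 0)).
  apply/eqP; rewrite eq_le; apply/andP; split.
    apply: ge_sup; first exact: energy_set_neq0.
    move=> _ [M [N ->]]; apply: (@le_trans _ _ ((3 / 5) ^+ M * haar_sup (mirror u) (2 ^+ M) 0)).
      by rewrite ler_pM2l // haar_le_haar_sup.
    by apply: ub_le_sup => //; exists M.
  apply: ge_sup; first by eexists; exists 0%N.
  by move=> _ [M _ <-].
exact: nondecreasing_cvgn.
Qed.

(** The integrand of the jump form of u. *)
Definition jump_form u (z : R * R) : R := (u z.1 - u z.2) ^+ 2 * J z.

Lemma jump_form_mirror u z : half_line z.1 -> half_line z.2 ->
  jump_density (mirror u) J z = jump_form u z.
Proof.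
rewrite /half_line /= !in_itv /= !andbT => z1 z2.
by rewrite /jump_density /jump_form /mirror !ger0_norm.
Qed.

(** The jump form of u is its limiting dyadic energy. *)
Lemma jump_form_integral K u : is_gasket K -> FI K u -> square_bounded (mirror u) ->
  mu2.-integrable (half_line (R := R) `*` half_line (R := R)) (EFin \o jump_form u) /\
  (\int[mu2]_(z in half_line (R := R) `*` half_line (R := R)) (jump_form u z)%:E =
   (limit_energy u)%:E)%E.
Proof.
move=> gK Fu [C HC].
have [f Ff fu] : exists2 f, finite_energy K f & extends f u by apply/FIP.
have cU := continuous_mirror gK Ff fu.
have b M := FI_haar_bounded M gK Fu.
have cH := limit_energy_cvg gK Fu.
have mS := measurable_half_square.
split.
  have := square_integrable cU b HC cH; apply: eq_integrable; first exact: mS.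
  by move=> z /set_mem[z1 z2] /=; rewrite jump_form_mirror.
rewrite -(square_integral cU b HC cH); apply: eq_integral => z /set_mem[z1 z2].
by rewrite jump_form_mirror.
Qed.

End JumpForm.

Theorem theorem1p2 (R : realType) (K : set (R * R)) (hK : is_gasket K)
    (J : R * R -> R)
    (hJ : forall (n : int) (z : R * R),
       (\bigcup_(i in [set i : nat | (0 < i)%N]) cell n i) z ->
       J z = 35 / 16 * (14 / 17) * (20 / 3) ^ (n - 1))
    (u v : R -> R) (hu : DI K u) (hv : DI K v) :
  ((lebesgue_measure \x lebesgue_measure)%E.-integrable
      (@half_line R `*` @half_line R)
      (fun z : R * R => ((u z.1 - u z.2) * (v z.1 - v z.2) * J z)%:E)) /\
  (polar (EI K) u v)%:E =
    (\int[lebesgue_measure]_(y in @half_line R)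
       \int[lebesgue_measure]_(x in @half_line R)
         ((u x - u y) * (v x - v y) * J (x, y))%R%:E)%E.
Proof.
have Au := DI_approximable hu; have Av := DI_approximable hv.
have cont w : FI K w -> continuous (mirror w).
  by move=> /FIP[f Ff fw]; exact: continuous_mirror hK Ff fw.
have bu := L2_square_bounded (cont _ Au.1) hu.1.2.
have bv := L2_square_bounded (cont _ Av.1) hv.1.2.
(* The quadratic identity for u + v and for u - v. *)
have form c : c ^+ 2 = 1 ->
    EI K (fun x => u x + c * v x) = (limit_energy (fun x => u x + c * v x))%:E /\
    (lebesgue_measure \x lebesgue_measure)%E.-integrable (@half_line R `*` @half_line R)
      (EFin \o jump_form J (fun x => u x + c * v x)) /\
    (\int[(lebesgue_measure \x lebesgue_measure)%E]_(z in @half_line R `*` @half_line R)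
      (jump_form J (fun x => u x + c * v x) z)%:E = (limit_energy (fun x => u x + c * v x))%:E)%E.
  move=> c1; have A := approximable_comb c1 Au Av.
  split; first exact: EI_approximable.
  apply: (jump_form_integral hJ hK A.1).
  exact: square_bounded_comb (cont _ Au.1) (cont _ Av.1) c1 bu bv.
have [Ep [ip Ip]] := form 1 (expr1n R 2).
have [Em [im Im]] := form (-1) (sqrN1 R).
set wp := (fun x => u x + 1 * v x) in Ep ip Ip.
set wm := (fun x => u x + -1 * v x) in Em im Im.
have wpE : u \+ v = wp by apply/funext => x; rewrite /wp mul1r.
have wmE : u \- v = wm by apply/funext => x; rewrite /wm mulN1r.
pose S := @half_line R `*` @half_line R.
have mS : measurable S by exact: measurable_half_square.
pose F z : R := (u z.1 - u z.2) * (v z.1 - v z.2) * J z.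
have FE : (fun z => (F z)%:E) = (fun z => (4^-1)%:E *
    (((EFin \o jump_form J wp) \- (EFin \o jump_form J wm)) z)%E)%E.
  apply/funext => z; rewrite /= -EFinB -EFinM; congr EFin.
  by rewrite /jump_form /wp /wm /F; field.
have iB : (lebesgue_measure \x lebesgue_measure)%E.-integrable S
    ((EFin \o jump_form J wp) \- (EFin \o jump_form J wm))%E.
  by apply: integrableB; [exact: mS | exact: ip | exact: im].
have iF : (lebesgue_measure \x lebesgue_measure)%E.-integrable S (fun z => (F z)%:E).
  by rewrite FE; apply: integrableZl; [exact: mS | exact: iB].
split; first exact: iF.
transitivity (\int[(lebesgue_measure \x lebesgue_measure)%E]_(z in S) (F z)%:E)%E.
  rewrite FE integralZl; [|exact: mS|exact: iB].
  rewrite integralB; [|exact: mS|exact: ip|exact: im].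
  rewrite Ip Im -EFinB -EFinM /polar.
  by rewrite wpE wmE Ep Em.
rewrite integral_mkcond.
have iT : (lebesgue_measure \x lebesgue_measure)%E.-integrable setT
    ((fun z => (F z)%:E) \_ S).
  by apply/(integrable_mkcond _ _).1; [exact: mS | exact: iF].
(* Fubini's theorem, for functions extended by 0 to the plane. *)
rewrite -integral21_prod_meas1 //.
rewrite [RHS]integral_mkcond; apply: eq_integral => y _.
rewrite /fubini_G patchE; case: ifPn => yX.
  rewrite [RHS]integral_mkcond; apply: eq_integral => x _.
  by rewrite !patchE in_setX /= yX andbT.
by apply: integral0_eq => x _; rewrite patchE in_setX /= (negbTE yX) andbF.
Qed.
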